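(* Let $(\mathbf{X}_i,Y_i)_{i\ge 1}$ be i.i.d. with $\mathbf{X}_i\in\mathcal{X}\subset\mathbb{R}^p$, $Y_i\in\mathbb{R}$ and $\mathbb{E}[Y\mid \mathbf{X}=\mathbf{x}]=f_0(\mathbf{x})$, where $f_0:\mathcal{X}\to\mathbb{R}$ is convex, and let $M\ge 1$ be a fixed integer. For each $n$ and $m=1,\dots,M$, let $(\mathbf{x}^{(m)}_{1:n},\mathbf{y}^{(m)}_{1:n})$ be a bagged training set: $n$ pairs drawn uniformly at random with replacement from $(\mathbf{x}_i,y_i)_{i=1}^n$. Let $\hat f(\,\cdot\mid \mathbf{x}^{(m)}_{1:n},\mathbf{y}^{(m)}_{1:n})$ be the CAP estimator (defined in the context) trained on the $m$-th bagged set, with final partition $\{A^{(m)}_k\}_{k=1}^{K^{(m)}_n}$ and index subsets $C^{(m)}_k$ (indices $i$ of the $m$-th bagged set with $\mathbf{x}^{(m)}_i\in A^{(m)}_k$). Assume $\mathbb{E}[Y^2\mid \mathbf{X}=\mathbf{x}]<\infty$ a.s. for all $\mathbf{x}\in\mathcal{X}$, and: A1. $\mathcal{X}$ is compact, and $f_0$ is Lipschitz continuous (with Lipschitz parameter $\zeta$) and continuously differentiable on $\mathcal{X}$. A2. There is $a>0$ such that $\mathbb{E}\left[e^{a|Y-f_0(\mathbf{x})|}\mid \mathbf{X}=\mathbf{x}\right]$ is bounded on $\mathcal{X}$. A3. For $m=1,\dots,M$, $\max_k d^{(m)}_{nk}\to 0$ in probability as $n\to\infty$. A4. Let $\lambda^{(m)}_k$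 be the smallest eigenvalue of $|C^{(m)}_k|^{-1}G^{(m)}_k$ and $\lambda^{(m)}_n=\min_k\lambda^{(m)}_k$. For $m=1,\dots,M$, $\lambda^{(m)}_n$ remains bounded away from $0$ in probability as $n\to\infty$. A5. For $m=1,\dots,M$, $\min_{k=1,\dots,K^{(m)}_n} \big(d^{(m)}_{nk}\big)^2|C^{(m)}_k|/\log(n)\to\infty$ in probability as $n\to\infty$. (The quantities $d^{(m)}_{nk}$ and $G^{(m)}_k$ are defined in the context.) Then $$\sup_{\mathbf{x}\in\mathcal{X}}\left|\frac1M\sum_{m=1}^M\hat f(\mathbf{x}\mid \mathbf{x}^{(m)}_{1:n},\mathbf{y}^{(m)}_{1:n})-f_0(\mathbf{x})\right|\to 0$$ in probability as $n\to\infty$.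
   Context: Convexity of $f_0$ on $\mathcal{X}$: $\lambda f_0(\mathbf{x}_1)+(1-\lambda)f_0(\mathbf{x}_2)\ge f_0(\lambda\mathbf{x}_1+(1-\lambda)\mathbf{x}_2)$ for all $\mathbf{x}_1,\mathbf{x}_2\in\mathcal{X}$, $\lambda\in(0,1)$ (so $\mathcal{X}$ is convex). The resampling is independent of the data given the data set. CAP (Convex Adaptive Partitioning) estimator. Input: data $(\mathbf{x}_i,y_i)_{i=1}^n$. Fix $L\ge1$, evenly spaced knots $0<a_1<\dots<a_L<1$, a constant $D>0$, and minimum subset size $n_{\min}=\max\{n/(D\log n),\,2(p+1)\}$. A model of size $K$ consists of a partition $A_1,\dots,A_K$ of $\mathcal{X}$, index subsets $C_k=\{i:\mathbf{x}_i\in A_k\}$, and for each $k$ a least squares hyperplane $(\alpha_k,\beta_k)\in\arg\min_{\alpha\in\mathbb{R},\beta\in\mathbb{R}^p}\sum_{i\in C_k}(y_i-\alpha-\beta^T\mathbf{x}_i)^2$; it defines the function $\mathbf{x}\mapsto\max_{k}\{\alpha_k+\beta_k^T\mathbf{x}\}$. 1. Start with $K=1$, $A_1=\mathcal{X}$. 2. Split: for each subset $k$, each cardinal direction $j=1,\dots,p$ and each knot $a_\ell$, form the candidate model obtained by splitting $A_k$ into $\{\mathbf{x}\in A_k: x_j\le b\}$ and $\{\mathbf{x}\in A_k:x_j>b\}$, where $b=a_\ell\min_{i\in C_k}x_{ij}+(1-a_\ell)\max_{i\in C_k}x_{ij}$, and refitting the hyperplanes. Among candidates with all $|C_k|\ge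 n_{\min}$, keep the one minimizing the training mean squared error of its max-of-hyperplanes function; increase $K$ by one. 3. Refit: consider the partition induced by the hyperplanes of the current model, with cells where $\alpha_k+\beta_k^T\mathbf{x}$ attains the maximum (ties broken by a fixed rule), and refit hyperplanes by least squares on it; replace the current model by this one if all its subsets have at least $n_{\min}$ observations. The resulting model is $\mathcal{M}_K$. 4. Stop when every subset has fewer than $2n_{\min}$ observations; otherwise return to step 2. 5. Select the size $K_n$ among the models $\mathcal{M}_1,\mathcal{M}_2,\dots$ by a data-dependent model-size criterion (generalized cross-validation). The CAP estimator is $\hat f(\mathbf{x})=\max_{k=1,\dots,K_n}\{\alpha_k+\beta_k^T\mathbf{x}\}$ for the selected model; its partition $\{A_k\}$ and subsets $C_k$ are those of the selected model. Quantities attached to a partition (a superscript $(m)$ indicates they are computed for the $m$-th estimator from its training set): diameter $d_{nk}=\sup_{\mathbf{x}_1,\mathbf{x}_2\in A_k}\|\mathbf{x}_1-\mathbf{x}_2\|_2$; empirical mean $\bar{\mathbf{x}}_k=|C_k|^{-1}\sum_{i\in C_k}\mathbf{x}_i$; for $i\in C_k$, $\Gamma_i=\begin{bmatrix}1\\ d_{nk}^{-1}(\mathbf{x}_i-\bar{\mathbf{x}}_k)\end{bmatrix}\in\mathbb{R}^{p+1}$; and $G_k=\sum_{i\in C_k}\Gamma_i\Gamma_i^T$. ''Bounded away from $0$ in probability'' means there is $c>0$ with $\Pr(\lambda^{(m)}_n\ge c)\to1$. ''$Z_n\to\infty$ in probability'' means $\Pr(Z_n>t)\to1$ for every $t$.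 *)

(* Defs.v *)
From HB Require Import structures.
From mathcomp Require Import all_boot all_order all_algebra.
From mathcomp Require Import all_classical all_reals all_analysis.
From mathcomp Require Import measurable_realfun.

Set Implicit Arguments.
Unset Strict Implicit.
Unset Printing Implicit Defensive.

Import Order.TTheory GRing.Theory Num.Theory numFieldNormedType.Exports.

Local Open Scope classical_set_scope.
Local Open Scope ring_scope.

Section Euclidean.
Context {R : realType} {p : nat}.
Implicit Types (x y u v : 'rV[R]_p) (A : set 'rV[R]_p).

Definition dotv u v : R := \sum_(j < p) u ord0 j * v ord0 j.

(* The norm [`| v |] of the library on row vectors is the sup norm. *)
Definition norm2 v : R := Num.sqrt (dotv v v).

Definition diameter A : R := sup [set norm2 (x - y) | x in A & y in A].

Definition lipschitz_on2 (zeta : R) A (f : 'rV[R]_p -> R) : Prop :=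
  forall x y, A x -> A y -> `|f x - f y| <= zeta * norm2 (x - y).

(* Continuous differentiability of a function given on a set that may have
   boundary points, or no interior: derivatives are taken relative to [A]. *)
Definition continuously_differentiable_on A (f : 'rV[R]_p -> R) : Prop :=
  exists g : 'rV[R]_p -> 'rV[R]_p,
    {within A, continuous g} /\
    forall x, A x -> forall e : R, 0 < e ->
      exists2 delta : R, 0 < delta &
        forall y, A y -> norm2 (y - x) < delta ->
          `|f y - f x - dotv (g x) (y - x)| <= e * norm2 (y - x).

End Euclidean.

(* Maximum and minimum over a nonempty list; [R] having no neutral element for
   them, the iteration starts at the value of the head. *)
Definition seq_max {R : realType} {I : Type} (i0 : I) (s : seq I) (F : I -> R) : R :=
  \big[Num.max/F (head i0 s)]_(i <- s) F i.
Definition seq_min {R : realType} {I : Type} (i0 : I) (s : seq I) (F : I -> R) : R :=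
  \big[Num.min/F (head i0 s)]_(i <- s) F i.

Definition borel (S : topologicalType) : set (set S) := <<s (@open S) >>.

Section Probability.
Context {R : realType} {d : measure_display} {T : measurableType d}.
Variable P : probability T R.

(* "[E n] holds with probability tending to 1".  The events about the CAP
   estimator involve unspecified choices among minimizers and suprema over
   uncountable sets, and need not be measurable; their inner probability is
   used.  See [whpE] for measurable events. *)
Definition whp (E : nat -> set T) : Prop :=
  exists F : nat -> set T,
    [/\ forall n, measurable (F n),
        forall n, F n `<=` E n
      & (P \o F) n @[n --> \oo] --> 1%E].

Lemma whpE (E : nat -> set T) : (forall n, measurable (E n)) ->
  whp E <-> (P \o E) n @[n --> \oo] --> 1%E.
Proof.
move=> mE; split=> [[F [mF FE PF1]]|PE1]; last by exists E; split=> // n; exact: subset_refl.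
apply: (squeeze_cvge _ PF1 (cvg_cst 1%E)).
apply: nearW => n /=; rewrite probability_le1// andbT.
by rewrite le_measure ?inE//; exact: FE.
Qed.

Definition cvg_in_prob (Z : nat -> T -> R) (l : R) : Prop :=
  forall e : R, 0 < e -> whp (fun n => [set w | `|Z n w - l| <= e]).

Definition cvg_pinfty_in_prob (Z : nat -> T -> R) : Prop :=
  forall t : R, whp (fun n => [set w | t < Z n w]).

Definition bounded_away_from_0_in_prob (Z : nat -> T -> R) : Prop :=
  exists2 c : R, 0 < c & whp (fun n => [set w | c <= Z n w]).

Definition iid (S : topologicalType) (W : nat -> T -> S) : Prop :=
  [/\ forall i B, borel B -> measurable (W i @^-1` B),
      forall i B, borel B -> P (W i @^-1` B) = P (W 0%N @^-1` B)
    & forall (N : nat) (B : nat -> set S), (forall i, borel (B i)) ->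
        P (\bigcap_(i in `I_N) (W i @^-1` B i)) =
        (\prod_(i < N) P (W i @^-1` B i))%E].

(* [J] is uniform on the [n ^ n] maps from ['I_n] to itself, that is, it draws
   [n] indices uniformly with replacement, and is independent of [W]. *)
Definition uniform_resampling (S : topologicalType) (W : nat -> T -> S)
    (n : nat) (J : T -> {ffun 'I_n -> 'I_n}) : Prop :=
  forall j : {ffun 'I_n -> 'I_n},
    measurable (J @^-1` [set j]) /\
    forall (N : nat) (B : nat -> set S), (forall i, borel (B i)) ->
      P (\bigcap_(i in `I_N) (W i @^-1` B i) `&` J @^-1` [set j]) =
      (P (\bigcap_(i in `I_N) (W i @^-1` B i)) * ((n ^ n)%N%:R^-1)%:E)%E.

(* [h] is a version on [A] of x |-> E[Z | V = x], where [V] takes its values in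
   [A] and [Z] is integrable, or measurable and nonnegative. *)
Definition cond_expectation (p : nat) (A : set 'rV[R]_p) (V : T -> 'rV[R]_p)
    (Z : T -> \bar R) (h : 'rV[R]_p -> \bar R) : Prop :=
  measurable_fun (A : set (g_sigma_algebraType (@open 'rV[R]_p))) h /\
  (forall B : set 'rV[R]_p, borel B ->
    \int[P]_(w in V @^-1` B) Z w = \int[P]_(w in V @^-1` B) h (V w))%E.

End Probability.

Section CAP.
Context {R : realType} {p : nat}.

Definition dataset (n : nat) := 'I_n -> 'rV[R]_p * R.

(* [(alpha, beta)] stands for x |-> alpha + beta^T x. *)
Definition hyperplane : Type := (R * 'rV[R]_p)%type.
Definition hval (h : hyperplane) (x : 'rV[R]_p) : R := h.1 + dotv h.2 x.
Definition max_affine (hs : seq hyperplane) (x : 'rV[R]_p) : R :=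
  seq_max (0 : R * 'rV[R]_p) hs (hval ^~ x).

Definition rss n (z : dataset n) (C : {set 'I_n}) (h : hyperplane) : R :=
  \sum_(i in C) ((z i).2 - hval h (z i).1) ^+ 2.

Definition solver := forall n : nat, dataset n -> {set 'I_n} -> hyperplane.
Definition least_squares_solver (ls : solver) : Prop :=
  forall n (z : dataset n) (C : {set 'I_n}) (h : hyperplane),
    rss z C (ls n z C) <= rss z C h.

(* The observations in a cell. *)
Definition obs n (z : dataset n) (A : set 'rV[R]_p) : {set 'I_n} :=
  finset (fun i : 'I_n => `[< A (z i).1 >]).

Definition evenly_spaced_knots (L : nat) (a : 'I_L -> R) : Prop :=
  (forall l, 0 < a l < 1) /\
  exists a0 h : R, 0 < h /\ forall l : 'I_L, a l = a0 + h * l%:R.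

Section Algorithm.
Variables (X : set 'rV[R]_p) (L : nat) (a : 'I_L -> R) (D : R).
(* Least squares hyperplanes need not be unique, hence a fixed selection [ls];
   then a model is determined by its partition. *)
Variable ls : solver.
(* [tb] picks an index among the indices of the maximizing hyperplanes. *)
Variable tb : seq nat -> nat.
Variable crit : forall n, dataset n -> seq (set 'rV[R]_p) -> R.
Variables (n : nat) (z : dataset n).

Definition nmin : R :=
  Num.max (n%:R / (D * ln n%:R)) (2 * p.+1)%N%:R.

Definition cap_hyperplanes (As : seq (set 'rV[R]_p)) : seq hyperplane :=
  [seq ls z (obs z A) | A <- As].

Definition cap_fun (As : seq (set 'rV[R]_p)) : 'rV[R]_p -> R :=
  max_affine (cap_hyperplanes As).

Definition mse (As : seq (set 'rV[R]_p)) : R :=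
  n%:R^-1 * \sum_(i < n) ((z i).2 - cap_fun As (z i).1) ^+ 2.

Definition large_cells (As : seq (set 'rV[R]_p)) : bool :=
  all (fun A => nmin <= #|obs z A|%:R) As.

Definition split_level (A : set 'rV[R]_p) (j : 'I_p) (l : 'I_L) : R :=
  let s := [set (z i).1 ord0 j | i in [set i : 'I_n | A (z i).1]] in
  a l * inf s + (1 - a l) * sup s.

Definition split_cell (As : seq (set 'rV[R]_p)) (k : nat) (j : 'I_p) (l : 'I_L) :
    seq (set 'rV[R]_p) :=
  let A := nth set0 As k in
  let b := split_level A j l in
  take k As ++ [:: A `&` [set x | x ord0 j <= b]; A `&` [set x | b < x ord0 j]]
    ++ drop k.+1 As.

Definition admissible_split (As Bs : seq (set 'rV[R]_p)) : Prop :=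
  (exists k j l, (k < size As)%N /\ Bs = split_cell As k j l) /\ large_cells Bs.

Definition best_split (As Bs : seq (set 'rV[R]_p)) : Prop :=
  admissible_split As Bs /\
  forall Bs', admissible_split As Bs' -> mse Bs <= mse Bs'.

Definition maximizers (hs : seq hyperplane) (x : 'rV[R]_p) : seq nat :=
  [seq k <- iota 0 (size hs) | hval (nth 0 hs k) x == max_affine hs x].

Definition refit_partition (As : seq (set 'rV[R]_p)) : seq (set 'rV[R]_p) :=
  let hs := cap_hyperplanes As in
  [seq X `&` [set x | tb (maximizers hs x) = k] | k <- iota 0 (size hs)].

Definition refit (As : seq (set 'rV[R]_p)) : seq (set 'rV[R]_p) :=
  if large_cells (refit_partition As) then refit_partition As else As.

Definition cap_step (As As' : seq (set 'rV[R]_p)) : Prop :=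
  exists2 Bs, best_split As Bs & As' = refit Bs.

(* When all cells have fewer than [2 * nmin] observations there is no
   admissible split; the algorithm also stops if there is none otherwise. *)
Definition stopped (As : seq (set 'rV[R]_p)) : Prop :=
  all (fun A => #|obs z A|%:R < 2 * nmin) As \/
  ~ exists Bs, admissible_split As Bs.

(* [Ms] lists the partitions of the models M_1, M_2, ... of a full run. *)
Definition cap_run (Ms : seq (seq (set 'rV[R]_p))) : Prop :=
  [/\ (0 < size Ms)%N,
      nth [::] Ms 0 = [:: X],
      forall k, (k.+1 < size Ms)%N ->
        ~ stopped (nth [::] Ms k) /\ cap_step (nth [::] Ms k) (nth [::] Ms k.+1)
    & stopped (nth [::] Ms (size Ms).-1)].

Definition cap_partition (As : seq (set 'rV[R]_p)) : Prop :=
  exists2 Ms, cap_run Ms &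
    exists K, [/\ (K < size Ms)%N, As = nth [::] Ms K
      & forall K', (K' < size Ms)%N ->
          crit z (nth [::] Ms K) <= crit z (nth [::] Ms K')].

End Algorithm.

Section Cells.
Variables (n : nat) (z : dataset n).
Implicit Type A : set 'rV[R]_p.

Definition cell_mean A : 'rV[R]_p :=
  #|obs z A|%:R^-1 *: \sum_(i in obs z A) (z i).1.

Definition Gam A (i : 'I_n) : 'cV[R]_(1 + p) :=
  col_mx 1%:M ((diameter A)^-1 *: ((z i).1 - cell_mean A))^T.

Definition gram A : 'M[R]_(1 + p) :=
  \sum_(i in obs z A) Gam A i *m (Gam A i)^T.

(* A real symmetric matrix of positive size has a nonempty finite set of real
   eigenvalues. *)
Definition smallest_eigenvalue (q : nat) (B : 'M[R]_q) : R :=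
  inf [set l : R | eigenvalue B l].

Definition lambda_cell A : R :=
  smallest_eigenvalue (#|obs z A|%:R^-1 *: gram A).

Definition max_diameter (As : seq (set 'rV[R]_p)) : R :=
  seq_max set0 As diameter.

Definition min_lambda (As : seq (set 'rV[R]_p)) : R :=
  seq_min set0 As lambda_cell.

Definition min_scaled_size (As : seq (set 'rV[R]_p)) : R :=
  seq_min set0 As
    (fun A => diameter A ^+ 2 * #|obs z A|%:R / ln n%:R).

End Cells.

End CAP.

Arguments dataset : clear implicits.
Arguments solver : clear implicits.

(* The training set with indices [J w], drawn from the first [n] observations. *)
Definition bagged {R : realType} {p : nat} {T : Type}
    (x : nat -> T -> 'rV[R]_p) (y : nat -> T -> R)
    (n : nat) (J : T -> {ffun 'I_n -> 'I_n}) (w : T) : dataset R p n :=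
  fun i => (x (J w i) w, y (J w i) w).

(* Main.v *)
(* A fitted hyperplane reproduces f0 on its cell up to a bias controlled by the
   diameter (A1, A3) and a stochastic error; by A4 the latter is small as
   soon as the sum of the residuals Y - f0(X) over C_k, and over the part of C_k
   beyond any axis-parallel hyperplane (Abel summation), is o(|C_k| d_nk).
   Convexity of f0 then bounds the maximum of the hyperplanes from above on all of
   X, and the hyperplane of its own cell bounds it from below at a point.

   The difficulty is uniformity over the cells. They are pairwise separated by
   hyperplanes, but a cell may have up to D ln n neighbours, so that the entropy of
   the class of all possible cells is of order (ln n)^2, whereas A5 only pays for
   ln n. Two facts repair this.  By A4 and A5 a cell is cut out by far fewer
   halfspaces: near it, cells that are not much thinner are few by a packing
   argument, and thinner ones are few because A5 makes them heavy.  And halfspaces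
   may be replaced by elements of a net of polylogarithmic size: given the traces
   of all halfspaces on the covariates, an intersection of F halfspaces costs an
   entropy of F ln ln n only, while the replacement error is a set of n / polylog(n)
   observations, for which a cruder union bound suffices.

   Separating hyperplanes do not tell to which cell the observations lying on them
   belong.  These are few, since almost surely no hyperplane contains more than p
   of the X_i: by A3 and A4 hyperplanes are null for the law of X. *)
Require Import Defs.
From HB Require Import structures.
From mathcomp Require Import all_boot all_order all_algebra.
From mathcomp Require Import zify lra ring.

Set Implicit Arguments.
Unset Strict Implicit.
Unset Printing Implicit Defensive.

Import Order.TTheory GRing.Theory Num.Theory.

(** * Shattering and nets of set systems *)

(** Conditioning on the covariates is done without conditional laws. The events [traces = H] form a
    finite measurable partition; on each of them the net and all intersections of traces are
    deterministic, every bad event is bounded by a constant times P(traces = H), and summing over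
    [H] costs nothing. The noise is only subexponential, and truncating it at order ln n would
    destroy its centring. Averaging over the resampling yields exp(sum (exp(t eps) - 1)). Truncation
    is used only to compare this pointwise with a majorant [ghat], whose product is then integrated
    over the untruncated event, where the mean of the noise still vanishes. Three scales enter: q of
    order ln n, a net of resolution q^-6, and tau = ln ln n for the ratio of diameters below which a
    neighbouring cell counts as thin. A halfspace costs ln q, of order tau, while thin neighbours
    are fewer by tau^2. Separation of the cells needs few observations on hyperplanes, hence general
    position, hence null hyperplanes; that last fact is derived from mere disjointness of the cells,
    so there is no circle. *)

Section SauerShelah.
Variable T : finType.
Implicit Types (H : {set {set T}}) (A B S : {set T}).

Definition shatters H A : bool :=
  [forall B : {set T}, (B \subset A) ==> [exists S in H, S :&: A == B]].

Lemma shattersP H A :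
  reflect (forall B, B \subset A -> exists2 S, S \in H & S :&: A = B) (shatters H A).
Proof.
apply: (iffP forallP) => [h B BA|h B].
  by have /existsP[S /andP[SH /eqP]] := implyP (h B) BA; exists S.
by apply/implyP => /h[S SH <-]; apply/existsP; exists S; rewrite SH eqxx.
Qed.

Lemma shattersS H1 H2 A : H1 \subset H2 -> shatters H1 A -> shatters H2 A.
Proof.
move=> H12 /shattersP h; apply/shattersP => B /h[S SH <-]; exists S => //.
exact: (subsetP H12).
Qed.

(** Pajor's form of the Sauer-Shelah lemma. Split [H] by membership of a point [x] on which two
    members differ. A set shattered by one half avoids [x]; a set shattered by both halves counts
    twice, since adding [x] to it gives another set shattered by [H]. *)
Lemma card_le_shattered H : #|H| <= #|[set A | shatters H A]|.
Proof.
have [m] := ubnP #|H|; elim: m H => // m IH H Hm.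
have [H1|] := leqP #|H| 1.
  have [->|[S SH]] := set_0Vmem H; first by rewrite cards0.
  rewrite (leq_trans H1)// card_gt0; apply/set0Pn; exists set0; rewrite inE.
  by apply/shattersP => B; rewrite subset0 => /eqP ->; exists S; rewrite ?setI0.
move=> /card_gt1P[S1 [S2 [S1H S2H S12]]].
have [x xS] : exists x, (x \in S1) != (x \in S2).
  apply/existsP; apply: contraNT S12 => /existsPn h.
  by apply/eqP/setP => x; have := h x; rewrite negbK => /eqP.
pose H1 := [set S in H | x \in S]; pose H0 := [set S in H | x \notin S].
have HE : #|H| = #|H1| + #|H0|.
  rewrite -(cardsID H1 H); congr (_ + _); apply: eq_card => S; rewrite !inE.
    by rewrite andbA andbb.
  by case: (S \in H); rewrite /= ?andbT ?andbF.
have H10 : 0 < #|H1|.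
  apply/card_gt0P; case: (boolP (x \in S1)) xS => xS1 xS.
    by exists S1; rewrite inE S1H.
  by exists S2; rewrite inE S2H; case: (x \in S2) xS.
have H00 : 0 < #|H0|.
  apply/card_gt0P; case: (boolP (x \in S1)) xS => xS1 xS; last by exists S1; rewrite inE S1H.
  by exists S2; rewrite inE S2H; case: (x \in S2) xS.
pose s1 := [set A | shatters H1 A]; pose s0 := [set A | shatters H0 A].
have xs1 A : A \in s1 -> x \notin A.
  rewrite inE => /shattersP h; apply/negP => xA.
  have [S] := h set0 (sub0set _); rewrite inE => /andP[_ xS'] /setP /(_ x).
  by rewrite !inE xS' xA.
have xs0 A : A \in s0 -> x \notin A.
  rewrite inE => /shattersP h; apply/negP => xA.
  have [S] := h A (subxx _); rewrite inE => /andP[_ /negbTE xS'] /setP /(_ x).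
  by rewrite !inE xS' xA.
have le1 : #|H1| <= #|s1| by apply: IH; lia.
have le0 : #|H0| <= #|s0| by apply: IH; lia.
rewrite HE (leq_trans (leq_add le1 le0))// -cardsUI.
pose g A := x |: A.
have -> : #|s1 :&: s0| = #|g @: (s1 :&: s0)|.
  rewrite card_in_imset// => A B /setIP[/xs1 xA _] /setIP[/xs1 xB _] /(congr1 (fun A => A :\ x)).
  by rewrite /g !setU1K.
have dis : [disjoint s1 :|: s0 & g @: (s1 :&: s0)].
  apply/pred0P => A; apply/negbTE/negP => /andP[/setUP As] /imsetP[B _ AE].
  by case: As => [/xs1|/xs0]; rewrite AE setU11.
move: dis; rewrite -leq_card_setU => /eqP <-; apply: subset_leq_card.
apply/subsetP => A /setUP[/setUP[]|/imsetP[B /setIP[]]].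
- by rewrite !inE; apply: shattersS; apply/subsetP => S; rewrite inE => /andP[].
- by rewrite !inE; apply: shattersS; apply/subsetP => S; rewrite inE => /andP[].
move=> Bs1 Bs0 ->; rewrite inE; apply/shattersP => C CB.
have [xB xB'] := (xs1 _ Bs1, xs0 _ Bs0).
move: Bs1 Bs0; rewrite !inE => /shattersP h1 /shattersP h0.
have CxB : C :\ x \subset B.
  by apply/subsetP => y /setD1P[yx yC]; move/subsetP: CB => /(_ _ yC) /setU1P[/eqP|//]; rewrite (negbTE yx).
have [xC|xC] := boolP (x \in C).
  have [S] := h1 _ CxB; rewrite inE => /andP[SH xS'] SB; exists S => //.
  rewrite setIUr SB; have -> : S :&: [set x] = [set x] by apply/setIidPr; rewrite sub1set.
  exact: setD1K.
have [S] := h0 _ CxB; rewrite inE => /andP[SH xS'] SB; exists S => //.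
rewrite setIUr SB; have -> : S :&: [set x] = set0.
  by apply/setP => y; rewrite !inE; apply/andP => -[yS /eqP yx]; rewrite yx (negbTE xS') in yS.
by rewrite set0U; apply/setDidPl; rewrite disjoint_sym disjoints1.
Qed.

Lemma card_small_sets d : #|[set A : {set T} | #|A| <= d]| <= #|T|.+1 ^ d.
Proof.
pose f (t : d.-tuple (option T)) : {set T} := [set x | Some x \in t].
have /subset_leq_card : [set A : {set T} | #|A| <= d] \subset f @: [set: d.-tuple (option T)].
  apply/subsetP => A; rewrite inE => Ad.
  have st : size (map some (enum A) ++ nseq (d - #|A|) None) == d.
    by rewrite size_cat size_map -cardE size_nseq subnKC.
  apply/imsetP; exists (Tuple st) => //; apply/setP => x; rewrite inE /=.
  rewrite mem_cat mem_map ?mem_enum; last by move=> ? ? [].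
  by rewrite mem_nseq andbF orbF.
move=> /leq_trans; apply; rewrite (leq_trans (leq_imset_card _ _))// cardsT card_tuple.
by rewrite card_option.
Qed.

Lemma sauer_shelah H d : (forall A, shatters H A -> #|A| <= d) -> #|H| <= #|T|.+1 ^ d.
Proof.
move=> Hd; apply: leq_trans (card_le_shattered _) _; apply: leq_trans (card_small_sets d).
by apply/subset_leq_card/subsetP => A; rewrite !inE => /Hd.
Qed.

Definition symdiff A B : {set T} := (A :\: B) :|: (B :\: A).

Lemma symdiffC A B : symdiff A B = symdiff B A.
Proof. by rewrite /symdiff setUC. Qed.

Lemma symdiffxx A : symdiff A A = set0.
Proof. by rewrite /symdiff setDv setU0. Qed.

(** A maximal family of pairwise distant members is also a net, as an uncovered member could be
    added. Distances are measured in units of [#|T| / D], multiplied out to stay in the integers. *)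
Lemma exists_net H D : exists2 N : {set {set T}}, N \subset H &
  (forall A B, A \in N -> B \in N -> A != B -> #|T| <= D * #|symdiff A B|) /\
  (forall A, A \in H -> exists2 B, B \in N & D * #|symdiff A B| <= #|T|).
Proof.
pose P := [pred N : {set {set T}} | (N \subset H) &&
  [forall A in N, forall B in N, (A != B) ==> (#|T| <= D * #|symdiff A B|)]].
have P0 : P set0 by rewrite /= sub0set; apply/forall_inP => A; rewrite inE.
have [N /maxsetP[/andP[NH /forall_inP Nsep] Nmax] _] := maxset_exists P0.
have sep A B : A \in N -> B \in N -> A != B -> #|T| <= D * #|symdiff A B|.
  by move=> AN BN AB; have /forall_inP /(_ _ BN) := Nsep _ AN; rewrite AB.
exists N => //; split=> // A AH.
have [AN|AN] := boolP (A \in N); first by exists A; rewrite // symdiffxx cards0 muln0.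
have [/exists_inP[B BN hB]|/exists_inPn h] := boolP [exists B in N, D * #|symdiff A B| <= #|T|].
  by exists B.
suff /Nmax : P (A |: N) by move=> /(_ (subsetUr _ _)) /setP /(_ A); rewrite setU11 (negbTE AN).
rewrite /= subUset sub1set AH NH /=; apply/forall_inP => B Bi; apply/forall_inP => C Ci.
apply/implyP => BC; case/setU1P: Bi BC => [->|BN]; case/setU1P: Ci => [->|CN] BC.
- by rewrite eqxx in BC.
- by have := h _ CN; rewrite -ltnNge => /ltnW.
- by have := h _ BN; rewrite -ltnNge symdiffC => /ltnW.
- exact: sep.
Qed.

End SauerShelah.

Lemma leq_card_bigcup (I T : finType) (P : pred I) (F : I -> {set T}) :
  #|\bigcup_(i | P i) F i| <= \sum_(i | P i) #|F i|.
Proof.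
elim/big_rec2: _ => [|i m A _ le]; first by rewrite cards0.
by rewrite (leq_trans (leq_card_setU _ _))// leq_add2l.
Qed.

(** This is (1 - 1/D)^D <= 1/2: the first two terms of the expansion of ((D - 1) + 1)^D already
    amount to at least 2 (D - 1)^D. *)
Lemma expn_pred_half D : 0 < D -> 2 * D.-1 ^ D <= D ^ D.
Proof.
case: D => // m _ /=; rewrite -[X in _ <= X ^ _]addn1 expnDn big_ord_recl big_ord_recl /=.
rewrite /bump /= bin0 bin1 !exp1n !muln1 subn0 mul1n mul2n -addnn leq_add2l.
by apply: leq_trans (leq_addr _ _); rewrite expnS leq_mul// subn1.
Qed.

(* Union bound over the pairs: [D * k] random points all miss a set of at least
   [#|T| / D] points with probability at most [2 ^- k]. *)
Lemma separating_sample (T : finType) (N : {set {set T}}) (D k : nat) : 0 < D ->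
  #|N| ^ 2 < 2 ^ k ->
  (forall A B, A \in N -> B \in N -> A != B -> #|T| <= D * #|symdiff A B|) ->
  (0 < #|T|) ->
  exists f : {ffun 'I_(D * k) -> T}, {in N &, injective (fun A : {set T} => f @^-1: A)}.
Proof.
move=> D0 Nk sep T0.
pose bad (AB : {set T} * {set T}) := [set f : {ffun 'I_(D * k) -> T} | f \in ffun_on (~: symdiff AB.1 AB.2)].
pose prs := [set AB : {set T} * {set T} | [&& AB.1 \in N, AB.2 \in N & AB.1 != AB.2]].
have bad_card AB : AB \in prs -> 2 ^ k * #|bad AB| <= #|T| ^ (D * k).
  rewrite inE => /and3P[AN BN ABne].
  have -> : #|bad AB| = #|~: symdiff AB.1 AB.2| ^ (D * k).
    by rewrite cardsE card_ffun_on card_ord.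
  have hs := sep _ _ AN BN ABne; have -> := cardsCs (~: symdiff AB.1 AB.2); rewrite setCK.
  have : D * (#|T| - #|symdiff AB.1 AB.2|) <= #|T| * D.-1.
    case: D D0 hs {sep bad prs} => // D' _ hs /=; by rewrite mulnBr leq_subLR mulSn mulnC leq_add2r.
  rewrite -(leq_exp2r _ _ (_ : 0 < D)) // => h.
  rewrite !expnM -expnMn; case: k {Nk bad} => // k; rewrite leq_exp2r//.
  rewrite -(leq_pmul2l (_ : 0 < D ^ D)) ?expn_gt0 ?D0// mulnCA -expnMn.
  rewrite (leq_trans (leq_mul (leqnn 2) h))// expnMn mulnCA.
  by rewrite [leqRHS]mulnC leq_mul2l expn_pred_half// orbT.
have cardprs : #|prs| <= #|N| ^ 2.
  rewrite expnS expn1 -cardsX; apply/subset_leq_card/subsetP => -[A B].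
  by rewrite !inE /= => /and3P[-> ->].
have lt : #|\bigcup_(AB in prs) bad AB| < #|T| ^ (D * k).
  rewrite -(ltn_pmul2l (_ : 0 < 2 ^ k)) ?expn_gt0//.
  apply: (@leq_ltn_trans (#|N| ^ 2 * #|T| ^ (D * k))); last by rewrite ltn_pmul2r// expn_gt0 T0.
  apply: (@leq_trans (2 ^ k * \sum_(AB in prs) #|bad AB|)).
    by rewrite leq_mul2l leq_card_bigcup orbT.
  rewrite big_distrr /=; apply: (@leq_trans (\sum_(AB in prs) #|T| ^ (D * k))); first exact: leq_sum.
  by rewrite sum_nat_const leq_mul2r cardprs orbT.
have /existsP[f fbad] : [exists f, f \notin \bigcup_(AB in prs) bad AB].
  apply: contraLR lt => /existsPn h; rewrite -leqNgt.
  rewrite -[X in _ ^ X](card_ord (D * k)) -card_ffun; apply/subset_leq_card/subsetP => f _.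
  by have := h f; rewrite negbK.
exists f => A B AN BN fAB; apply/eqP; apply: contraNT fbad => AB.
apply/bigcupP; exists (A, B); rewrite ?inE/= ?AN ?BN ?AB//.
apply/ffun_onP => i; rewrite !inE; have /setP /(_ i) := fAB; rewrite !inE => ->.
by case: (_ \in B).
Qed.

From mathcomp Require Import all_classical all_reals all_analysis.
From mathcomp Require Import measurable_realfun.

Import numFieldNormedType.Exports.

Local Open Scope classical_set_scope.
Local Open Scope ring_scope.

(** * Halfspaces and their traces on finite point sets *)

Section DotProduct.
Context {R : realType} {p : nat}.
Implicit Types (u v w : 'rV[R]_p) (c : R).

Lemma dotvC u v : dotv u v = dotv v u.
Proof. by apply: eq_bigr => j _; rewrite mulrC. Qed.

Lemma dotvDl u v w : dotv (u + v) w = dotv u w + dotv v w.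
Proof. by rewrite -big_split; apply: eq_bigr => j _; rewrite mxE mulrDl. Qed.

Lemma dotvDr u v w : dotv u (v + w) = dotv u v + dotv u w.
Proof. by rewrite !(dotvC u) dotvDl. Qed.

Lemma dotvZl c u v : dotv (c *: u) v = c * dotv u v.
Proof. by rewrite mulr_sumr; apply: eq_bigr => j _; rewrite mxE mulrA. Qed.

Lemma dotvZr c u v : dotv u (c *: v) = c * dotv u v.
Proof. by rewrite !(dotvC u) dotvZl. Qed.

Lemma dotvNl u v : dotv (- u) v = - dotv u v.
Proof. by rewrite -scaleN1r dotvZl mulN1r. Qed.

Lemma dotvNr u v : dotv u (- v) = - dotv u v.
Proof. by rewrite !(dotvC u) dotvNl. Qed.

Lemma dotvBl u v w : dotv (u - v) w = dotv u w - dotv v w.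
Proof. by rewrite dotvDl dotvNl. Qed.

Lemma dotvBr u v w : dotv u (v - w) = dotv u v - dotv u w.
Proof. by rewrite dotvDr dotvNr. Qed.

Lemma dotv0l v : dotv 0 v = 0.
Proof. by rewrite -(scale0r 0) dotvZl mul0r. Qed.

Lemma dotv0r v : dotv v 0 = 0.
Proof. by rewrite dotvC dotv0l. Qed.

Lemma dotv_suml (I : Type) (r : seq I) (P : pred I) (F : I -> 'rV[R]_p) v :
  dotv (\sum_(i <- r | P i) F i) v = \sum_(i <- r | P i) dotv (F i) v.
Proof. by apply: (big_morph (dotv^~ v)) => [x y|]; rewrite ?dotvDl ?dotv0l. Qed.

Lemma dotv_sumr (I : Type) (r : seq I) (P : pred I) (F : I -> 'rV[R]_p) v :
  dotv v (\sum_(i <- r | P i) F i) = \sum_(i <- r | P i) dotv v (F i).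
Proof. by rewrite dotvC dotv_suml; apply: eq_bigr => i _; rewrite dotvC. Qed.

Lemma dotv_ge0 v : 0 <= dotv v v.
Proof. by apply: sumr_ge0 => j _; rewrite -expr2 sqr_ge0. Qed.

Lemma dotv_eq0 v : (dotv v v == 0) = (v == 0).
Proof.
rewrite psumr_eq0 => [|j _]; last by rewrite -expr2 sqr_ge0.
apply/allP/eqP => [h|-> j _]; last by rewrite mxE mul0r eqxx.
apply/rowP => j; have := h j; rewrite mem_index_enum => /(_ isT).
by rewrite mulf_eq0 orbb mxE => /eqP.
Qed.

Lemma norm2_ge0 v : 0 <= norm2 v.
Proof. exact: sqrtr_ge0. Qed.

Lemma norm2_sqr v : norm2 v ^+ 2 = dotv v v.
Proof. by rewrite sqr_sqrtr// dotv_ge0. Qed.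

Lemma norm2_eq0 v : (norm2 v == 0) = (v == 0).
Proof. by rewrite sqrtr_eq0 -dotv_eq0 eq_le dotv_ge0 andbT. Qed.

Lemma norm2_gt0 v : (0 < norm2 v) = (v != 0).
Proof. by rewrite lt_neqAle norm2_ge0 andbT eq_sym norm2_eq0. Qed.

Lemma norm20 : norm2 (0 : 'rV[R]_p) = 0.
Proof. by apply/eqP; rewrite norm2_eq0. Qed.

Lemma norm2Z c v : norm2 (c *: v) = `|c| * norm2 v.
Proof.
by rewrite /norm2 dotvZl dotvZr mulrA -expr2 sqrtrM ?sqr_ge0// sqrtr_sqr.
Qed.

Lemma norm2N v : norm2 (- v) = norm2 v.
Proof. by rewrite -scaleN1r norm2Z normrN1 mul1r. Qed.

Lemma cauchy_schwarz u v : `|dotv u v| <= norm2 u * norm2 v.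
Proof.
have [->|v0] := eqVneq v 0; first by rewrite dotv0r normr0 norm20 mulr0.
have vv : 0 < dotv v v by rewrite lt_neqAle dotv_ge0 andbT eq_sym dotv_eq0.
rewrite -sqrtrM ?dotv_ge0// -sqrtr_sqr ler_wsqrtr//.
have := dotv_ge0 (dotv v v *: u - dotv u v *: v).
rewrite !(dotvBl, dotvBr, dotvZl, dotvZr) (dotvC v u).
set A := dotv u u; set B := dotv v v; set C := dotv u v => h.
suff : 0 <= B * (A * B - C ^+ 2) by rewrite pmulr_rge0// subr_ge0.
by apply: le_trans h _; rewrite le_eqVlt; apply/orP; left; apply/eqP; ring.
Qed.

Lemma norm2D u v : norm2 (u + v) <= norm2 u + norm2 v.
Proof.
rewrite -(ler_pXn2r (_ : 0 < 2)%N) ?nnegrE ?norm2_ge0 ?addr_ge0 ?norm2_ge0//.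
rewrite norm2_sqr sqrrD !norm2_sqr dotvDl !dotvDr (dotvC v u).
have := le_trans (ler_norm _) (cauchy_schwarz u v).
by move=> h; lra.
Qed.

Lemma norm2_sum (I : Type) (r : seq I) (P : pred I) (F : I -> 'rV[R]_p) :
  norm2 (\sum_(i <- r | P i) F i) <= \sum_(i <- r | P i) norm2 (F i).
Proof.
elim/big_ind2: _ => [|x1 x2 y1 y2 h1 h2|//]; first by rewrite norm20.
exact: le_trans (norm2D _ _) (lerD h1 h2).
Qed.

Lemma coord_le_norm2 v j : `|v ord0 j| <= norm2 v.
Proof.
rewrite -sqrtr_sqr ler_wsqrtr// /dotv (bigD1 j)//= -expr2 lerDl.
by apply: sumr_ge0 => k _; rewrite -expr2 sqr_ge0.
Qed.

Lemma norm2_le_coord v (c : R) : (forall j, `|v ord0 j| <= c) ->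
  norm2 v <= Num.sqrt p%:R * c.
Proof.
move=> h; have [p0|p0] := posnP p.
  subst p; rewrite /norm2 /dotv big_ord0 sqrtr0 mul0r; exact: lexx.
have c0 : 0 <= c by apply: le_trans (h (Ordinal p0)).
rewrite -[X in _ * X](ger0_norm c0) -sqrtr_sqr -sqrtrM// ler_wsqrtr//.
have -> : p%:R * c ^+ 2 = \sum_(j < p) c ^+ 2 by rewrite sumr_const card_ord mulr_natl.
apply: ler_sum => j _.
by rewrite -expr2 -real_normK ?num_real// lerXn2r ?nnegrE.
Qed.

Lemma dotv_delta v j : dotv (delta_mx ord0 j) v = v ord0 j.
Proof.
rewrite /dotv (bigD1 j)//= mxE !eqxx mul1r big1 ?addr0// => k kj.
by rewrite mxE (negbTE kj) andbF mul0r.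
Qed.

Lemma delta_row_neq0 (j : 'I_p) : delta_mx ord0 j != 0 :> 'rV[R]_p.
Proof.
by apply/eqP => /rowP /(_ j); rewrite !mxE !eqxx => /eqP; rewrite oner_eq0.
Qed.

End DotProduct.

Section HalfspaceTraces.
Context {R : realType} {p : nat}.

(** [v = 0] is allowed, so the empty and the full set are traces, and the noise of a whole cell
    needs no separate treatment. *)
Definition halfspace_trace (I : finType) (x : I -> 'rV[R]_p) (S : {set I}) : Prop :=
  exists v b, forall a, (a \in S) = (b < dotv v (x a)).

Definition traces (I : finType) (x : I -> 'rV[R]_p) : {set {set I}} :=
  finset (fun S => `[< halfspace_trace x S >]).

Lemma tracesP (I : finType) (x : I -> 'rV[R]_p) (S : {set I}) :
  reflect (halfspace_trace x S) (S \in traces x).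
Proof. by rewrite inE; exact: asboolP. Qed.

(* Radon's argument: [p + 2] points satisfy an affine relation [c], and a
   halfspace cannot contain exactly those with [c > 0]. *)
Lemma shatters_traces (I : finType) (x : I -> 'rV[R]_p) (A : {set I}) :
  shatters (traces x) A -> (#|A| <= p.+1)%N.
Proof.
move=> /shattersP sh; rewrite leqNgt; apply/negP => Ap.
pose B := \matrix_(i < #|A|, j < 1 + p) row_mx (1%:M : 'M[R]_1) (x (enum_val i)) ord0 j.
have /rowV0Pn[c /sub_kermxP cB c0] : kermx B != 0.
  rewrite -mxrank_eq0 mxrank_ker subn_eq0 -ltnNge.
  by rewrite (leq_ltn_trans (rank_leq_col _))// add1n.
have B0 i : B i (lshift p ord0) = 1 by rewrite mxE row_mxEl mxE.
have Bj i j : B i (rshift 1 j) = x (enum_val i) ord0 j by rewrite mxE row_mxEr.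
have aff v b : \sum_i c ord0 i * (dotv v (x (enum_val i)) - b) = 0.
  have /(congr1 (fun M => M *m (row_mx (- b)%:M v : 'rV[R]_(1 + p))^T)) : c *m B = 0 by [].
  rewrite mul0mx -mulmxA => /matrixP /(_ ord0 ord0); rewrite mxE [RHS]mxE => h.
  rewrite -[RHS]h; apply: eq_bigr => i _; congr (_ * _).
  rewrite mxE big_split_ord /= big_ord1 B0 [in RHS]mxE row_mxEl mxE eqxx mulr1n mul1r addrC.
  by congr (_ + _); apply: eq_bigr => j _; rewrite Bj mxE row_mxEr mulrC.
pose B' := enum_val @: finset (fun i : 'I_#|A| => 0 < c ord0 i).
have BA : B' \subset A.
  by apply/fintype.subsetP => _ /imsetP[i _ ->]; exact: enum_valP.
have [S /tracesP[v [b vb]] SA] := sh _ BA.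
have SE i : (0 < c ord0 i) = (b < dotv v (x (enum_val i))).
  have /setP /(_ (enum_val i)) := SA.
  rewrite inE enum_valP andbT -vb => ->; apply/idP/imsetP => [ci|[k]]; first by exists i; rewrite ?inE.
  by rewrite inE => ck /enum_val_inj ->.
have c_le0 i : c ord0 i <= 0.
  rewrite leNgt; apply/negP => ci; have := aff v b; apply/eqP; rewrite gt_eqF//.
  rewrite (bigD1 i)//= ltr_pwDl//; first by rewrite mulr_gt0// subr_gt0 -SE.
  apply: sumr_ge0 => k _; have [ck|ck] := ltP 0 (c ord0 k).
    by rewrite mulr_ge0 ?(ltW ck)// subr_ge0 ltW// -SE.
  by rewrite mulr_le0// subr_le0 leNgt -SE -leNgt.
case/negP: c0; apply/eqP/rowP => i; rewrite mxE.
have := aff 0 (- 1); under eq_bigr do rewrite dotv0l opprK add0r mulr1.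
move=> /(congr1 -%R) /eqP; rewrite oppr0 -sumrN psumr_eq0 => [/allP /(_ i)|k _].
  by rewrite mem_index_enum oppr_eq0 => /(_ isT) /eqP.
by rewrite oppr_ge0.
Qed.

Lemma card_traces (I : finType) (x : I -> 'rV[R]_p) : (#|traces x| <= #|I|.+1 ^ p.+1)%N.
Proof. by apply: sauer_shelah => A; exact: shatters_traces. Qed.

Lemma traces_preim (I I' : finType) (x : I -> 'rV[R]_p) (f : I' -> I) (S : {set I}) :
  S \in traces x -> f @^-1: S \in traces (x \o f).
Proof. by move=> /tracesP[v [b h]]; apply/tracesP; exists v, b => a; rewrite inE h. Qed.

(** Haussler's packing argument. A few random points tell the members of a separated family apart,
    so the family is no larger than the set of halfspace traces on these points, to which
    Sauer-Shelah applies. The bound depends on [n] only through [q]. *)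
Lemma traces_net (n q D : nat) (x : 'I_n -> 'rV[R]_p) : (0 < D)%N -> (0 < n < 2 ^ q)%N ->
  exists N : {set {set 'I_n}}, [/\ N \subset traces x,
    (#|N| <= (D * (2 * p.+1 * q).+1).+1 ^ p.+1)%N &
    forall A, A \in traces x -> exists2 B, B \in N & (D * #|symdiff A B| <= n)%N].
Proof.
move=> D0 /andP[n0 nq]; have [N NH [sep cov]] := exists_net (traces x) D.
rewrite card_ord in sep cov; exists N; split=> //.
have Nn : (#|N| <= 2 ^ (p.+1 * q))%N.
  rewrite mulnC expnM (leq_trans (subset_leq_card NH))// (leq_trans (card_traces x))//.
  by rewrite card_ord leq_exp2r.
(* [N] has at most 2^((p+1) q) members; squaring for the pairs gives the exponent 2 (p+1) q, and one
   more makes the inequality strict. *)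
have [|||f finj] := @separating_sample _ N D (2 * p.+1 * q).+1 D0.
- have -> : (2 * p.+1 * q = p.+1 * q * 2)%N by rewrite -mulnA mulnC.
  rewrite [X in (_ < X)%N]expnS expnM (@leq_ltn_trans ((2 ^ (p.+1 * q)) ^ 2))%N ?leq_exp2r//.
  by rewrite ltn_Pmull// !expn_gt0.
- by rewrite card_ord.
- by rewrite card_ord.
rewrite -(card_in_imset finj).
apply: (@leq_trans #|traces (x \o f)|); last first.
  by rewrite (leq_trans (card_traces _))// card_ord.
apply/subset_leq_card/fintype.subsetP => _ /imsetP[A AN ->]; apply: traces_preim.
exact: (fintype.subsetP NH).
Qed.

End HalfspaceTraces.

(** * Independence and resampling *)

Local Open Scope ereal_scope.

Section Independence.
Context {R : realType} {d : measure_display} {T : measurableType d}.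
Variable P : probability T R.

Lemma indep_integral d1 d2 (T1 : measurableType d1) (T2 : measurableType d2)
    (U : T -> T1) (V : T -> T2) :
  measurable_fun setT U -> measurable_fun setT V ->
  (forall A B, measurable A -> measurable B ->
    P (U @^-1` A `&` V @^-1` B) = P (U @^-1` A) * P (V @^-1` B)) ->
  forall F : T1 * T2 -> \bar R, measurable_fun setT F -> (forall z, 0 <= F z) ->
  \int[P]_w F (U w, V w) = \int[P]_w \int[P]_w' F (U w, V w').
Proof.
move=> mU mV ind F mF F0.
pose Um : {mfun T >-> T1} := mfun_Sub (mem_set mU).
pose Vm : {mfun T >-> T2} := mfun_Sub (mem_set mV).
have mUV : measurable_fun setT (fun w => (U w, V w)) by exact: measurable_fun_pair.
pose UVm : {mfun T >-> (T1 * T2)%type} := mfun_Sub (mem_set mUV).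
transitivity (\int[distribution P UVm]_z F z).
  by rewrite ge0_integral_pushforward ?preimage_setT.
transitivity (\int[distribution P Um \x distribution P Vm]_z F z).
  apply: eq_measure_integral => A mA _; apply/esym/product_measure_unique => //.
rewrite fubini_tonelli1//.
rewrite ge0_integral_pushforward ?preimage_setT//=.
- apply: eq_integral => w _; rewrite /fubini_F /=.
  rewrite ge0_integral_pushforward ?preimage_setT//.
  exact: measurableT_comp.
- exact: measurable_fun_fubini_tonelli_F.
- by move=> y _; apply: integral_ge0.
Qed.

Variables (d' : measure_display) (E : measurableType d') (W : nat -> T -> E).
Hypothesis mW : forall i, measurable_fun setT (W i).
Hypothesis indW : forall (N : nat) (B : nat -> set E), (forall i, measurable (B i)) ->
  P (\bigcap_(i in `I_N) (W i @^-1` B i)) = \prod_(i < N) P (W i @^-1` B i).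

(** Finite-dimensional events that leave the [k]-th coordinate free: a pi-system for the
    sigma-algebra of all other observations. Equipping [T] itself with that sigma-algebra permits
    Fubini between one observation and all the others. *)
Definition cylinders (k : nat) : set (set T) :=
  [set A | exists (N : nat) (B : nat -> set E), [/\ forall i, measurable (B i), B k = setT
    & A = \bigcap_(i in `I_N) (W i @^-1` B i)]].

Definition off_algebra (k : nat) := g_sigma_algebraType (cylinders k).

Lemma cylinders_measurable k : cylinders k `<=` measurable.
Proof.
move=> _ [N [B [mB _ ->]]]; apply: bigcap_measurableType => i _.
by rewrite -[X in measurable X]setTI; exact: mW.
Qed.

Lemma off_algebra_measurable k : <<s cylinders k >> `<=` measurable.
Proof. exact: (smallest_sub (@sigma_algebra_measurable _ T) (@cylinders_measurable k)). Qed.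

Lemma measurable_off_algebra k i : i != k ->
  measurable_fun setT (W i : off_algebra k -> E).
Proof.
move=> ik _ B mB; rewrite setTI; apply: sub_sigma_algebra.
exists i.+1, (fun j => if j == i then B else setT); split.
- by move=> j; case: ifP.
- by rewrite eq_sym (negbTE ik).
- apply/seteqP; split=> [w Bw j /= _|w /(_ i (ltnSn i))]; last by rewrite eqxx.
  by case: (eqVneq j i) => [->//|_]; exact: I.
Qed.

Lemma measurable_id_off_algebra k : measurable_fun setT (id : T -> off_algebra k).
Proof. by move=> _ B mB; rewrite setTI; exact: (@off_algebra_measurable k _ mB). Qed.

Lemma cylinders_setI k : setI_closed (cylinders k).
Proof.
move=> _ _ [N1 [B1 [m1 k1 ->]]] [N2 [B2 [m2 k2 ->]]].
exists (maxn N1 N2), (fun i => (if (i < N1)%N then B1 i else setT) `&`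
  (if (i < N2)%N then B2 i else setT)); split.
- by move=> i; apply: measurableI; case: ifP.
- by rewrite k1 k2 !if_same setTI.
- apply/seteqP; split => [w [h1 h2] i /= iN|w h].
    split; case: ifP => // iN'; [exact: h1|exact: h2].
  split=> i /= iN; have := h i; rewrite /= leq_max iN ?orbT => /(_ isT) []//.
Qed.

Lemma cylinder_indep k N (B : nat -> set E) C : (forall i, measurable (B i)) ->
  B k = setT -> measurable C ->
  P (\bigcap_(i in `I_N) (W i @^-1` B i) `&` W k @^-1` C) =
  P (\bigcap_(i in `I_N) (W i @^-1` B i)) * P (W k @^-1` C).
Proof.
move=> mB Bk mC; pose N' := maxn N k.+1.
pose B' i := if (i < N)%N then B i else setT.
have mB' i : measurable (B' i) by rewrite /B'; case: ifP.
pose B'' i := if i == k then C else B' i.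
have mB'' i : measurable (B'' i) by rewrite /B''; case: ifP.
have kN : (k < N')%N by rewrite leq_max ltnSn orbT.
have -> : \bigcap_(i in `I_N) (W i @^-1` B i) = \bigcap_(i in `I_N') (W i @^-1` B' i).
  apply/seteqP; split => [w h i /= iN|w h i /= iN].
    by rewrite /B'; case: ifP => // iN'; exact: h.
  by have := h i; rewrite /= leq_max iN => /(_ isT); rewrite /B' iN.
have B'k : B' k = setT by rewrite /B' Bk if_same.
have -> : \bigcap_(i in `I_N') (W i @^-1` B' i) `&` W k @^-1` C =
    \bigcap_(i in `I_N') (W i @^-1` B'' i).
  apply/seteqP; split => [w [h Cw] i /= iN|w h].
    by rewrite /B''; case: eqP => [->//|_]; exact: h.
  split=> [i /= iN|]; last by have := h _ kN; rewrite /B'' eqxx.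
  by have := h _ iN; rewrite /B''; case: eqP => // ->; rewrite B'k.
rewrite !indW// (bigD1 (Ordinal kN))//= [X in _ = X * _](bigD1 (Ordinal kN))//=.
rewrite {1}/B'' eqxx B'k preimage_setT probability_setT mul1e muleC; congr (_ * _).
apply: eq_bigr => i ik; rewrite /B''; case: eqP => // ik'.
by move: ik; rewrite -val_eqE /= ik' eqxx.
Qed.

(** For fixed [C] both sides are finite measures in [A] that agree on the pi-system of cylinders. *)
Lemma off_algebra_indep k (A : set T) C : <<s cylinders k >> A -> measurable C ->
  P (A `&` W k @^-1` C) = P A * P (W k @^-1` C).
Proof.
move=> sA mC; have mWC : measurable (W k @^-1` C) by rewrite -[X in measurable X]setTI; exact: mW.
have fin : P (W k @^-1` C) \is a fin_num by exact: fin_num_measure.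
have c0 : (0 <= fine (P (W k @^-1` C)))%R by exact: fine_ge0.
transitivity (mrestr P mWC A); first by [].
transitivity (mscale (NngNum c0) P A); last by rewrite /= /mscale /= fineK// muleC.
apply: (g_sigma_algebra_measure_unique (cylinders k) _ (fun=> setT) _ _ (mrestr P mWC) (mscale (NngNum c0) P)) sA.
- exact: cylinders_measurable.
- move=> _; exists 0%N, (fun=> setT); split=> //; apply/seteqP; split=> // w _ i.
- by rewrite bigcup_const.
- exact: cylinders_setI.
- move=> _ [N [B [mB Bk ->]]]; rewrite /= /mrestr /mscale /= fineK// cylinder_indep// muleC//.
- by move=> _; rewrite /= /mrestr setTI; exact: le_lt_trans (probability_le1 _ _) (ltry _).
Qed.

(** The identity of [T], read as the collection of the other observations, is independent of
    [W k]. *)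
Lemma fubini_off k (F : off_algebra k * E -> \bar R) : measurable_fun setT F ->
  (forall z, 0 <= F z) ->
  \int[P]_w F (w, W k w) = \int[P]_w \int[P]_w' F (w, W k w').
Proof.
move=> mF F0; apply: (@indep_integral _ _ _ _ (id : T -> off_algebra k) (W k)) => //.
- exact: measurable_id_off_algebra.
- by move=> A B mA mB; exact: off_algebra_indep.
Qed.

Lemma measurable_partial_integral k (F : off_algebra k * E -> \bar R) :
  measurable_fun setT F -> (forall z, 0 <= F z) ->
  measurable_fun setT (fun w : T => \int[P]_w' F (w, W k w')).
Proof.
move=> mF F0; pose Wm : {mfun T >-> E} := mfun_Sub (mem_set (mW k)).
have -> : (fun w : T => \int[P]_w' F (w, W k w')) = fubini_F (distribution P Wm) F.
  apply/funext => w; rewrite /fubini_F ge0_integral_pushforward ?preimage_setT//.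
  exact: measurableT_comp.
move=> _ B mB; rewrite setTI; apply: (@off_algebra_measurable k).
have := @measurable_fun_fubini_tonelli_F _ _ _ _ _ (distribution P Wm) F mF F0 measurableT B mB.
by rewrite setTI.
Qed.

End Independence.

Local Close Scope ereal_scope.

(** * Elementary exponential inequalities and the majorant of the resampled noise *)

Section ExponentialBounds.
Context {R : realType}.
Implicit Types u c t e : R.

(** From exp u = 1 / exp(-u) <= 1 / (1 - u). *)
Lemma expR_le_quadratic u : u <= 1 / 2 -> expR u <= 1 + u + 2 * u ^+ 2.
Proof.
move=> u2; rewrite -[u in expR u]opprK expRN invf_ple ?posrE ?expR_gt0//; last by nra.
apply: le_trans (expR_ge1Dx (- u)); rewrite -div1r ler_pdivrMr; last by nra.
by nra.
Qed.

(** Majorant of exp(exp(t e) - 1), the factor produced by averaging over the resampling. Its mean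
    uses only what is known of the noise: the linear term is centred, the last one is an exponential
    moment. The constant is 14 = 7 * 2, where u^2 <= 2 exp |u| turns a quadratic term with
    coefficient 7 into an exponential one. *)
Definition ghat c t e : R := 1 + t * e + 14 * (t / c) ^+ 2 * expR (c * `|e|).

Lemma expR_ge_half_sqr u : 0 <= u -> u ^+ 2 / 2 <= expR u.
Proof.
move=> u0; apply: le_trans (expR_ge1Dxn 1 u0).
by rewrite (_ : 2`! = 2)%N// lerDr.
Qed.

Lemma ghat_lower c t e : 0 < c -> 1 + t * e + 7 * (t * e) ^+ 2 <= ghat c t e.
Proof.
move=> c0; rewrite /ghat lerD2l.
have ce : 0 <= c * `|e| by rewrite mulr_ge0// ltW.
have := ler_wpM2l (sqr_ge0 (t / c)) (expR_ge_half_sqr ce).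
rewrite (_ : _ ^+ 2 * (_ / 2) = (t * e) ^+ 2 / 2); first by nra.
by rewrite !exprMn real_normK ?num_real// exprVn; field; rewrite lt0r_neq0.
Qed.

Lemma ghat_ge0 c t e : 0 < c -> 0 <= ghat c t e.
Proof. by move=> c0; apply: le_trans (ghat_lower t e c0); nra. Qed.

Lemma exp_exp_le_ghat c t e : 0 < c -> `|t * e| <= 1 / 4 ->
  expR (expR (t * e) - 1) <= ghat c t e.
Proof.
move=> c0 te; apply: le_trans (ghat_lower t e c0).
move: (t * e) te => u /ler_normlP[u1 u2].
have h1 := @expR_le_quadratic u ltac:(lra).
have h2 := expR_ge1Dx u.
have v2 : expR u - 1 <= 1 / 2 by nra.
apply: le_trans (expR_le_quadratic v2) _.
(* On |u| <= 1/4 one has |exp u - 1| <= (3/2) |u|; with the quadratic bound applied twice, u^2 gets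
   the coefficient 2 + 9/2 <= 7. *)
have : (expR u - 1) ^+ 2 <= (9 / 4) * u ^+ 2.
  have -> : 9 / 4 * u ^+ 2 = ((3 / 2) * `|u|) ^+ 2 by rewrite exprMn real_normK ?num_real//; field.
  have [u0|u0] := leP 0 u.
    by rewrite ger0_norm// ler_pXn2r// ?nnegrE; nra.
  have e1 : expR u <= 1 by rewrite -(expR0 R) ler_expR ltW.
  have -> : (expR u - 1) ^+ 2 = (1 - expR u) ^+ 2 by ring.
  by rewrite ltr0_norm// ler_pXn2r// ?nnegrE; nra.
by nra.
Qed.

Lemma expR_power_le (n : nat) (s : R) : (0 < n)%N -> - n%:R <= s -> (1 + s / n%:R) ^+ n <= expR s.
Proof.
move=> n0 sn; have n0' : 0 < n%:R :> R by rewrite ltr0n.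
have -> : expR s = expR (s / n%:R) ^+ n.
  by rewrite -expRM_natl mulrCA divff ?mulr1// lt0r_neq0.
rewrite lerXn2r ?nnegrE ?expR_ge0 ?expR_ge1Dx//.
have -> : 1 + s / n%:R = (n%:R + s) / n%:R by rewrite mulrDl divff ?lt0r_neq0.
by rewrite divr_ge0 ?(ltW n0')//; lra.
Qed.

End ExponentialBounds.

Local Open Scope ereal_scope.

Lemma measure_fintype_bigcup {R : realType} {d : measure_display} {T : measurableType d}
    (mu : {measure set T -> \bar R}) (I : finType) (F : I -> set T) :
  (forall i, measurable (F i)) -> trivIset setT F ->
  mu (\bigcup_i F i) = \sum_i mu (F i).
Proof.
move=> mF tF; rewrite measure_fin_bigcup//; last exact: finite_finset.
rewrite (fsbig_seq _ _ (index_enum_uniq I)); apply: eq_fsbigl; apply/seteqP; split=> // i _; exact: mem_index_enum.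
Qed.

(** * Chernoff bounds under resampling with replacement *)

Section Resampling.
Context {R : realType} {d : measure_display} {T : measurableType d}.
Variable P : probability T R.
Variables (d' : measure_display) (E : measurableType d') (W : nat -> T -> E).
Hypothesis mW : forall i, measurable_fun setT (W i).
Variables (n : nat) (J : T -> {ffun 'I_n -> 'I_n}).
Hypothesis mJ : forall j, measurable (J @^-1` [set j]).
Hypothesis indJ : forall j (N : nat) (B : nat -> set E), (forall i, measurable (B i)) ->
  P (\bigcap_(i in `I_N) (W i @^-1` B i) `&` J @^-1` [set j]) =
  P (\bigcap_(i in `I_N) (W i @^-1` B i)) * ((n ^ n)%N%:R^-1)%:E.

Lemma resample_indep k (A : set T) j : <<s cylinders W k >> A ->
  P (A `&` J @^-1` [set j]) = P A * ((n ^ n)%N%:R^-1)%:E.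
Proof.
move=> sA; have c0 : (0 <= (n ^ n)%N%:R^-1 :> R)%R by rewrite invr_ge0.
transitivity (mrestr P (mJ j) A); first by [].
transitivity (mscale (NngNum c0) P A); last by rewrite /= /mscale /= muleC.
apply: (g_sigma_algebra_measure_unique (cylinders W k) _ (fun=> setT) _ _
  (mrestr P (mJ j)) (mscale (NngNum c0) P)) sA.
- exact: cylinders_measurable.
- move=> _; exists 0%N, (fun=> setT); split=> //; apply/seteqP; split=> // w _ i.
- by rewrite bigcup_const.
- exact: cylinders_setI.
- move=> _ [N [B [mB Bk ->]]]; rewrite /= /mrestr /mscale /= indJ// muleC//.
- by move=> _; rewrite /= /mrestr setTI; exact: le_lt_trans (probability_le1 _ _) (ltry _).
Qed.

Lemma probability_resample k (A : {ffun 'I_n -> 'I_n} -> set T) :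
  (forall j, <<s cylinders W k >> (A j)) ->
  P [set w | A (J w) w] = ((n ^ n)%N%:R^-1)%:E * \sum_(j : {ffun 'I_n -> 'I_n}) P (A j).
Proof.
move=> sA; have mA j : measurable (A j) by exact: (off_algebra_measurable mW (sA j)).
have -> : [set w | A (J w) w] = \bigcup_j (A j `&` J @^-1` [set j]).
  apply/seteqP; split => [w Aw|w [j _ [Aw /= Jj]]]; last by rewrite /= Jj.
  by exists (J w).
rewrite measure_fintype_bigcup//=.
- rewrite ge0_sume_distrr//; apply: eq_bigr => j _.
  by rewrite (@resample_indep k)// muleC.
- by move=> j; apply: measurableI.
- by apply/trivIsetP => j j' _ _ jj'; apply/seteqP; split => // w [[_ /= e1] [_ /= e2]]; move: jj'; rewrite -e1 e2 eqxx.
Qed.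

(* Averaging over the resampling [j], which is independent of the data, turns
   the product over positions into an [n]-th power. *)
Lemma resampled_chernoff k (D : set T) (S : {set 'I_n}) (zeta : 'I_n -> T -> R) (x : R) :
  (0 < n)%N -> <<s cylinders W k >> D ->
  (forall a, measurable_fun setT (zeta a : off_algebra W k -> R)) ->
  P (D `&` [set w | (x <= \sum_(i | J w i \in S) zeta (J w i) w)%R]) <=
  (expR (- x))%:E * \int[P]_(w in D) (expR (\sum_(a in S) (expR (zeta a w) - 1)))%:E.
Proof.
move=> n0 sD mz; have mD := off_algebra_measurable mW sD.
have sub (f : T -> R) : measurable_fun setT (f : off_algebra W k -> R) -> measurable_fun setT f.
  move=> mf _ B mB; rewrite setTI; apply: (off_algebra_measurable mW (k := k)).
  by have := mf measurableT B mB; rewrite setTI.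
pose s (j : {ffun 'I_n -> 'I_n}) w : R := (\sum_(i | j i \in S) zeta (j i) w)%R.
have ms j : measurable_fun setT (s j : off_algebra W k -> R).
  by rewrite /s; under eq_fun do rewrite big_mkcond; apply: measurable_sum => i /=; case: (j i \in S) => //.
pose A j := D `&` [set w | (x <= s j w)%R].
have sA j : <<s cylinders W k >> (A j).
  apply: (@measurableI _ (off_algebra W k)) => //.
  by have := @measurable_fun_le _ (off_algebra W k) R setT (cst x) (s j) measurableT (measurable_cst _) (ms j); rewrite setTI.
have mA j : measurable (A j) by exact: (off_algebra_measurable mW (sA j)).
have mexp j : measurable_fun setT (fun w => (expR (s j w))%:E).
  by apply/measurable_EFinP; apply: measurableT_comp => //; apply: sub; exact: ms.
have intZ (c : R) (f : T -> \bar R) : (0 <= c)%R -> (forall w, 0 <= f w) ->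
    measurable_fun setT f -> c%:E * \int[P]_(w in D) f w = \int[P]_(w in D) (c%:E * f w).
  by move=> c0 f0 mf; rewrite ge0_integralZl_EFin//; exact: measurable_funTS.
have e0 u : 0 <= (expR u : R)%:E by rewrite lee_fin expR_ge0.
(* Markov's inequality for each fixed resampling [j]; the sum over [j] moves under the integral
   afterwards. *)
apply: (@le_trans _ _ (((n ^ n)%N%:R^-1)%:E * \sum_(j : {ffun 'I_n -> 'I_n})
    ((expR (- x))%:E * \int[P]_(w in D) (expR (s j w))%:E))).
  rewrite -[X in P X]/([set w | A (J w) w]) (@probability_resample k A)// lee_wpmul2l ?lee_fin ?invr_ge0//.
  apply: lee_sum => j _; rewrite intZ ?expR_ge0//.
  have mexpx : measurable_fun setT (fun w => (expR (- x))%:E * (expR (s j w))%:E).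
    by apply: emeasurable_funM.
  apply: (@le_trans _ _ (\int[P]_(w in A j) ((expR (- x))%:E * (expR (s j w))%:E))); last first.
    apply: ge0_subset_integral => //; first exact: measurable_funTS.
    by move=> w [].
  rewrite -[leLHS]mul1e -integral_cst//; apply: ge0_le_integral => //; first exact: measurable_funTS.
  by move=> w [_ /= xs]; rewrite -EFinM lee_fin -expRD -expR0 ler_expR addrC subr_ge0.
rewrite -ge0_sume_distrr; last by move=> j _; apply: integral_ge0 => w _; rewrite lee_fin expR_ge0.
rewrite muleCA -ge0_integral_sum//; last by move=> j; exact: measurable_funTS.
rewrite [X in _ * X <= _]intZ ?invr_ge0//; last 2 first.
- by move=> w; apply: sume_ge0 => j _.
- by apply: emeasurable_sum.
apply: lee_wpmul2l; first by rewrite lee_fin expR_ge0.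
apply: ge0_le_integral => //.
- by move=> w _; rewrite mule_ge0 ?lee_fin ?invr_ge0//; apply: sume_ge0 => j _; rewrite lee_fin expR_ge0.
- by apply: emeasurable_funM => //; apply: emeasurable_sum => j; exact: measurable_funTS.
- apply/measurable_EFinP/measurableT_comp => //; apply: measurable_funTS.
  under eq_fun do rewrite big_mkcond; apply: measurable_sum => a /=; case: (a \in S) => //.
  by apply: measurable_funB => //; apply: measurableT_comp => //; exact: sub.
move=> w _; rewrite sumEFin -EFinM lee_fin.
(* The value 1 outside [S] lets the product run over all positions, so that the sum over [j]
   factorizes. *)
pose F (a : 'I_n) : R := expR (if a \in S then zeta a w else 0%R).
have -> : (\sum_(j : {ffun 'I_n -> 'I_n}) expR (s j w) = (\sum_a F a) ^+ n)%R.
  transitivity (\sum_(j : {ffun 'I_n -> 'I_n}) \prod_i F (j i))%R.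
    by apply: eq_bigr => j _; rewrite /s big_mkcond expR_sum.
  by rewrite -(bigA_distr_bigA (fun _ a => F a)) prodr_const card_ord.
have FE : (\sum_a F a = n%:R + \sum_(a in S) (expR (zeta a w) - 1))%R.
  rewrite [in RHS]big_mkcond /= -[X in X%:R](card_ord n) -sumr_const -big_split /=.
  by apply: eq_bigr => a _; rewrite /F; case: ifP => _; rewrite ?expR0 ?addr0// addrC subrK.
rewrite natrX -exprVn -exprMn mulrC FE mulrDl divff ?pnatr_eq0 -?lt0n//.
apply: expR_power_le => //; rewrite -subr_ge0 opprK addrC -FE.
by apply: sumr_ge0 => a _; exact: expR_ge0.
Qed.

End Resampling.

Local Open Scope ereal_scope.

(* [A] is measurable along every measurable family of points, so that some of
   the points may be frozen. *)
Definition jointly_measurable (dV : measure_display) (V : measurableType dV) (I : Type)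
    (A : (I -> V) -> Prop) : Prop :=
  forall (d : measure_display) (S : measurableType d) (x : I -> S -> V),
    (forall i, measurable_fun setT (x i)) -> measurable [set s | A (x ^~ s)].

(** * Moments of products of independent factors on an event of the covariates *)

Section ProductMoment.
Context {R : realType} {d : measure_display} {T : measurableType d}.
Variable P : probability T R.
Variables (d' : measure_display) (E : measurableType d') (W : nat -> T -> E).
Hypothesis mW : forall i, measurable_fun setT (W i).
Hypothesis indW : forall (N : nat) (B : nat -> set E), (forall i, measurable (B i)) ->
  P (\bigcap_(i in `I_N) (W i @^-1` B i)) = \prod_(i < N) P (W i @^-1` B i).
Variables (dV : measure_display) (V : measurableType dV) (pr : E -> V) (psi : E -> R).
Hypothesis mpr : measurable_fun setT pr.
Hypothesis mpsi : measurable_fun setT psi.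
Hypothesis psi0 : forall z, (0 <= psi z)%R.
Variable kappa : R.
Hypothesis kappa0 : (0 <= kappa)%R.
Hypothesis psi_kappa : forall k A, measurable A ->
  \int[P]_(w in [set w | A (pr (W k w))]) (psi (W k w))%:E <=
  kappa%:E * P [set w | A (pr (W k w))].

(** One observation is integrated out at a time. The event [A] depends on it as well, so the
    hypothesis on [psi] is applied, with the others frozen, to the section of [A]; Fubini read
    backwards, with [psi] replaced by 1, restores [A] before the induction continues. *)
Lemma product_moment_seq n (A : ('I_n -> V) -> Prop) (s : seq 'I_n) :
  jointly_measurable A -> uniq s ->
  \int[P]_(w in [set w | A (fun a => pr (W a w))]) (\prod_(a <- s) psi (W a w))%:E <=
  (kappa ^+ size s)%:E * P [set w | A (fun a => pr (W a w))].
Proof.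
move=> mA; have mX i : measurable_fun setT (fun w => pr (W i w)) by exact: measurableT_comp.
have mAX : measurable [set w | A (fun a => pr (W a w))].
  by apply: (mA _ _ (fun a : 'I_n => fun w => pr (W a w))).
elim: s => [_|k s IH /= /andP[ks us]].
  under eq_integral do rewrite big_nil.
  by rewrite integral_cst//= expr0.
(* The configuration of [w] with its [k]-th point replaced by [x]. *)
pose upd (w : T) (x : V) (a : 'I_n) : V := if a == k then x else pr (W a w).
have updE w : upd w (pr (W k w)) = (fun a => pr (W a w)).
  by apply/funext => a; rewrite /upd; case: eqP => [->|].
pose prs (w : T) : R := (\prod_(a <- s) psi (W a w))%R.
have prs0 w : (0 <= prs w)%R by apply: prodr_ge0.
have mprsk : measurable_fun setT (prs : off_algebra W k -> R).
  apply: measurable_prod => a as_.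
  apply: measurableT_comp => //; apply: measurable_off_algebra.
  by apply: contraNneq ks => ak; rewrite -(val_inj ak).
have mupd : measurable [set z : off_algebra W k * E | A (upd z.1 (pr z.2))].
  apply: (mA _ _ (fun a (z : off_algebra W k * E) => upd z.1 (pr z.2) a)) => a.
  rewrite /upd; case: eqP => [_|/eqP ak].
    exact: measurableT_comp measurable_snd.
  apply: measurableT_comp => //; apply: (measurableT_comp _ measurable_fst).
  by apply: measurable_off_algebra; rewrite val_eqE.
pose B := [set z : off_algebra W k * E | A (upd z.1 (pr z.2))].
pose F (c : E -> R) (z : off_algebra W k * E) : \bar R := (\1_B z * (c z.2 * prs z.1))%:E.
have mF (c : E -> R) : measurable_fun setT c -> measurable_fun setT (F c).
  move=> mc; apply/measurable_EFinP; apply: measurable_funM; first exact: measurable_indic.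
  apply: measurable_funM; first exact: measurableT_comp measurable_snd.
  exact: measurableT_comp measurable_fst.
have F0 (c : E -> R) : (forall z, 0 <= c z)%R -> forall z, 0 <= F c z.
  by move=> c0 z; rewrite lee_fin !mulr_ge0.
have FE (c : E -> R) : \int[P]_(w in [set w | A (fun a => pr (W a w))]) (c (W k w) * prs w)%:E =
    \int[P]_w F c (w, W k w).
  rewrite integral_mkcond; apply: eq_integral => w _; rewrite /F /patch indicE /=.
  rewrite (_ : (w \in [set w | A (fun a => pr (W a w))]) = ((w, W k w) \in B)).
    by case: ifP; rewrite ?mul1r ?mul0r.
  by apply/idP/idP; rewrite !inE /B /= updE.
have secE (c : E -> R) w : (forall z, 0 <= c z)%R -> measurable_fun setT c ->
    \int[P]_w' F c (w, W k w') =
    (prs w)%:E * \int[P]_(w' in [set w' | [set x | A (upd w x)] (pr (W k w'))]) (c (W k w'))%:E.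
  move=> c0 mc; rewrite [in RHS]integral_mkcond -ge0_integralZl_EFin//; last 2 first.
  - by move=> w' _; rewrite erestrict_ge0// => x _; rewrite lee_fin.
  - apply/(measurable_restrictT _ _).1.
      rewrite -[X in measurable X]setTI; apply: mX => //.
      by apply: (mA _ _ (fun a x => upd w x a)) => a; rewrite /upd; case: eqP.
    by apply: measurable_funTS; apply/measurable_EFinP; exact: measurableT_comp.
  apply: eq_integral => w' _; rewrite /F /patch indicE /=.
  rewrite (_ : (w' \in [set w' | A (upd w (pr (W k w')))]) = ((w, W k w') \in B)).
    by case: ifP; rewrite ?mul1r ?mul0r ?mule0// muleC.
  by apply/idP/idP; rewrite !inE.
under eq_integral do rewrite big_cons -/(prs _).
rewrite FE (fubini_off mW indW (mF _ mpsi) (F0 _ psi0)).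
apply: (@le_trans _ _ (\int[P]_w (kappa%:E * \int[P]_w' F (cst 1%R) (w, W k w')))).
  apply: ge0_le_integral => //.
  - by move=> w _; apply: integral_ge0 => w' _; exact: F0.
  - exact: measurable_partial_integral (mF _ mpsi) (F0 _ psi0).
  - by apply: emeasurable_funM => //; apply: measurable_partial_integral (mF _ _) (F0 _ _).
  move=> w _; rewrite !secE// muleCA lee_wpmul2l ?lee_fin//.
  have mAw : measurable [set x | A (upd w x)].
    by apply: (mA _ _ (fun a x => upd w x a)) => a; rewrite /upd; case: eqP.
  rewrite [X in _ * X](_ : _ = P [set w' | [set x | A (upd w x)] (pr (W k w'))]); first exact: psi_kappa.
  by rewrite -[RHS]mul1e -integral_cst// -[X in measurable X]setTI; exact: mX.
rewrite ge0_integralZl_EFin//; last 2 first.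
- by move=> w _; apply: integral_ge0 => w' _; apply: F0.
- by apply: measurable_partial_integral (mF _ _) (F0 _ _).
rewrite -(fubini_off mW indW (mF _ _) (F0 _ _))// -FE.
under eq_integral do rewrite mul1r.
by rewrite exprS EFinM -muleA lee_wpmul2l ?lee_fin// IH.
Qed.

End ProductMoment.

Lemma measurable_fun_generated (S S' : pointedType) (G : set (set S)) (G' : set (set S'))
    (f : S -> S') : (forall B, G' B -> G (f @^-1` B)) ->
  measurable_fun setT (f : g_sigma_algebraType G -> g_sigma_algebraType G').
Proof.
move=> fG; apply: (@measurability _ _ _ (g_sigma_algebraType G') _ _ G') => //.
by move=> _ [B GB <-]; rewrite setTI; apply: sub_sigma_algebra; exact: fG.
Qed.

Lemma measurable_fun_generatedR {R : realType} (S : pointedType) (G : set (set S))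
    (f : S -> R) : (forall B, open B -> G (f @^-1` B)) ->
  measurable_fun setT (f : g_sigma_algebraType G -> R).
Proof.
move=> fG; apply: (measurability _ (RGenOpens.measurableE R)).
move=> _ [_ [a [b ->] <-]]; rewrite setTI; apply: sub_sigma_algebra; apply: fG.
exact: interval_open.
Qed.

Lemma measurable_dotv {R : realType} {p : nat} (v : 'rV[R]_p) :
  measurable_fun setT (dotv v : g_sigma_algebraType (@open 'rV[R]_p) -> R).
Proof.
apply: measurable_sum => j; apply: measurable_funM => //.
by apply: measurable_fun_generatedR => B oB; apply: open_comp => // y _; exact: coord_continuous.
Qed.

Local Close Scope ereal_scope.

(** * Exponential bounds in the regression model *)

Local Open Scope ereal_scope.

Section RegressionModel.
Context {R : realType} {p : nat} {d : measure_display} {T : measurableType d}.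
Variables (P : probability T R) (XX : set 'rV[R]_p) (f0 : 'rV[R]_p -> R).
Variables (X : nat -> T -> 'rV[R]_p) (Y : nat -> T -> R).
Hypothesis hX : forall i w, XX (X i w).
Hypothesis hiid : iid P (fun i w => (X i w, Y i w)).
Hypothesis hYint : P.-integrable setT (EFin \o Y 0%N).
Hypothesis hf0 : cond_expectation P XX (X 0%N) (EFin \o Y 0%N) (EFin \o f0).
Hypothesis cXX : closed XX.
Variable f0_bound : R.
Hypothesis f0_bounded : forall x, XX x -> (`|f0 x| <= f0_bound)%R.
Variables (c : R) (h : 'rV[R]_p -> \bar R) (B : R).
Hypotheses (c0 : (0 < c)%R) (B0 : (0 <= B)%R).
Hypothesis hexp : cond_expectation P XX (X 0%N)
  (fun w => (expR (c * `|Y 0%N w - f0 (X 0%N w)|))%:E) h.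
Hypothesis hB : forall x, XX x -> h x <= B%:E.

Definition xspace := g_sigma_algebraType (@open 'rV[R]_p).
Definition xyspace := g_sigma_algebraType (@open ('rV[R]_p * R)%type).
Definition XY (i : nat) (w : T) : xyspace := (X i w, Y i w).

Lemma measurable_XY i : measurable_fun setT (XY i).
Proof. by move=> _ A mA; rewrite setTI; case: hiid => + _ _; apply. Qed.

Lemma indep_XY (N : nat) (A : nat -> set xyspace) : (forall i, measurable (A i)) ->
  P (\bigcap_(i in `I_N) (XY i @^-1` A i)) = \prod_(i < N) P (XY i @^-1` A i).
Proof. by move=> mA; case: hiid => _ _; apply. Qed.

Lemma measurable_xpart : measurable_fun setT (fst : xyspace -> xspace).
Proof. apply: measurable_fun_generated => U oU; apply: open_comp => // z _; exact: cvg_fst. Qed.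

Lemma measurable_ypart : measurable_fun setT (snd : xyspace -> R).
Proof. apply: measurable_fun_generatedR => U oU; apply: open_comp => // z _; exact: cvg_snd. Qed.

Lemma measurable_XX : measurable (XX : set xspace).
Proof.
rewrite -[X in measurable X]setCK; apply: measurableC; apply: sub_sigma_algebra.
exact: closed_openC.
Qed.

Lemma measurable_X i : measurable_fun setT (X i : T -> xspace).
Proof. exact: (measurableT_comp measurable_xpart (measurable_XY i)). Qed.

Lemma measurable_Y i : measurable_fun setT (Y i).
Proof. exact: (measurableT_comp measurable_ypart (measurable_XY i)). Qed.

(** [f0] is only known to be measurable on [XX]; extended by 0 it is measurable everywhere, and the
    data never leave [XX]. *)
Definition residual (z : xyspace) : R := (z.2 - (f0 \_ XX) z.1)%R.

Lemma measurable_residual : measurable_fun setT residual.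
Proof.
apply: measurable_funB; first exact: measurable_ypart.
have mf : measurable_fun (XX : set xspace) (f0 : xspace -> R).
  by have [m _] := hf0; exact/measurable_EFinP.
have m := iffLR (measurable_restrictT (f0 : xspace -> R) measurable_XX) mf.
exact: measurableT_comp m measurable_xpart.
Qed.

Definition eps (i : nat) (w : T) : R := (Y i w - f0 (X i w))%R.

Lemma residualE i w : residual (XY i w) = eps i w.
Proof. by rewrite /residual /eps /= patchT// inE; exact: hX. Qed.

Lemma measurable_eps i : measurable_fun setT (eps i).
Proof.
rewrite (_ : eps i = residual \o XY i); last by apply/funext => w; rewrite /= residualE.
exact: measurableT_comp measurable_residual (measurable_XY i).
Qed.

Lemma identically_distributed (F : xyspace -> \bar R) i : measurable_fun setT F ->
  (forall z, 0 <= F z) -> \int[P]_w F (XY i w) = \int[P]_w F (XY 0 w).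
Proof.
move=> mF F0.
have E j : \int[P]_w F (XY j w) = \int[distribution P (mfun_Sub (mem_set (measurable_XY j)))]_z F z.
  by rewrite ge0_integral_pushforward ?preimage_setT.
rewrite !E; apply: eq_measure_integral => A mA _.
by rewrite /distribution /pushforward /=; case: hiid => _ + _; apply.
Qed.

(** [h] is only bounded above, so its integral is first bounded by that of its positive part. *)
Lemma exp_moment_le (A : set xspace) : measurable A ->
  \int[P]_(w in X 0%N @^-1` A) (expR (c * `|eps 0 w|))%:E <= B%:E * P (X 0%N @^-1` A).
Proof.
move=> mA; have mXA : measurable (X 0%N @^-1` A).
  by rewrite -[X in measurable X]setTI; exact: measurable_X.
have [mh hE] := hexp; rewrite hE// integralE.
apply: (@le_trans _ _ (\int[P]_(w in X 0%N @^-1` A) (fun w => h (X 0%N w))^\+ w)).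
  by apply: geeDl; rewrite oppe_le0 integral_ge0.
have mhX : measurable_fun setT (fun w => h (X 0%N w)).
  apply: (@measurable_comp _ _ _ _ (xspace) _ XX h) => //.
  - exact: measurable_XX.
  - by move=> _ [w _ <-].
  - exact: measurable_X.
rewrite -integral_cst//; apply: ge0_le_integral => //.
- by apply: measurable_funTS; apply: measurable_funepos.
- by move=> w _; rewrite funeposE ge_max hB//= lee_fin.
Qed.

(** Over an event determined by the covariate the noise has mean zero by the defining property of
    the conditional expectation, and the exponential term is bounded. Both facts are known for the
    first observation and pass to the [i]-th by equality of laws. Boundedness of [f0] makes f0(X)
    integrable, so that the two means can be subtracted. *)
Lemma ghat_moment t i (A : set xspace) : measurable A ->
  \int[P]_(w in X i @^-1` A) (ghat c t (eps i w))%:E <=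
  (1 + 14 * (t / c) ^+ 2 * B)%:E * P (X i @^-1` A).
Proof.
move=> mA; have mXA j : measurable (X j @^-1` A).
  by rewrite -[X in measurable X]setTI; exact: measurable_X.
have mg : measurable_fun setT (fun z : xyspace => ghat c t (residual z)).
  rewrite /ghat; apply: measurable_funD.
    by apply: measurable_funD => //; apply: measurable_funM => //; exact: measurable_residual.
  apply: measurable_funM => //; apply: measurableT_comp => //.
  by apply: measurable_funM => //; apply: measurableT_comp => //; exact: measurable_residual.
have mAf : measurable ((fst : xyspace -> xspace) @^-1` A).
  by rewrite -[X in measurable X]setTI; exact: measurable_xpart.
pose F (g : xyspace -> R) (z : xyspace) : \bar R := (\1_((fst : xyspace -> xspace) @^-1` A) z * g z)%:E.
have toF (g : xyspace -> R) j : \int[P]_(w in X j @^-1` A) (g (XY j w))%:E = \int[P]_w F g (XY j w).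
  rewrite integral_mkcond; apply: eq_integral => w _; rewrite /F /patch indicE /=.
  rewrite (_ : (w \in X j @^-1` A) = (XY j w \in (fst : xyspace -> xspace) @^-1` A)).
    by case: ifP; rewrite ?mul1r ?mul0r.
  by apply/idP/idP; rewrite !inE.
have mF (g : xyspace -> R) : measurable_fun setT g -> measurable_fun setT (F g).
  by move=> mg'; apply/measurable_EFinP; apply: measurable_funM => //; exact: measurable_indic.
have PE j : P (X j @^-1` A) = \int[P]_w F (cst 1%R) (XY j w).
  by rewrite -toF -[LHS]mul1e -integral_cst.
under eq_integral do rewrite -residualE.
rewrite (toF (fun z => ghat c t (residual z))) identically_distributed; last 2 first.
- exact: mF.
- by move=> z; rewrite lee_fin mulr_ge0// ghat_ge0.
rewrite PE identically_distributed; last 2 first.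
- exact: mF.
- by move=> z; rewrite lee_fin mulr_ge0//= ler01.
rewrite -PE -toF; under eq_integral do rewrite residualE.
have iY : P.-integrable (X 0%N @^-1` A) (EFin \o Y 0%N) by exact: integrableS hYint.
have mf0X : measurable_fun setT (fun w => f0 (X 0%N w)).
  rewrite (_ : (fun w => f0 (X 0%N w)) = (fun w => Y 0%N w - eps 0 w)%R).
    by apply: measurable_funB; [exact: measurable_Y|exact: measurable_eps].
  by apply/funext => w; rewrite /eps subKr.
have if0 : P.-integrable (X 0%N @^-1` A) (EFin \o (fun w => f0 (X 0%N w))).
  apply: (@le_integrable _ _ _ _ _ _ _ (EFin \o cst f0_bound)) => //.
  - by apply/measurable_EFinP; exact: measurable_funTS.
  - by move=> w _; rewrite lee_fin (le_trans (f0_bounded (hX 0 w)))// ler_norm.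
  - exact: finite_measure_integrable_cst.
have ie : P.-integrable (X 0%N @^-1` A) (EFin \o eps 0).
  by have := integrableB (mXA 0%N) iY if0; apply: eq_integrable => // w _; rewrite /= EFinB.
have ie0 : \int[P]_(w in X 0%N @^-1` A) (eps 0 w)%:E = 0.
  rewrite /eps; under eq_integral do rewrite EFinB.
  rewrite integralB_EFin//; have [_ ->//] := hf0.
  rewrite subee// fin_num_abs; have [_] := integrableP _ _ _ if0.
  by move=> /(le_lt_trans _); apply; apply: le_abse_integral => //; case: (integrableP _ _ _ if0).
pose K := (14 * (t / c) ^+ 2)%R.
have K0 : (0 <= K)%R by rewrite mulr_ge0// sqr_ge0.
have mex : measurable_fun setT (fun w => expR (c * `|eps 0 w|)).
  apply: measurableT_comp => //; apply: measurable_funM => //; apply: measurableT_comp => //.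
  exact: measurable_eps.
have iex : P.-integrable (X 0%N @^-1` A) (EFin \o (fun w => expR (c * `|eps 0 w|))).
  apply/integrableP; split; first by apply/measurable_EFinP; exact: measurable_funTS.
  under eq_integral do rewrite gee0_abs ?lee_fin ?expR_ge0//.
  apply: le_lt_trans (exp_moment_le mA) _.
  by rewrite lte_mul_pinfty ?lee_fin// (le_lt_trans (probability_le1 _ _))// ltry.
have i1 : P.-integrable (X 0%N @^-1` A) (EFin \o cst 1%R) by exact: finite_measure_integrable_cst.
rewrite (_ : \int[P]_(w in _) _ = P (X 0%N @^-1` A) +
    K%:E * \int[P]_(w in X 0%N @^-1` A) (expR (c * `|eps 0 w|))%:E).
  rewrite EFinD muleDl ?fin_num_measure// mul1e leeD2l//.
  by rewrite -/K (EFinM K B) -muleA lee_wpmul2l ?lee_fin// exp_moment_le.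
under eq_integral do rewrite /ghat !EFinD EFinM -/K (EFinM K).
rewrite integralD//; last 2 first.
- by apply: integrableD => //; exact: integrableZl.
- exact: integrableZl.
rewrite integralD//; last exact: integrableZl.
by rewrite !integralZl// ie0 mule0 adde0 integral_cst// mul1e.
Qed.

Variables (n : nat) (J : T -> {ffun 'I_n -> 'I_n}).
Hypothesis n0 : (0 < n)%N.
Hypothesis hJ : uniform_resampling P (fun i w => (X i w, Y i w)) J.
Variable A : ('I_n -> xspace) -> Prop.
Hypothesis mA : jointly_measurable A.

Let AX := [set w | A (fun a => X a w)].

(** The omitted index is [n], so that the sigma-algebra contains the first [n] observations, the
    only ones that a bag draws from. *)
Lemma off_measurable_X (a : 'I_n) : measurable_fun setT (X a : off_algebra XY n -> xspace).
Proof.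
have m : measurable_fun setT (XY a : off_algebra XY n -> xyspace).
  by apply: measurable_off_algebra; rewrite neq_ltn ltn_ord.
exact: measurableT_comp measurable_xpart m.
Qed.

Lemma off_measurable_eps (a : 'I_n) : measurable_fun setT (eps a : off_algebra XY n -> R).
Proof.
have m : measurable_fun setT (XY a : off_algebra XY n -> xyspace).
  by apply: measurable_off_algebra; rewrite neq_ltn ltn_ord.
rewrite (_ : eps a = residual \o XY a); last by apply/funext => w; rewrite /= residualE.
exact: measurableT_comp measurable_residual m.
Qed.

Lemma off_measurable_AX : <<s cylinders XY n >> AX.
Proof. exact: (mA off_measurable_X). Qed.

Lemma measurable_AX : measurable AX.
Proof. by apply: (mA (x := fun a : 'I_n => X a)) => a; exact: measurable_X. Qed.

(** Truncation enters only where [ghat] dominates the double exponential pointwise. As [ghat] is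
    nonnegative, the domain can then be enlarged to all of [AX], an event of the covariates alone,
    on which the noise is still centred and whose probability remains as a factor. *)
Lemma noise_chernoff (S : {set 'I_n}) (t b x : R) : (`|t| * b <= 1 / 4)%R ->
  P (AX `&` [set w | forall a : 'I_n, (`|eps a w| <= b)%R] `&`
     [set w | (x <= \sum_(i | J w i \in S) t * eps (J w i) w)%R]) <=
  (expR (- x + 14 * (t / c) ^+ 2 * B * #|S|%:R))%:E * P AX.
Proof.
move=> tb; pose D := AX `&` [set w | forall a : 'I_n, (`|eps a w| <= b)%R].
have sD : <<s cylinders XY n >> D.
  apply: (@measurableI _ (off_algebra XY n)); first exact: off_measurable_AX.
  rewrite (_ : [set w | _] = \bigcap_(a in [set: 'I_n]) [set w | (`|eps a w| <= b)%R]); last first.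
    by apply/seteqP; split=> [w h' a _|w h' a]; exact: h'.
  apply: (@fin_bigcap_measurable _ (off_algebra XY n)) => [|a _]; first exact: finite_finset.
  have me : measurable_fun setT (fun w : off_algebra XY n => `|eps a w|%R).
    by apply: measurableT_comp => //; exact: off_measurable_eps.
  by have := measurable_fun_le measurableT me (measurable_cst b); rewrite setTI.
have mD := off_algebra_measurable measurable_XY sD.
have mze (a : 'I_n) : measurable_fun setT ((fun w => t * eps a w)%R : off_algebra XY n -> R).
  by apply: measurable_funM => //; exact: off_measurable_eps.
apply: le_trans (resampled_chernoff measurable_XY (fun j => (hJ j).1) (fun j => (hJ j).2) S x n0 sD mze) _.
rewrite expRD EFinM -muleA lee_wpmul2l ?lee_fin ?expR_ge0//.
have mg a : measurable_fun setT (fun w => ghat c t (eps a w)).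
  rewrite /ghat; apply: measurable_funD.
    by apply: measurable_funD => //; apply: measurable_funM => //; exact: measurable_eps.
  apply: measurable_funM => //; apply: measurableT_comp => //.
  by apply: measurable_funM => //; apply: measurableT_comp => //; exact: measurable_eps.
have mpg : measurable_fun setT (fun w => (\prod_(a <- enum S) ghat c t (eps a w))%:E).
  by apply/measurable_EFinP; apply: measurable_prod.
have pg0 w : (0 <= \prod_(a <- enum S) ghat c t (eps a w))%R.
  by apply: prodr_ge0 => a _; exact: ghat_ge0.
apply: (@le_trans _ _ (\int[P]_(w in AX) (\prod_(a <- enum S) ghat c t (eps a w))%:E)).
  apply: (@le_trans _ _ (\int[P]_(w in D) (\prod_(a <- enum S) ghat c t (eps a w))%:E)).
    apply: ge0_le_integral => //.
    - apply: measurable_funTS; apply/measurable_EFinP/measurableT_comp => //.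
      under eq_fun do rewrite big_mkcond; apply: measurable_sum => a /=; case: (a \in S) => //.
      apply: measurable_funB => //; apply: measurableT_comp => //.
      by apply: measurable_funM => //; exact: measurable_eps.
    - exact: measurable_funTS.
    - move=> w [_ /= wb]; rewrite lee_fin expR_sum -big_enum /=; apply: ler_prod => a _.
      rewrite expR_ge0 exp_exp_le_ghat// normrM.
      by apply: le_trans tb; rewrite ler_wpM2l.
  have DA : D `<=` AX by move=> w [].
  have mAX := measurable_AX.
  have mpgA : measurable_fun AX (fun w => (\prod_(a <- enum S) ghat c t (eps a w))%:E).
    exact: measurable_funTS.
  by apply: ge0_subset_integral => // w _; rewrite lee_fin.
have psik k (U : set xspace) : measurable U ->
    \int[P]_(w in [set w | U ((XY k w).1)]) (ghat c t (residual (XY k w)))%:E <=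
    (1 + 14 * (t / c) ^+ 2 * B)%:E * P [set w | U ((XY k w).1)].
  by move=> mU; under eq_integral do rewrite residualE; exact: ghat_moment.
have K0 : (0 <= 14 * (t / c) ^+ 2 * B)%R by rewrite mulr_ge0// mulr_ge0// sqr_ge0.
have mgr : measurable_fun setT (fun z : xyspace => ghat c t (residual z)).
  rewrite /ghat; apply: measurable_funD.
    by apply: measurable_funD => //; apply: measurable_funM => //; exact: measurable_residual.
  apply: measurable_funM => //; apply: measurableT_comp => //.
  by apply: measurable_funM => //; apply: measurableT_comp => //; exact: measurable_residual.
have := product_moment_seq measurable_XY indep_XY measurable_xpart mgr
  (fun z => ghat_ge0 t (residual z) c0) (addr_ge0 ler01 K0) psik mA (enum_uniq (mem S)).
have rE w : (\prod_(a <- enum S) ghat c t (residual (XY a w)) = \prod_(a <- enum S) ghat c t (eps a w))%R.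
  by apply: eq_bigr => a _; rewrite residualE.
under eq_integral do rewrite rE.
move=> /le_trans; apply; rewrite -cardE lee_wpmul2r//.
by rewrite lee_fin expRM_natr lerXn2r ?nnegrE ?addr_ge0 ?expR_ge0// expR_ge1Dx.
Qed.

Lemma count_chernoff (S : {set 'I_n}) (t x : R) :
  P (AX `&` [set w | (x <= t * #|finset (fun i => J w i \in S)|%:R)%R]) <=
  (expR (- x + (expR t - 1) * #|S|%:R))%:E * P AX.
Proof.
have := resampled_chernoff measurable_XY (fun j => (hJ j).1) (fun j => (hJ j).2) S x n0
  off_measurable_AX (fun a : 'I_n => @measurable_cst _ _ (off_algebra XY n) R setT t).
have E w : (\sum_(i | J w i \in S) t = t * #|finset (fun i => J w i \in S)|%:R)%R.
  by rewrite mulr_natr -sumr_const; apply: eq_bigl => i; rewrite inE.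
under eq_set do rewrite E.
move=> /le_trans; apply; rewrite (_ : \int[P]_(w in AX) _ = (expR ((expR t - 1) *+ #|S|))%:E * P AX).
  by rewrite muleA -EFinM -expRD mulr_natr.
rewrite -integral_cst; last exact: measurable_AX.
by apply: eq_integral => w _ /=; rewrite sumr_const.
Qed.

End RegressionModel.

Local Close Scope ereal_scope.

(** * Partitions produced by CAP *)

Section SeqExtrema.
Context {R : realType} {I : Type}.
Implicit Types (F : I -> R) (s : seq I).

Lemma bigmax_seqP (c : R) i0 s F :
  let m := \big[Num.max/c]_(i <- s) F i in
  [/\ c <= m, forall k, (k < size s)%N -> F (nth i0 s k) <= m
    & m = c \/ exists2 k, (k < size s)%N & m = F (nth i0 s k)].
Proof.
elim: s => [|x s IH] /=; first by rewrite big_nil; split=> //; left.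
rewrite big_cons; move: IH => /=; set m := \big[_/_]_(i <- s) _ => -[cm sm me].
split; first by rewrite le_max cm orbT.
  by move=> [_|k ks] /=; rewrite le_max ?lexx// sm ?orbT.
have [xm|mx] := leP (F x) m; last by right; exists 0%N.
by case: me => [->|[k ks ->]]; [left|right; exists k.+1].
Qed.

Lemma seq_max_ge i0 s F k : (k < size s)%N -> F (nth i0 s k) <= seq_max i0 s F.
Proof. by move=> ks; have [_ + _] := bigmax_seqP (F (head i0 s)) i0 s F; apply. Qed.

Lemma seq_max_attained i0 s F : (0 < size s)%N ->
  exists2 k, (k < size s)%N & seq_max i0 s F = F (nth i0 s k).
Proof.
move=> s0; have [_ _ [E|//]] := bigmax_seqP (F (head i0 s)) i0 s F.
by exists 0%N; rewrite ?nth0.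
Qed.

Lemma seq_min_le i0 s F k : (k < size s)%N -> seq_min i0 s F <= F (nth i0 s k).
Proof.
rewrite /seq_min; move: (F (head i0 s)) => c; elim: s k => //= x s IH [_|k ks].
  by rewrite big_cons ge_min lexx.
by rewrite big_cons ge_min IH ?orbT.
Qed.

End SeqExtrema.

Section CapCells.
Context {R : realType} {p : nat}.
Implicit Types (A B : set 'rV[R]_p) (As Bs : seq (set 'rV[R]_p)).

Definition separated A B : Prop := exists (v : 'rV[R]_p) (b : R), [/\ v != 0,
  forall x, A x -> b <= dotv v x & forall x, B x -> dotv v x <= b].

Lemma separatedC A B : separated A B -> separated B A.
Proof.
move=> [v [b [v0 vA vB]]]; exists (- v), (- b); split=> [|x Bx|x Ax]; rewrite ?oppr_eq0//.
  by rewrite dotvNl lerN2 vB.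
by rewrite dotvNl lerN2 vA.
Qed.

Definition cell_rel A B : bool := `[< A `&` B = set0 /\ separated A B >].

Definition disjoint_cells A B : bool := `[< A `&` B = set0 >].

Lemma cell_rel_disjoint A B : cell_rel A B -> disjoint_cells A B.
Proof. by move=> /asboolP[AB0 _]; apply/asboolP. Qed.

Variables (XX : set 'rV[R]_p).

(** The relation is a parameter because disjointness of the cells holds unconditionally whereas
    separation requires [few_on_hyperplanes]; the latter will come from general position, whose
    proof rests on the disjoint version. *)
Definition partition_with (r : rel (set 'rV[R]_p)) As : Prop :=
  [/\ forall x, XX x -> has (fun A => `[< A x >]) As,
      forall A, A \in As -> A `<=` XX & pairwise r As].

Definition separated_partition := partition_with cell_rel.

Lemma cell_relS A B A' B' : A' `<=` A -> B' `<=` B -> cell_rel A B -> cell_rel A' B'.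
Proof.
move=> AA BB /asboolP[AB0 [v [b [v0 vA vB]]]]; apply/asboolP; split.
  by rewrite -subset0 => x [/AA Ax /BB Bx]; rewrite -AB0.
by exists v, b; split=> // x; [move=> /AA; exact: vA|move=> /BB; exact: vB].
Qed.

Lemma cell_rel_sym A B : cell_rel A B = cell_rel B A.
Proof. by apply/asboolP/asboolP => -[e /separatedC]; rewrite setIC. Qed.

Variables (L : nat) (a : 'I_L -> R) (D : R) (ls : solver R p) (tb : seq nat -> nat).
Hypothesis htb : forall s, s != [::] -> tb s \in s.
Variables (n : nat) (z : dataset R p n).

Notation nmin := (@nmin R p D n).

Lemma nmin_gt0 : 0 < nmin.
Proof. by rewrite /Defs.nmin lt_max ltr0n muln_gt0 orbT. Qed.

Lemma sum_obs_setI As (V : {set 'I_n}) : pairwise disjoint_cells As ->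
  (\sum_(A <- As) #|obs z A :&: V| <= #|V|)%N.
Proof.
pose U As' := finset (fun i : 'I_n => has (fun A => i \in obs z A) As') :&: V.
move=> pw; suff -> : (\sum_(A <- As) #|obs z A :&: V| = #|U As|)%N.
  by rewrite subset_leq_card// subsetIr.
elim: As pw => [|A As IH] /=.
  by rewrite big_nil => _; apply/esym/eqP; rewrite cards_eq0; apply/eqP/setP => i; rewrite !inE.
move=> /andP[/allP AAs /IH E]; rewrite big_cons E.
have -> : U (A :: As) = (obs z A :&: V) :|: U As.
  by apply/setP => i; rewrite finset.in_setU !finset.in_setI 2!finset.in_set /= finset.in_set andb_orl.
rewrite cardsU.
suff -> : (obs z A :&: V) :&: U As = finset.set0 by rewrite cards0 subn0.
apply/setP => i; rewrite !finset.in_setI !finset.in_set; apply/negbTE/negP => /and3P[/andP[/asboolP Ai _]].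
move=> /hasP[B BAs]; rewrite inE => /asboolP Bi; have /asboolP AB0 := AAs _ BAs.
have : (A `&` B) (z i).1 by [].
by rewrite AB0.
Qed.

Lemma obs_disjoint_sum As : pairwise cell_rel As ->
  (\sum_(A <- As) #|obs z A| <= n)%N.
Proof.
move=> /(sub_pairwise cell_rel_disjoint) /(sum_obs_setI [set: 'I_n]%SET).
by rewrite cardsT card_ord; under eq_bigr do rewrite finset.setIT.
Qed.

Lemma size_large_cells As : pairwise cell_rel As -> large_cells D z As ->
  (size As)%:R * nmin <= n%:R.
Proof.
move=> /obs_disjoint_sum h /allP lc.
have : (\sum_(A <- As) #|obs z A|)%N%:R <= n%:R :> R by rewrite ler_nat.
apply: le_trans; rewrite natr_sum.
have -> : (size As)%:R * nmin = \sum_(A <- As) nmin.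
  by rewrite big_const_seq count_predT iter_addr addr0 mulr_natl.
by rewrite !big_seq; apply: ler_sum => A AAs; exact: lc.
Qed.

Lemma separated_partition1 : separated_partition [:: XX].
Proof.
by split=> [x Xx|A|//]; [rewrite /= orbF; apply/asboolP|rewrite inE => /eqP ->].
Qed.

Lemma partition_split (r : rel (set 'rV[R]_p)) As k j l :
  (forall A B A' B', A' `<=` A -> B' `<=` B -> r A B -> r A' B') ->
  (forall A b, r (A `&` [set x | x ord0 j <= b]) (A `&` [set x | b < x ord0 j])) ->
  (k < size As)%N -> partition_with r As -> partition_with r (split_cell a z As k j l).
Proof.
move=> rS rsplit ks [cov sub pw]; rewrite /split_cell.
set A := nth set0 As k; set b := split_level _ _ _ _ _.
set A1 := A `&` _; set A2 := A `&` _.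
have AsE : As = take k As ++ A :: drop k.+1 As by rewrite -drop_nth// cat_take_drop.
have A1A : A1 `<=` A by move=> x [].
have A2A : A2 `<=` A by move=> x [].
rewrite AsE in cov sub pw.
split=> [x Xx|B|].
- have := cov x Xx; rewrite !has_cat /= => /orP[->//|/orP[/asboolP Ax|->]]; last by rewrite !orbT.
  have A12x : `[< A1 x >] || `[< A2 x >].
    have [xb|bx] := leP (x ord0 j) b.
      by apply/orP; left; apply/asboolP; split.
    by apply/orP; right; apply/asboolP; split.
  by rewrite orbF A12x orbT.
- rewrite mem_cat !inE => /or3P[Bt|/eqP ->|/orP[/eqP ->|Bd]].
  + by apply: sub; rewrite mem_cat Bt.
  + by move=> x /A1A; apply: sub; rewrite mem_cat mem_head orbT.
  + by move=> x /A2A; apply: sub; rewrite mem_cat mem_head orbT.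
  + by apply: sub; rewrite mem_cat inE Bd !orbT.
have A12 : r A1 A2 by exact: rsplit.
move: pw; rewrite !pairwise_cat /= A12 /= => /and3P[/allrelP ar -> /andP[/allP Ad ->]].
rewrite !andbT; apply/and3P; split.
- apply/allrelP => B C Bt; rewrite !inE => /or3P[/eqP ->|/eqP ->|Cd].
  + by apply: (rS B A) => //; apply: ar => //; exact: mem_head.
  + by apply: (rS B A) => //; apply: ar => //; exact: mem_head.
  + by apply: ar => //; rewrite inE Cd orbT.
- by [].
- by apply/allrelP => B C; rewrite !inE => /orP[]/eqP -> /Ad AC; exact: (rS A C).
Qed.

Lemma split_disjoint A j b :
  disjoint_cells (A `&` [set x | x ord0 j <= b]) (A `&` [set x | b < x ord0 j]).
Proof.
apply/asboolP; rewrite -subset0 => x [[_ /= xb] [_ /= bx]].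
by have := lt_le_trans bx xb; rewrite ltxx.
Qed.

Lemma separated_partition_split As k j l : (k < size As)%N -> separated_partition As ->
  separated_partition (split_cell a z As k j l).
Proof.
apply: partition_split; first exact: cell_relS.
move=> A b; apply/asboolP; split; first by have /asboolP := split_disjoint A j b.
apply: separatedC; exists (delta_mx ord0 j), b; split; first exact: delta_row_neq0.
  by move=> x [_ /= bx]; rewrite dotv_delta ltW.
by move=> x [_ /= bx]; rewrite dotv_delta.
Qed.

Lemma mem_maximizers (hs : seq (@hyperplane R p)) x k : k \in maximizers hs x =
  (k < size hs)%N && (hval (nth 0 hs k) x == max_affine hs x).
Proof. by rewrite mem_filter mem_iota /= add0n andbC. Qed.

Lemma maximizers_neq0 (hs : seq (@hyperplane R p)) x : (0 < size hs)%N -> maximizers hs x != [::].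
Proof.
move=> s0; have [k ks kE] := seq_max_attained (0 : R * 'rV[R]_p) (hval ^~ x) s0.
have : k \in maximizers hs x by rewrite mem_maximizers ks /max_affine kE eqxx.
by case: maximizers.
Qed.

Lemma tb_maximizer (hs : seq (@hyperplane R p)) x : (0 < size hs)%N ->
  tb (maximizers hs x) \in maximizers hs x.
Proof. by move=> /maximizers_neq0 h; exact: htb. Qed.

(** Stated for as many hyperplanes as there can be cells with [nmin] observations: a refitted cell
    that is kept cannot be covered by them. *)
Definition few_on_hyperplanes : Prop := forall s : seq ('rV[R]_p * R),
  all (fun h => h.1 != 0) s -> (size s)%:R * nmin <= n%:R ->
  #|finset (fun i => has (fun h => dotv h.1 (z i).1 == h.2) s)|%:R < nmin.

(* Two cells of the refitted partition are separated by the difference of their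
   hyperplanes. If these coincide, the one that is not the tie-breaking choice
   only consists of points where a different hyperplane ties as well. *)
Lemma separated_partition_refit Bs : few_on_hyperplanes -> (0 < size Bs)%N ->
  (size Bs)%:R * nmin <= n%:R -> large_cells D z (refit_partition XX ls tb z Bs) ->
  separated_partition (refit_partition XX ls tb z Bs).
Proof.
move=> few s0 sn; rewrite /refit_partition; set hs := cap_hyperplanes ls z Bs.
have shs : size hs = size Bs by rewrite size_map.
rewrite shs; pose cell k := XX `&` [set x | tb (maximizers hs x) = k].
rewrite -/cell => /allP lc.
have hs0 : (0 < size hs)%N by rewrite shs.
have lcell k : (k < size Bs)%N -> nmin <= #|obs z (cell k)|%:R.
  by move=> ks; apply: lc; apply/mapP; exists k; rewrite ?mem_iota.
have cell_max k x : cell k x -> hval (nth 0 hs k) x = max_affine hs x.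
  by move=> [_ /= <-]; have := tb_maximizer x hs0; rewrite mem_maximizers => /andP[_ /eqP].
have le_max k x : (k < size Bs)%N -> hval (nth 0 hs k) x <= max_affine hs x.
  by rewrite -shs => ks; exact: (seq_max_ge (0 : R * 'rV[R]_p) (hval ^~ x)).
have cell_ge j k x : (j < size Bs)%N -> cell k x -> hval (nth 0 hs j) x <= hval (nth 0 hs k) x.
  by move=> js /cell_max ->; exact: le_max.
have slope_neq j k : (j < size Bs)%N -> (k < size Bs)%N -> j <> k ->
    (nth 0 hs j).2 != (nth 0 hs k).2.
  have nonempty i : (i < size Bs)%N -> exists x, cell i x.
    move=> /lcell /(lt_le_trans nmin_gt0); rewrite ltr0n => /card_gt0P[i']; rewrite inE => /asboolP.
    by exists (z i').1.
  (* At most one of [j], [k] is the tie-breaking choice among the copies of its hyperplane. If the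
     slopes agree then so do the intercepts, both cells being nonempty, and the two indices may be
     exchanged. *)
  wlog ktb : j k / k != tb [seq l <- iota 0 (size hs) | nth 0 hs l == nth 0 hs k].
    move=> WL js ks jk; apply/eqP => slope.
    have inter : nth 0 hs j = nth 0 hs k.
      have [x cx] := nonempty _ js; have [y cy] := nonempty _ ks.
      have := cell_ge _ _ _ ks cx; have := cell_ge _ _ _ js cy.
      rewrite /hval slope !lerD2r => h1 h2.
      apply/eqP; rewrite -pair_eqE /pair_eq /= slope eqxx andbT; apply/eqP.
      by apply: le_anti; rewrite h1 h2.
    have [kE|kN] := eqVneq k (tb [seq l <- iota 0 (size hs) | nth 0 hs l == nth 0 hs k]).
      have jN : j != tb [seq l <- iota 0 (size hs) | nth 0 hs l == nth 0 hs j].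
        by rewrite inter -kE; apply/eqP.
      by have /eqP := WL k j jN ks js (fun e => jk (esym e)); rewrite slope.
    by have /eqP := WL j k kN js ks jk; rewrite slope.
  move=> js ks jk.
  pose s := [seq ((nth 0 hs l).2 - (nth 0 hs k).2, (nth 0 hs k).1 - (nth 0 hs l).1) |
    l <- iota 0 (size hs) & (nth 0 hs l).2 != (nth 0 hs k).2].
  have s_ne : all (fun h => h.1 != 0) s.
    by apply/allP => _ /mapP[l + ->]; rewrite mem_filter /= subr_eq0 => /andP[].
  have s_size : (size s)%:R * nmin <= n%:R.
    apply: le_trans sn; rewrite ler_wpM2r ?(ltW nmin_gt0)// ler_nat size_map size_filter.
    by rewrite (leq_trans (count_size _ _))// size_iota shs.
  have := few s s_ne s_size; rewrite ltNge => /negP[].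
  apply: le_trans (lcell _ ks) _; rewrite ler_nat subset_leq_card//.
  apply/fintype.subsetP => i; rewrite !finset.in_set => ci0.
  have ci : cell k (z i).1 by exact/asboolP.
  have [_ /= tbk] := ci.
  (* Otherwise the maximizers at this point would be exactly the copies of the [k]-th hyperplane,
     among which [tb] does not choose [k]. *)
  have [l ls_ /andP[hl hlk]] : exists2 l, (l < size hs)%N &
      (hval (nth 0 hs l) (z i).1 == max_affine hs (z i).1) && (nth 0 hs l != nth 0 hs k).
    apply/exists2P; apply: contrapT => no; move/eqP: ktb; apply.
    rewrite -[LHS]tbk /maximizers; congr tb; apply: eq_in_filter => l; rewrite mem_iota add0n /= => lhs.
    apply/idP/idP => [hl|/eqP ->]; last by rewrite (cell_max k)// tbk.
    by apply: contrapT => /negP nl; apply: no; exists l; rewrite hl nl.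
  have slope_l : (nth 0 hs l).2 != (nth 0 hs k).2.
    apply: contraNneq hlk => slope; move: hl; rewrite -(cell_max k)// /hval slope => /eqP/addIr int.
    by rewrite -pair_eqE /pair_eq /= slope int !eqxx.
  apply/hasP; exists ((nth 0 hs l).2 - (nth 0 hs k).2, (nth 0 hs k).1 - (nth 0 hs l).1).
    by apply/mapP; exists l => //; rewrite mem_filter slope_l mem_iota.
  move: hl; rewrite -(cell_max k)// /hval => /eqP h.
  by apply/eqP; rewrite /= dotvBl; lra.
split.
- move=> x Xx; apply/hasP; exists (cell (tb (maximizers hs x))); last by apply/asboolP.
  have := tb_maximizer x hs0; rewrite mem_maximizers shs => /andP[tbs _].
  by apply/mapP; exists (tb (maximizers hs x)); rewrite ?mem_iota.
- by move=> _ /mapP[k _ ->] x [].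
apply/(pairwiseP set0) => j k; rewrite !inE size_map size_iota => js ks jk.
rewrite !(nth_map 0%N) ?size_iota// !nth_iota// !add0n.
split.
  by rewrite -subset0 => x [[_ /= xj] [_ /= xk]]; move: jk; rewrite -xj -xk ltnn.
have jk' : j <> k by move=> e; rewrite e ltnn in jk.
exists ((nth 0 hs j).2 - (nth 0 hs k).2), ((nth 0 hs k).1 - (nth 0 hs j).1); split.
- by rewrite subr_eq0 slope_neq.
- by move=> x /(cell_ge _ _ _ ks); rewrite /hval dotvBl; lra.
- by move=> x /(cell_ge _ _ _ js); rewrite /hval dotvBl; lra.
Qed.

Variable crit : forall n, dataset R p n -> seq (set 'rV[R]_p) -> R.

(** The one-cell model is never checked for its size, hence the alternative. Any later model comes
    from an admissible split, whose size condition bounds the number of hyperplanes that enter the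
    refit. *)
Lemma cap_partition_separated As : few_on_hyperplanes ->
  cap_partition XX a D ls tb crit z As ->
  separated_partition As /\ (As = [:: XX] \/ large_cells D z As).
Proof.
move=> few [Ms [Ms0 M0 step _] [K [KM -> _]]]; elim: K KM => [|K IH] KM.
  by rewrite M0; split; [exact: separated_partition1|left].
have [inv _] := IH (ltnW KM).
have [_ [Bs [[[k [j [l [ks BsE]]]] lB] _] ->]] := step _ KM.
have invB : separated_partition Bs by rewrite BsE; exact: separated_partition_split.
have B0 : (0 < size Bs)%N by rewrite BsE /split_cell !size_cat /= addnC addSn.
rewrite /refit; case: ifPn => [lr|_]; last by split=> //; right.
split; last by right.
apply: separated_partition_refit => //; apply: size_large_cells => //.
by case: invB.
Qed.

Lemma cap_partition_disjoint As : cap_partition XX a D ls tb crit z As ->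
  partition_with disjoint_cells As.
Proof.
move=> [Ms [Ms0 M0 step _] [K [KM -> _]]]; elim: K KM => [|K IH] KM.
  by rewrite M0; have [? ? _] := separated_partition1.
have inv := IH (ltnW KM).
have [_ [Bs [[[k [j [l [ks BsE]]]] lB] _] ->]] := step _ KM.
have invB : partition_with disjoint_cells Bs.
  rewrite BsE; apply: partition_split => //; last by move=> ? ?; exact: split_disjoint.
  move=> A B A' B' AA BB /asboolP AB0; apply/asboolP.
  by rewrite -subset0 => x [/AA Ax /BB Bx]; rewrite -AB0.
have B0 : (0 < size Bs)%N by rewrite BsE /split_cell !size_cat /= addnC addSn.
rewrite /refit; case: ifPn => // _; rewrite /refit_partition; set hs := cap_hyperplanes _ _ _.
have shs : (0 < size hs)%N by rewrite size_map.
split.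
- move=> x Xx; apply/hasP; exists (XX `&` [set y | tb (maximizers hs y) = tb (maximizers hs x)]); last first.
    by apply/asboolP; split.
  apply: map_f; have := tb_maximizer x shs; rewrite mem_maximizers => /andP[lt _].
  by rewrite mem_iota add0n lt.
- by move=> A /mapP[k' _ ->] x [].
- rewrite pairwise_map; have := iota_uniq 0 (size hs); rewrite uniq_pairwise.
  apply: sub_pairwise => k1 k2 /= k12; apply/asboolP; rewrite -subset0 => x [[_ /= e1] [_ /= e2]].
  by move: k12; rewrite -e1 -e2 eqxx.
Qed.

End CapCells.

(** * Measurability of the family of traces *)

Section TraceMeasurability.
Context {R : realType} {p n : nat}.

(** Finitely many points leave room to move the halfspace, so being a trace is a countable
    disjunction; this makes the trace events measurable. *)
Lemma halfspace_trace_rational (x : 'I_n -> 'rV[R]_p) (S : {set 'I_n}) :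
  halfspace_trace x S <-> exists (v : 'rV[rat]_p) (b : rat),
    forall a, (a \in S) = (ratr b < dotv (map_mx ratr v) (x a)).
Proof.
split=> [[v [b vb]]|[v [b vb]]]; last by exists (map_mx ratr v), (ratr b).
(* First a level strictly between the two sides, then a small perturbation of [v] *)
have [b' [eta [eta0 hb']]] : exists (b' : R) (eta : R), 0 < eta /\
    forall a, if a \in S then b' + eta <= dotv v (x a) else dotv v (x a) <= b' - eta.
  (* The default [b + 1] keeps the minimum above [b] and serves for the empty [S]. *)
  pose m := \big[Num.min/b + 1]_(a in S) dotv v (x a).
  have bm : b < m.
    apply: (big_ind (fun y => b < y)); first by rewrite ltrDl.
      by move=> y z by_ bz; rewrite lt_min by_.
    by move=> a; rewrite vb.
  exists ((b + m) / 2), ((m - b) / 2); split; first by rewrite divr_gt0// subr_gt0.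
  move=> a; case: ifPn => aS.
    have -> : (b + m) / 2 + (m - b) / 2 = m by field.
    by rewrite /m (bigminD1 a)// ge_min lexx.
  have -> : (b + m) / 2 - (m - b) / 2 = b by field.
  by rewrite leNgt -vb.
pose M := 1 + \sum_a norm2 (x a).
have M0 : 0 < M by rewrite ltr_pwDl// sumr_ge0// => a _; exact: norm2_ge0.
have aM a : norm2 (x a) <= M.
  rewrite /M (bigD1 a)//= addrCA lerDl addr_ge0// sumr_ge0// => k _; exact: norm2_ge0.
pose s := Num.sqrt p%:R + 1 : R.
have s0 : 0 < s by rewrite ltr_wpDl// sqrtr_ge0.
pose del := eta / (4 * s * M).
have del0 : 0 < del by rewrite divr_gt0// !mulr_gt0.
have rat_near (y z : R) : 0 < z -> exists q : rat, `|ratr q - y| <= z.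
  move=> z0; have [|q] := @rat_in_itvoo R (y - z) (y + z); first by lra.
  rewrite in_itv /= => /andP[h1 h2]; exists q.
  by rewrite ler_norml; apply/andP; split; lra.
have [g hg] := choice (fun j : 'I_p => rat_near (v ord0 j) del del0).
have eta4 : 0 < eta / 4 by rewrite divr_gt0.
have [q hq] := rat_near b' (eta / 4) eta4.
exists (\row_j g j), q => a.
have dv : `|dotv (map_mx ratr (\row_j g j)) (x a) - dotv v (x a)| <= eta / 4.
  rewrite -dotvBl (le_trans (cauchy_schwarz _ _))//.
  apply: (@le_trans _ _ ((s * del) * M)).
    apply: ler_pM => //; rewrite ?norm2_ge0//.
    apply: (@le_trans _ _ (Num.sqrt p%:R * del)).
      by apply: norm2_le_coord => j; rewrite !mxE.
    by rewrite ler_wpM2r ?(ltW del0)// /s lerDl.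
  rewrite /del le_eqVlt; apply/orP; left; apply/eqP; field.
  by rewrite !lt0r_neq0.
move: hq dv; rewrite !ler_norml => /andP[q1 q2] /andP[d1 d2].
have := hb' a; case: ifPn => aS h; apply/esym.
  by apply/idP; lra.
by apply/negbTE; rewrite -leNgt; lra.
Qed.

Lemma jointly_measurable_traces (H : {set {set 'I_n}}) :
  jointly_measurable (fun x : 'I_n -> g_sigma_algebraType (@open 'rV[R]_p) => traces x = H).
Proof.
move=> d S x mx.
have m1 (v : 'rV[rat]_p) (b : rat) (a : 'I_n) :
    measurable [set s | ratr b < dotv (map_mx ratr v) (x a s)].
  have := measurable_fun_ltr (measurable_cst (ratr b : R)) (measurableT_comp (measurable_dotv (map_mx ratr v)) (mx a)).
  by move=> /(_ measurableT [set true] I); rewrite setTI.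
have mS (U : {set 'I_n}) : measurable [set s | U \in traces (x ^~ s)].
  rewrite (_ : [set s | _] = \bigcup_(vb in [set: 'rV[rat]_p * rat])
      \bigcap_(a in [set: 'I_n]) [set s | (a \in U) = (ratr vb.2 < dotv (map_mx ratr vb.1) (x a s))]).
    apply: countable_bigcupT_measurable; first exact: countableP.
    move=> [v b]; apply: fin_bigcap_measurable => [|a _]; first exact: finite_finset.
    case: (a \in U) => /=.
      rewrite (_ : [set s | _] = [set s | ratr b < dotv (map_mx ratr v) (x a s)]); first exact: m1.
      by apply/seteqP; split=> s /=; [move=> <-|move=> ->].
    rewrite (_ : [set s | _] = ~` [set s | ratr b < dotv (map_mx ratr v) (x a s)]);
      first by apply: measurableC; exact: m1.
    by apply/seteqP; split=> s /=; [move=> <-|move/negP/negbTE ->].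
  apply/seteqP; split=> s /=.
    by move=> /tracesP/halfspace_trace_rational[v [b h]]; exists (v, b) => // a _; exact: h.
  by move=> [[v b] _ h]; apply/tracesP/halfspace_trace_rational; exists v, b => a; exact: h.
rewrite (_ : [set s | _] = \bigcap_(U in [set: {set 'I_n}])
    [set s | (U \in traces (x ^~ s)) = (U \in H)]).
  apply: fin_bigcap_measurable => [|U _]; first exact: finite_finset.
  case: (U \in H) => /=.
    exact: mS.
  rewrite (_ : [set s | _] = ~` [set s | U \in traces (x ^~ s)]); first by apply: measurableC; exact: mS.
  by apply/seteqP; split=> s /=; [move=> ->|move/negP/negbTE].
by apply/seteqP; split=> s /=; [move=> <-|move=> h; apply/setP => U; exact: h].
Qed.

End TraceMeasurability.

(** * Least squares on a cell *)

Section Rayleigh.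
Context {R : realType}.

Lemma continuous_sum (T : topologicalType) (I : Type) (r : seq I) (F : I -> T -> R) :
  (forall i, continuous (F i)) -> continuous (fun x => \sum_(i <- r) F i x).
Proof.
move=> cF; elim: r => [|i r IH].
  by under eq_fun do rewrite big_nil; move=> x; exact: cvg_cst.
under eq_fun do rewrite big_cons; move=> x; apply: cvgD; [exact: cF|exact: IH].
Qed.

Lemma continuous_mul (T : topologicalType) (f g : T -> R) :
  continuous f -> continuous g -> continuous (fun x => f x * g x).
Proof. by move=> cf cg x; apply: cvgM; [exact: cf|exact: cg]. Qed.

Lemma continuous_coord q j : continuous (fun u : 'rV[R]_q => u ord0 j).
Proof. by move=> u; exact: coord_continuous. Qed.

Lemma dotvE q (u v : 'rV[R]_q) : dotv u v = (u *m v^T) ord0 ord0.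
Proof. by rewrite mxE; apply: eq_bigr => j _; rewrite mxE. Qed.

Lemma unit_sphere_compact q : compact [set u : 'rV[R]_q | dotv u u = 1].
Proof.
apply: bounded_closed_compact.
  exists 1; split => // M M1 u /= u1; rewrite (le_trans _ (ltW M1))// (_ : `|u| = mx_norm u)// mx_normrE.
  apply: bigmax_le => // -[i j] _; rewrite /= (ord1 i) (le_trans (coord_le_norm2 _ _))//.
  by rewrite /norm2 u1 sqrtr1.
rewrite (_ : [set u | _] = (fun u : 'rV[R]_q => dotv u u) @^-1` [set 1]); last by [].
apply: preimage_closed; last exact: closed_eq.
move=> u _; apply: continuous_sum => j.
by apply: continuous_mul; exact: continuous_coord.
Qed.

(** Variational characterization: the quadratic form attains its minimum on the unit sphere, a
    first-order variation shows that the minimizer is an eigenvector, and so the infimum of the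
    eigenvalues is at most the minimum. *)
Lemma smallest_eigenvalue_le q (B : 'M[R]_q) (u : 'rV[R]_q) : B^T = B ->
  smallest_eigenvalue B * dotv u u <= dotv (u *m B) u.
Proof.
move=> BT; have [->|u0] := eqVneq u 0; first by rewrite mul0mx !dotv0r mulr0.
pose Q (v : 'rV[R]_q) := dotv (v *m B) v.
have sym (v w : 'rV[R]_q) : dotv (v *m B) w = dotv (w *m B) v.
  rewrite !dotvE -[RHS](mxE trmx_key (fun i j => _ j i)) -/(trmx _).
  by rewrite !trmx_mul !trmxK BT mulmxA.
have scal c (v : 'rV[R]_q) : Q (c *: v) = c ^+ 2 * Q v.
  by rewrite /Q -scalemxAl dotvZl dotvZr mulrA expr2.
have unit_of (v : 'rV[R]_q) : v != 0 -> dotv ((norm2 v)^-1 *: v) ((norm2 v)^-1 *: v) = 1.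
  move=> v0; rewrite dotvZl dotvZr -norm2_sqr mulrA -expr2 -exprMn mulVf ?expr1n//.
  by rewrite norm2_eq0.
have [|||m m1 mmin] := @compact_EVT_min _ _ Q [set u : 'rV[R]_q | dotv u u = 1].
- by exists ((norm2 u)^-1 *: u); exact: unit_of.
- exact: unit_sphere_compact.
- apply: continuous_subspaceT; apply: continuous_sum => j.
  apply: continuous_mul; last exact: continuous_coord.
  under eq_fun do rewrite mxE; apply: continuous_sum => k.
  by apply: continuous_mul; [exact: continuous_coord|exact: cst_continuous].
rewrite inE /= in m1.
have minQ v : Q m * dotv v v <= Q v.
  have [->|v0] := eqVneq v 0; first by rewrite /Q mul0mx !dotv0r mulr0.
  have := mmin ((norm2 v)^-1 *: v); rewrite inE => /(_ (unit_of v v0)).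
  rewrite scal -norm2_sqr -(ler_pM2r (_ : 0 < norm2 v ^+ 2)) ?exprn_gt0 ?norm2_gt0//.
  by rewrite exprVn mulrAC mulVf ?mul1r// expf_eq0 norm2_eq0.
have eigm : m *m B = Q m *: m.
  apply/eqP; rewrite -subr_eq0 -dotv_eq0; set w := m *m B - Q m *: m.
  have lin : dotv (m *m B) w - Q m * dotv m w = dotv w w.
    by rewrite {3}/w dotvBl dotvZl.
  have {lin} lin2 : dotv (m *m B) w = dotv w w + Q m * dotv m w by rewrite -lin subrK.
  move: w lin2 => w lin2.
  have quad s : 0 <= 2 * s * dotv w w + s ^+ 2 * (Q w - Q m * dotv w w).
    have := minQ (m + s *: w); rewrite /Q mulmxDl -scalemxAl.
    rewrite !(dotvDl, dotvDr, dotvZl, dotvZr) m1 (sym w m) ?(dotvC w m) -/(Q w) -/(Q m) -subr_ge0.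
    rewrite lin2 => h; apply: le_trans h _.
    by rewrite le_eqVlt; apply/orP; left; apply/eqP; ring.
  set a := dotv w w in quad *; set b := Q w - Q m * a in quad *.
  have a0 : 0 <= a by exact: dotv_ge0.
  apply/eqP/le_anti; rewrite a0 andbT leNgt; apply/negP => agt0.
  have c0 : 0 < 1 + `|b| by rewrite ltr_pwDl.
  have := quad (- (a / (1 + `|b|))); apply/negP; rewrite -ltNge.
  have -> : 2 * - (a / (1 + `|b|)) * a + (- (a / (1 + `|b|))) ^+ 2 * b =
      (a / (1 + `|b|)) ^+ 2 * (b - 2 * (1 + `|b|)) by field; rewrite lt0r_neq0.
  rewrite pmulr_rlt0 ?exprn_gt0 ?divr_gt0//.
  by have := ler_norm b; have := normr_ge0 b; lra.
apply: le_trans (minQ u); rewrite ler_wpM2r ?dotv_ge0//.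
apply: ge_inf; last first.
  apply/eigenvalueP; exists m => //; apply/negP => /eqP m0.
  by move/eqP: m1; rewrite m0 dotv0r eq_sym oner_eq0.
exists (Q m) => l /eigenvalueP[v vl v0].
have vv : 0 < dotv v v by rewrite lt_neqAle dotv_ge0 andbT eq_sym dotv_eq0.
by have := minQ v; rewrite /Q vl dotvZl ler_pM2r.
Qed.

(** The Rayleigh bound at the vector (0, v), which discards the constant coordinate of [Gam]. It
    turns A4 into a lower bound on the spread of a cell in every direction, relative to its
    diameter. *)
Lemma cell_variance p n (z : dataset R p n) (A : set 'rV[R]_p) (v : 'rV[R]_p) :
  0 < diameter A -> (0 < #|obs z A|)%N ->
  lambda_cell z A * (#|obs z A|%:R * diameter A ^+ 2 * dotv v v) <=
  \sum_(i in obs z A) dotv v ((z i).1 - cell_mean z A) ^+ 2.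
Proof.
move=> d0 c0; set d := diameter A; set c := #|obs z A|%:R.
have c0' : 0 < c by rewrite ltr0n.
pose u : 'rV[R]_(1 + p) := row_mx 0 v.
have uu : dotv u u = dotv v v.
  rewrite /dotv big_split_ord /= big_ord1 row_mxEl mxE mul0r add0r.
  by apply: eq_bigr => j _; rewrite row_mxEr.
have uG i : (u *m Gam z A i) = (d^-1 * dotv v ((z i).1 - cell_mean z A))%:M.
  rewrite mul_row_col mul0mx add0r linearZ /= -scalemxAr.
  by apply/matrixP => a b; rewrite !ord1 mxE dotvE !mxE eqxx mulr1n.
have sym : (c^-1 *: gram z A)^T = c^-1 *: gram z A.
  rewrite linearZ /= /gram; congr (_ *: _); rewrite linear_sum /=.
  by apply: eq_bigr => i _; rewrite trmx_mul trmxK.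
have := smallest_eigenvalue_le u sym; rewrite -/(lambda_cell z A) uu.
have -> : dotv (u *m (c^-1 *: gram z A)) u =
    (c * d ^+ 2)^-1 * \sum_(i in obs z A) dotv v ((z i).1 - cell_mean z A) ^+ 2.
  rewrite dotvE -scalemxAr -scalemxAl mxE /gram mulmx_sumr mulmx_suml summxE.
  rewrite invfM -mulrA [X in _ = _ * X]mulr_sumr; congr (_ * _); apply: eq_bigr => i _.
  rewrite mulmxA uG -mulmxA -trmx_mul uG tr_scalar_mx -scalar_mxM mxE eqxx mulr1n.
  by field; rewrite lt0r_neq0.
rewrite [X in _ <= X]mulrC ler_pdivlMr ?mulr_gt0 ?exprn_gt0// => h.
by apply: le_trans h; rewrite le_eqVlt; apply/orP; left; apply/eqP; ring.
Qed.

End Rayleigh.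

(** * Convex differentiable functions: tangents and uniform continuity of the gradient *)

Section ConvexC1.
Context {R : realType} {p : nat}.
Variables (XX : set 'rV[R]_p) (f : 'rV[R]_p -> R).
Hypotheses (cvxX : convex_set XX) (cvxf : convex_function XX f).

Lemma convex_set_segment x y (t : R) : XX x -> XX y -> 0 <= t <= 1 ->
  XX (x + t *: (y - x)).
Proof.
move=> Xx Xy /andP[t0 t1]; have := cvxX (y := x) (x := y) (Itv01 t0 t1).
rewrite !inE => /(_ Xy Xx); rewrite /conv /=.
by congr XX; apply/rowP => j; rewrite !mxE /unstable.onem; ring.
Qed.

Lemma convex_function_segment x y (t : R) : XX x -> XX y -> 0 <= t <= 1 ->
  f (x + t *: (y - x)) <= f x + t * (f y - f x).
Proof.
move=> Xx Xy /andP[t0 t1]; have := @cvxf (Itv01 t0 t1) y x.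
rewrite !inE => /(_ Xy Xx); rewrite convRE /=.
have -> : x + t *: (y - x) = t *: y + unstable.onem t *: x.
  by apply/rowP => j; rewrite !mxE /unstable.onem; ring.
by move=> /le_trans; apply; rewrite le_eqVlt; apply/orP; left; apply/eqP; rewrite /unstable.onem; ring.
Qed.

Lemma convex_mean (I : finType) (C : {set I}) (x : I -> 'rV[R]_p) :
  (0 < #|C|)%N -> (forall i, i \in C -> XX (x i)) ->
  XX (#|C|%:R^-1 *: \sum_(i in C) x i).
Proof.
rewrite -sum1_card -big_enum -[\sum_(i in C) x i]big_enum /=.
have : forall i, i \in enum C -> i \in C by move=> i; rewrite mem_enum.
rewrite big_enum sum1_card cardE.
elim: (enum C) => // i s IH sC _ CX.
have [s0|s0] := posnP (size s).
  by rewrite (size0nil s0) big_seq1 /= invr1 scale1r; apply/CX/sC/mem_head.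
have Xs := IH (fun j js => sC j (mem_behead (s := i :: s) js)) s0 CX.
have Xi : XX (x i) by apply/CX/sC/mem_head.
have sn : 0 < (size s)%:R :> R by rewrite ltr0n.
have := @convex_set_segment _ _ ((size s).+1%:R^-1) Xs Xi.
rewrite invr_ge0 ler0n /= invf_le1 ?ltr0n// ler1n /= => /(_ isT).
congr XX; rewrite big_cons /=; apply/rowP => j; rewrite !mxE -natr1; field.
by rewrite !lt0r_neq0// addr_gt0.
Qed.

Variable g : 'rV[R]_p -> 'rV[R]_p.
Hypothesis cg : {within XX, continuous g}.
Hypothesis dg : forall x, XX x -> forall e : R, 0 < e ->
  exists2 delta : R, 0 < delta & forall y, XX y -> norm2 (y - x) < delta ->
    `|f y - f x - dotv (g x) (y - x)| <= e * norm2 (y - x).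

(** [g] is a derivative relative to [XX] only. The segment from [x] to [y] stays in [XX] by
    convexity, and along it the first-order expansion at [x] is compared with the chord. *)
Lemma tangent_le x y : XX x -> XX y -> f x + dotv (g x) (y - x) <= f y.
Proof.
move=> Xx Xy; have [->|xy] := eqVneq y x; first by rewrite subrr dotv0r addr0.
have N0 : 0 < norm2 (y - x) by rewrite norm2_gt0 subr_eq0.
apply/ler_addgt0Pr => e e0.
have [del del0 h] := dg Xx (divr_gt0 e0 N0).
pose t := Num.min 1 (del / (2 * norm2 (y - x))).
have t0 : 0 < t by rewrite lt_min ltr01 divr_gt0// mulr_gt0.
have t1 : t <= 1 by rewrite ge_min lexx.
have t01 : 0 <= t <= 1 by rewrite (ltW t0).
have E : x + t *: (y - x) - x = t *: (y - x) by rewrite addrAC subrr add0r.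
have := h _ (convex_set_segment Xx Xy t01).
rewrite E norm2Z (gtr0_norm t0) dotvZr.
have tdel : t * norm2 (y - x) < del.
  apply: (@le_lt_trans _ _ (del / 2)); last by lra.
  rewrite -ler_pdivlMr// ge_min; apply/orP; right.
  by rewrite le_eqVlt; apply/orP; left; apply/eqP; field; rewrite lt0r_neq0.
move=> /(_ tdel) /ler_normlP[+ _].
have -> : e / norm2 (y - x) * (t * norm2 (y - x)) = t * e by field; rewrite lt0r_neq0.
have := convex_function_segment Xx Xy t01 => h1 h2.
have : t * (dotv (g x) (y - x) - (f y - f x) - e) <= 0.
  set D := dotv _ _ in h2 *; set F := f (_ + _) in h1 h2 *; set fy := f y in h1 *; set fx := f x in h1 h2 *.
  by clear -h1 h2; nra.
by rewrite pmulr_rle0//; lra.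
Qed.

Hypothesis compX : compact XX.

(** Heine-Cantor. The topology is that of the sup norm, whence the comparisons with [norm2] and the
    factor sqrt p. *)
Lemma uniform_gradient (e : R) : 0 < e -> exists2 eta : R, 0 < eta &
  forall x y, XX x -> XX y -> norm2 (y - x) <= eta -> norm2 (g y - g x) <= e.
Proof.
(* The added 1 keeps [s] positive when [p = 0]. *)
move=> e0; pose s := Num.sqrt p%:R + 1 : R.
have s0 : 0 < s by rewrite ltr_wpDl// sqrtr_ge0.
pose e' := e / s / 2; have e'0 : 0 < e' by rewrite !divr_gt0.
have /compact_near_coveringP/(_ R (0^'+) (fun eta x => XX x -> forall y, XX y -> norm2 (y - x) <= eta ->
  norm2 (g y - g x) <= e)) := compX.
move=> H; have {H} : \forall eta \near 0^'+, XX `<=` [set x | XX x -> forall y, XX y ->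
    norm2 (y - x) <= eta -> norm2 (g y - g x) <= e].
  apply: H => x Xx.
  have /subspace_continuousP /(_ x Xx) /cvgrPdist_lt /(_ e' e'0) := cg.
  rewrite near_withinE => /nbhs_ballP[r /= r0 hr].
  exists (ball x (r / 2), [set eta : R | eta < r / 2]) => /=.
    split; first by apply: nbhsx_ballx; rewrite divr_gt0.
    by apply: nbhs_right_lt; rewrite divr_gt0.
  move=> [x' eta] /= [bx' eta_r] Xx' y Xy yx'.
  have supn (v : 'rV[R]_p) : `|v| <= norm2 v.
    rewrite (_ : `|v| = mx_norm v)// mx_normrE; apply: bigmax_le; first exact: norm2_ge0.
    by move=> [i j] _ /=; rewrite (ord1 i) coord_le_norm2.
  have hx' : `|g x - g x'| < e'.
    by apply: hr => //; apply: le_ball bx'; rewrite ler_pdivrMr// ler_peMr ?(ltW r0)// ler1n.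
  have hy : `|g x - g y| < e'.
    apply: hr => //; move: bx'; rewrite -!ball_normE /= => bx'.
    rewrite (_ : x - y = (x - x') - (y - x')); last by rewrite opprB addrA subrK.
    rewrite (le_lt_trans (ler_normB _ _))//.
    have := le_trans (supn (y - x')) yx'; lra.
  apply: (@le_trans _ _ (Num.sqrt p%:R * (2 * e'))); last first.
    have -> : e = s * (2 * e') by rewrite /e'; field; rewrite lt0r_neq0.
    by apply: ler_wpM2r; [rewrite mulr_ge0// ltW|rewrite /s lerDl].
  apply: norm2_le_coord => j.
  have nle : `|(g y - g x') ord0 j| <= `|g y - g x'|.
    by rewrite [leRHS](_ : _ = mx_norm (g y - g x'))// mx_normrE; apply: (le_bigmax _ (fun ij : 'I_1 * 'I_p => `|(g y - g x') ij.1 ij.2|) (ord0, j)).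
  apply: le_trans nle _; rewrite (_ : g y - g x' = (g x - g x') - (g x - g y)).
    by rewrite (le_trans (ler_normB _ _))//; lra.
  by rewrite opprB [RHS]addrC addrA subrK.
move=> /(filterI (nbhs_right_gt 0)) /filter_ex[eta [eta0 h]].
by exists eta => // x y Xx Xy; apply: h.
Qed.

End ConvexC1.

(** * Least squares error in terms of bias and sums of residuals *)

Section LeastSquares.
Context {R : realType}.

(** First-order condition for a quadratic function minimal at 0, tested at the single point -b / (1
    + |c|). *)
Lemma linear_term_eq0 (b c : R) : (forall s, 0 <= b * s + c * s ^+ 2) -> b = 0.
Proof.
move=> h; have c0 : 0 < 1 + `|c| by rewrite ltr_pwDl.
have := h (- b / (1 + `|c|)).
have -> : b * (- b / (1 + `|c|)) + c * (- b / (1 + `|c|)) ^+ 2 =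
    (b / (1 + `|c|)) ^+ 2 * (c - (1 + `|c|)) by field; rewrite lt0r_neq0.
have cn : c - (1 + `|c|) < 0 by have := ler_norm c; lra.
rewrite nmulr_lge0// => h1.
have /eqP : (b / (1 + `|c|)) ^+ 2 = 0 by apply/le_anti; rewrite h1 sqr_ge0.
by rewrite expf_eq0 /= mulf_eq0 invr_eq0 (gt_eqF c0) orbF => /eqP.
Qed.

(** Induction on the number of indices with [phi] above [l]. If [y] is the smallest such value, phi
    - l = (y - l) + (phi - y): the first part is a multiple of a level sum, the second is the same
    problem with [l] raised to [y], and the increments add up to at most u - l. *)
Lemma abel_bound (I : finType) (C : {set I}) (phi e : I -> R) (M l u : R) : l <= u ->
  (forall i, i \in C -> phi i <= u) ->
  (forall c, `|\sum_(i in C | c < phi i) e i| <= M) ->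
  `|\sum_(i in C | l < phi i) (phi i - l) * e i| <= M * (u - l).
Proof.
move=> lu phu hM; have M0 : 0 <= M by apply: le_trans (hM 0).
have [m] := ubnP #|finset (fun i => (i \in C) && (l < phi i))|.
elim: m l lu => // m IH l lu cm.
have [E|[i0]] := set_0Vmem (finset (fun i => (i \in C) && (l < phi i))).
  rewrite big_pred0 ?normr0 ?mulr_ge0 ?subr_ge0// => i.
  by have /setP /(_ i) := E; rewrite !finset.inE.
rewrite finset.inE => Pi0; case: (@arg_minP _ _ _ i0 (fun i => (i \in C) && (l < phi i)) phi Pi0) => i /andP[iC li] imin.
set y := phi i in li imin.
have yu : y <= u by exact: phu.
have lt : (#|finset (fun k => (k \in C) && (y < phi k)%R)| < m)%N.
  rewrite (@leq_trans #|finset (fun k => (k \in C) && (l < phi k)%R)|)//.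
  apply/proper_card/properP; split.
    by apply/fintype.subsetP => k; rewrite !finset.inE => /andP[-> /(lt_trans li)].
  by exists i; rewrite !finset.inE ?iC //= -/y ltxx.
have := IH y yu lt.
have -> : \sum_(k in C | l < phi k) (phi k - l) * e k =
    (y - l) * (\sum_(k in C | l < phi k) e k) + \sum_(k in C | y < phi k) (phi k - y) * e k.
  rewrite mulr_sumr [X in _ = _ + X](_ : _ = \sum_(k in C | l < phi k) (phi k - y) * e k); last first.
    rewrite big_mkcondr [RHS]big_mkcondr /=; apply: eq_bigr => k kC.
    case: (ltP y (phi k)) => [yk|ky]; first by rewrite (lt_trans li yk).
    case: ifP => // lk; have := imin k; rewrite kC lk => /(_ isT) yk.
    have ky' : phi k = y by apply/le_anti; rewrite ky yk.
    by rewrite ky' subrr mul0r.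
  by rewrite -big_split /=; apply: eq_bigr => k _; ring.
move=> h; apply: (le_trans (ler_normD _ _)).
rewrite normrM gtr0_norm ?subr_gt0//.
have := hM l; have : 0 < y - l by rewrite subr_gt0.
by set S1 := `|_|; set S2 := `|_| in h *; nra.
Qed.

Lemma centered_abel_bound (I : finType) (C : {set I}) (phi e : I -> R) (M l u m : R) :
  (forall i, i \in C -> l <= phi i <= u) -> l <= m <= u ->
  (forall c, `|\sum_(i in C | c < phi i) e i| <= M) ->
  `|\sum_(i in C) (phi i - m) * e i| <= 2 * M * (u - l).
Proof.
move=> lphu /andP[lm mu] hM; have M0 : 0 <= M by apply: le_trans (hM 0).
have lu := le_trans lm mu.
have tot : `|\sum_(i in C) e i| <= M.
  (* A level below all values gives the full sum. *)
  have := hM (l - 1); congr (`| _ | <= _); apply: eq_bigl => i.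
  case: (boolP (i \in C)) => //= iC; have /andP[h _] := lphu i iC.
  by apply: lt_le_trans h; lra.
have := abel_bound lu (fun i iC => (andP (lphu i iC)).2) hM.
have -> : \sum_(i in C | l < phi i) (phi i - l) * e i = \sum_(i in C) (phi i - l) * e i.
  rewrite big_mkcondr /=; apply: eq_bigr => i iC; case: ltP => // h.
  have /andP[h' _] := lphu i iC.
  have il : phi i = l by apply/le_anti; rewrite h h'.
  by rewrite il subrr mul0r.
have -> : \sum_(i in C) (phi i - m) * e i =
    \sum_(i in C) (phi i - l) * e i - (m - l) * \sum_(i in C) e i.
  by rewrite mulr_sumr -sumrB; apply: eq_bigr => i _; ring.
move=> h; apply: (le_trans (ler_normB _ _)); rewrite normrM ger0_norm ?subr_ge0//.
have ml : 0 <= m - l by rewrite subr_ge0.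
by set S1 := `|_| in h *; set S2 := `|_| in tot *; nra.
Qed.

Context {p : nat}.

Lemma normal_equations (ls : solver R p) n (z : dataset R p n) (C : {set 'I_n})
    (a : R) (v : 'rV[R]_p) : least_squares_solver ls ->
  \sum_(i in C) ((z i).2 - hval (ls n z C) (z i).1) * (a + dotv v (z i).1) = 0.
Proof.
move=> hls; set h := ls n z C; pose r i := (z i).2 - hval h (z i).1.
pose g i := a + dotv v (z i).1.
suff : -2 * (\sum_(i in C) r i * g i) = 0.
  by move/eqP; rewrite mulf_eq0 oppr_eq0 pnatr_eq0 /= => /eqP.
apply: (@linear_term_eq0 _ (\sum_(i in C) g i ^+ 2)) => s.
have := hls n z C (h.1 + s * a, h.2 + s *: v); rewrite -/h -subr_ge0 /rss -sumrB.
have -> : \sum_(i in C) (((z i).2 - hval (h.1 + s * a, h.2 + s *: v) (z i).1) ^+ 2 -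
    ((z i).2 - hval h (z i).1) ^+ 2) =
    -2 * (\sum_(i in C) r i * g i) * s + (\sum_(i in C) g i ^+ 2) * s ^+ 2; last by [].
rewrite -mulrA [_ * s]mulr_suml mulr_sumr [_ * s ^+ 2]mulr_suml -big_split /=.
by apply: eq_bigr => i _; rewrite /r /g /hval /= dotvDl dotvZl; ring.
Qed.

(** The normal equations are tested twice. Against 1 they give [a], since linear terms are centred
    at [xb]; against w . (x - xb) itself they lose [a] and bound c |C| d^2 |w|^2 by quantities
    linear in |w|. *)
Lemma least_squares_error (ls : solver R p) n (z : dataset R p n) (C : {set 'I_n})
    (f : 'rV[R]_p -> R) (xb G : 'rV[R]_p) (F d c ups del del' : R) :
  least_squares_solver ls -> (0 < #|C|)%N -> 0 < d -> 0 < c -> 0 <= ups -> 0 <= del' ->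
  xb = #|C|%:R^-1 *: \sum_(i in C) (z i).1 ->
  (forall v, c * (#|C|%:R * d ^+ 2 * dotv v v) <= \sum_(i in C) dotv v ((z i).1 - xb) ^+ 2) ->
  (forall i, i \in C -> norm2 ((z i).1 - xb) <= d) ->
  (forall i, i \in C -> `|f (z i).1 - F - dotv G ((z i).1 - xb)| <= ups * d) ->
  `|\sum_(i in C) ((z i).2 - f (z i).1)| <= del * #|C|%:R * d ->
  norm2 (\sum_(i in C) ((z i).2 - f (z i).1) *: ((z i).1 - xb)) <= del' * #|C|%:R * d ^+ 2 ->
  exists (a : R) (w : 'rV[R]_p), [/\ `|a| <= (ups + del) * d, norm2 w <= (ups + del') / c &
    forall x, hval (ls n z C) x = F + dotv G (x - xb) + a + dotv w (x - xb)].
Proof.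
move=> hls C0 d0 c0 ups0 del0 xbE var xd bias noise0 noise1.
set h := ls n z C; have cC : 0 < #|C|%:R :> R by rewrite ltr0n.
have centered : \sum_(i in C) ((z i).1 - xb) = 0.
  by rewrite sumrB sumr_const xbE -scaler_nat scalerA divff ?lt0r_neq0// scale1r subrr.
pose w := h.2 - G; pose a := h.1 + dotv h.2 xb - F.
have hE x : hval h x = F + dotv G (x - xb) + a + dotv w (x - xb).
  by rewrite /hval /a /w !(dotvBl, dotvBr); ring.
pose rho i := f (z i).1 - F - dotv G ((z i).1 - xb).
pose e i := (z i).2 - f (z i).1.
have rE i : (z i).2 - hval h (z i).1 = rho i + e i - a - dotv w ((z i).1 - xb).
  by rewrite hE /rho /e; ring.
exists a, w; split=> //.
- have := normal_equations z C 1 0 hls; rewrite -/h.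
  under eq_bigr do rewrite dotv0l addr0 mulr1 rE.
  rewrite sumrB -dotv_sumr centered dotv0r subr0 sumrB sumr_const => /eqP; rewrite subr_eq0 => /eqP E.
  have : `|a| * #|C|%:R <= (ups + del) * d * #|C|%:R.
    rewrite -[X in _ * X <= _](ger0_norm (ler0n _ _)) -normrM mulr_natr -E big_split /=.
    rewrite (le_trans (ler_normD _ _))//.
    have : `|\sum_(i in C) rho i| <= #|C|%:R * (ups * d).
      rewrite (le_trans (ler_norm_sum _ _ _))// mulr_natl -sumr_const.
      by apply: ler_sum => i iC; exact: bias.
    by move: noise0; rewrite /e; set S1 := `|_|; set S2 := `|_|; nra.
  by rewrite ler_pM2r.
have [->|w0] := eqVneq w 0; first by rewrite norm20 divr_ge0 ?addr_ge0// ltW.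
have N0 : 0 < norm2 w by rewrite norm2_gt0.
have := normal_equations z C (- dotv w xb) w hls; rewrite -/h.
have wE i : - dotv w xb + dotv w (z i).1 = dotv w ((z i).1 - xb) by rewrite dotvBr addrC.
under eq_bigr do rewrite rE wE.
move=> E; have := var w.
have -> : \sum_(i in C) dotv w ((z i).1 - xb) ^+ 2 =
    \sum_(i in C) rho i * dotv w ((z i).1 - xb) + dotv w (\sum_(i in C) e i *: ((z i).1 - xb)).
  have E2 : \sum_(i in C) a * dotv w ((z i).1 - xb) = 0.
    by rewrite -mulr_sumr -dotv_sumr centered dotv0r mulr0.
  have E3 : \sum_(i in C) (rho i + e i - a - dotv w ((z i).1 - xb)) * dotv w ((z i).1 - xb) =
      \sum_(i in C) rho i * dotv w ((z i).1 - xb) + \sum_(i in C) e i * dotv w ((z i).1 - xb) -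
      \sum_(i in C) a * dotv w ((z i).1 - xb) - \sum_(i in C) dotv w ((z i).1 - xb) ^+ 2.
    by rewrite -big_split -!sumrB /=; apply: eq_bigr => i _; ring.
  move: E; rewrite E3 E2 subr0 => /eqP; rewrite subr_eq0 => /eqP <-.
  by rewrite dotv_sumr; congr (_ + _); apply: eq_bigr => i _; rewrite dotvZr.
move=> V.
have b1 : \sum_(i in C) rho i * dotv w ((z i).1 - xb) <= #|C|%:R * (ups * d * (norm2 w * d)).
  rewrite mulr_natl -sumr_const; apply: ler_sum => i iC.
  apply: le_trans (ler_norm _) _; rewrite normrM ler_pM ?bias//.
  by rewrite (le_trans (cauchy_schwarz _ _))// ler_wpM2l ?norm2_ge0// xd.
have b2 : dotv w (\sum_(i in C) e i *: ((z i).1 - xb)) <= norm2 w * (del' * #|C|%:R * d ^+ 2).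
  by rewrite (le_trans (ler_norm _))// (le_trans (cauchy_schwarz _ _))// ler_wpM2l// norm2_ge0.
rewrite ler_pdivlMr//.
have : c * (#|C|%:R * d ^+ 2 * norm2 w ^+ 2) <= (norm2 w * (#|C|%:R * d ^+ 2)) * (ups + del').
  by rewrite norm2_sqr (le_trans V)// (le_trans (lerD b1 b2))// le_eqVlt; apply/orP; left; apply/eqP; ring.
have -> : c * (#|C|%:R * d ^+ 2 * norm2 w ^+ 2) = (norm2 w * (#|C|%:R * d ^+ 2)) * (norm2 w * c) by ring.
by rewrite ler_pM2l// !mulr_gt0// exprn_gt0.
Qed.

Lemma diameter_ge (A : set 'rV[R]_p) (Delta : R) x y : (forall x y, A x -> A y -> norm2 (x - y) <= Delta) ->
  A x -> A y -> norm2 (x - y) <= diameter A.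
Proof.
move=> bA Ax Ay; apply: ub_le_sup; last by exists x => //; exists y.
by exists Delta => _ [u Au [v Av <-]]; exact: bA.
Qed.

Lemma norm2_mean_le (I : finType) (C : {set I}) (x : I -> 'rV[R]_p) (y : 'rV[R]_p) (d : R) :
  (0 < #|C|)%N -> (forall i, i \in C -> norm2 (y - x i) <= d) ->
  norm2 (y - #|C|%:R^-1 *: \sum_(i in C) x i) <= d.
Proof.
move=> C0 h; have cC : 0 < #|C|%:R :> R by rewrite ltr0n.
have -> : y - #|C|%:R^-1 *: \sum_(i in C) x i = #|C|%:R^-1 *: \sum_(i in C) (y - x i).
  by rewrite sumrB sumr_const scalerBr -[y *+ _]scaler_nat scalerA mulVf ?lt0r_neq0// scale1r.
rewrite norm2Z ger0_norm ?invr_ge0 ?ler0n// mulrC ler_pdivrMr// mulr_natr -sumr_const.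
by rewrite (le_trans (norm2_sum _ _ _))// ler_sum.
Qed.

End LeastSquares.

(** * Error of the maximum of the fitted hyperplanes *)

Section CapFunctionError.
Context {R : realType} {p : nat}.

Lemma cap_fun_close (XX : set 'rV[R]_p) (f : 'rV[R]_p -> R) (g : 'rV[R]_p -> 'rV[R]_p)
    (ls : solver R p) n (z : dataset R p n) As (c eta ups del Delta : R) :
  least_squares_solver ls -> convex_set XX ->
  (forall x y, XX x -> XX y -> f x + dotv (g x) (y - x) <= f y) ->
  (forall x y, XX x -> XX y -> norm2 (y - x) <= eta -> norm2 (g y - g x) <= ups) ->
  (forall x y, XX x -> XX y -> norm2 (x - y) <= Delta) ->
  0 < c -> 0 <= ups -> 0 <= del ->
  (forall x, XX x -> has (fun A => `[< A x >]) As) -> (forall A, A \in As -> A `<=` XX) ->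
  (forall A, A \in As -> [/\ (0 < #|obs z A|)%N, 0 < diameter A, diameter A <= eta,
    c <= lambda_cell z A &
    forall T : pred 'I_n, (T = predT \/ exists j s, T = (fun i => s < (z i).1 ord0 j)) ->
      `|\sum_(i in obs z A | T i) ((z i).2 - f (z i).1)| <= del * #|obs z A|%:R * diameter A]) ->
  forall x, XX x -> `|cap_fun ls z As x - f x| <=
    (2 * ups + del) * eta + (ups + 4 * Num.sqrt p%:R * del) / c * (Delta + eta).
Proof.
move=> hls cvx tang ug bX c0 ups0 del0 cov sub hA x Xx.
have Delta0 : 0 <= Delta by apply: le_trans (norm2_ge0 _) (bX x x Xx Xx).
set L := (ups + _) / c.
have sp0 : 0 <= Num.sqrt p%:R :> R by exact: sqrtr_ge0.
have L0 : 0 <= L by rewrite divr_ge0 ?(ltW c0)// addr_ge0 ?mulr_ge0.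
have cell A : A \in As -> (forall x, XX x -> hval (ls n z (obs z A)) x <= f x + (ups + del) * eta + L * Delta) /\
    (forall x, A x -> f x - ups * eta - (ups + del) * eta - L * eta <= hval (ls n z (obs z A)) x).
  move=> AAs; have [C0 d0 deta lam noise] := hA A AAs.
  set C := obs z A in C0 noise *; set d := diameter A in d0 deta noise *.
  have inA i : i \in C -> A (z i).1 by rewrite inE => /asboolP.
  have inX i : i \in C -> XX (z i).1 by move=> /inA /(sub A AAs).
  have bA u v : A u -> A v -> norm2 (u - v) <= Delta by move=> /(sub A AAs) Xu /(sub A AAs); exact: bX.
  pose xb := cell_mean z A.
  have Xxb : XX xb by exact: convex_mean.
  have xd u : A u -> norm2 (u - xb) <= d.
    by move=> Au; apply: norm2_mean_le => // i iC; exact: diameter_ge bA Au (inA i iC).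
  have bias u : A u -> `|f u - f xb - dotv (g xb) (u - xb)| <= ups * d.
    (* The tangents at [xb] and at [u] give 0 <= f u - f xb - g xb . (u - xb) <= (g u - g xb) . (u -
       xb). *)
    move=> Au; have Xu := sub A AAs u Au; have h1 := tang _ _ Xxb Xu; have h2 := tang _ _ Xu Xxb.
    have h3 : dotv (g u - g xb) (u - xb) <= ups * d.
      rewrite (le_trans (ler_norm _))// (le_trans (cauchy_schwarz _ _))// ler_pM ?norm2_ge0 ?xd//.
      by apply: ug => //; exact: le_trans (xd _ Au) deta.
    have h4 : dotv (g u) (xb - u) = - dotv (g u) (u - xb) by rewrite -dotvNr opprB.
    rewrite dotvBl in h3; rewrite ger0_norm; first by lra.
    by lra.
  have noise0 : `|\sum_(i in C) ((z i).2 - f (z i).1)| <= del * #|C|%:R * d.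
    have := noise predT (or_introl erefl); congr (`| _ | <= _).
    by apply: eq_bigl => i; rewrite andbT.
  have noise1 : norm2 (\sum_(i in C) ((z i).2 - f (z i).1) *: ((z i).1 - xb)) <=
      (4 * Num.sqrt p%:R * del) * #|C|%:R * d ^+ 2.
    (* Each coordinate ranges over an interval of length 2 d, so the centred Abel bound is 4 d times
       the bound on the level sums. *)
    apply: (@le_trans _ _ (Num.sqrt p%:R * (4 * (del * #|C|%:R * d) * d))); last first.
      by rewrite le_eqVlt; apply/orP; left; apply/eqP; ring.
    apply: norm2_le_coord => j.
    have -> : (\sum_(i in C) ((z i).2 - f (z i).1) *: ((z i).1 - xb)) ord0 j =
        \sum_(i in C) ((z i).1 ord0 j - xb ord0 j) * ((z i).2 - f (z i).1).
      by rewrite summxE; apply: eq_bigr => i _; rewrite !mxE mulrC.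
    have -> : 4 * (del * #|C|%:R * d) * d = 2 * (del * #|C|%:R * d) * ((xb ord0 j + d) - (xb ord0 j - d)) by ring.
    apply: centered_abel_bound.
    - move=> i iC; have := le_trans (coord_le_norm2 ((z i).1 - xb) j) (xd _ (inA i iC)).
      by rewrite !mxE ler_norml => /andP[h1 h2]; apply/andP; split; lra.
    - by apply/andP; split; lra.
    - by move=> s; apply: (noise (fun i => s < (z i).1 ord0 j)); right; exists j, s.
  have var v : c * (#|C|%:R * d ^+ 2 * dotv v v) <= \sum_(i in C) dotv v ((z i).1 - xb) ^+ 2.
    apply: le_trans (cell_variance v d0 C0); rewrite ler_wpM2r// !mulr_ge0 ?exprn_ge0 ?(ltW d0)//.
    exact: dotv_ge0.
  have [a [w [ha hw hE]]] := least_squares_error hls C0 d0 c0 ups0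
    (mulr_ge0 (mulr_ge0 (ler0n R 4) sp0) del0) erefl var (fun i iC => xd _ (inA i iC))
    (fun i iC => bias _ (inA i iC)) noise0 noise1.
  have ad : `|a| <= (ups + del) * eta by rewrite (le_trans ha)// ler_wpM2l ?addr_ge0.
  move: ad => /ler_normlP[a1 a2].
  have hwx u D' : norm2 (u - xb) <= D' -> `|dotv w (u - xb)| <= L * D'.
    by move=> h; rewrite (le_trans (cauchy_schwarz _ _))// ler_pM ?norm2_ge0.
  split=> u; rewrite hE.
    move=> Xu; have /ler_normlP[_ h] := hwx u Delta (bX _ _ Xu Xxb).
    by have := tang _ _ Xxb Xu; lra.
  move=> Au; have /ler_normlP[h _] := hwx u eta (le_trans (xd u Au) deta).
  have /ler_normlP[_ h2] := le_trans (bias u Au) (ler_wpM2l ups0 deta).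
  by lra.
have sAs : (0 < size As)%N by have := cov x Xx; case: (As).
set hs := cap_hyperplanes ls z As.
have shs : size hs = size As by rewrite size_map.
have nthE k : (k < size As)%N -> nth (0 : R * 'rV[R]_p) hs k = ls n z (obs z (nth set0 As k)).
  by move=> ks; rewrite (nth_map set0).
have eta0 : 0 <= eta.
  by have [_ d0 /(le_trans (ltW d0))] := hA _ (mem_nth set0 sAs).
rewrite /cap_fun /max_affine -/hs ler_norml; apply/andP; split.
  have /hasP[A AAs /asboolP Ax] := cov x Xx.
  have [k ks AE] : exists2 k, (k < size As)%N & A = nth set0 As k.
    by exists (index A As); rewrite ?index_mem ?nth_index.
  have := seq_max_ge (0 : R * 'rV[R]_p) (hval ^~ x) (s := hs) (k := k).
  rewrite shs nthE// -AE => /(_ ks); have [_ /(_ x Ax)] := cell A AAs.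
  have : 0 <= L * Delta by exact: mulr_ge0.
  by lra.
have hs0 : (0 < size hs)%N by rewrite shs.
have [k ks ->] := seq_max_attained (0 : R * 'rV[R]_p) (hval ^~ x) hs0.
rewrite shs in ks; rewrite nthE//; have [/(_ x Xx) + _] := cell _ (mem_nth set0 ks).
have : 0 <= L * eta by exact: mulr_ge0.
have : 0 <= ups * eta by exact: mulr_ge0.
by lra.
Qed.

End CapFunctionError.

(** * Separating a cell by few halfspaces *)

Section Packing.
Context {R : realType} {p : nat}.

(** The cubes of a grid of mesh rho / (sqrt p + 1) have diameter less than [rho], hence each
    contains at most one of the points. *)
Lemma packing (s : seq 'rV[R]_p) (x0 : 'rV[R]_p) (H rho : R) : 0 < rho -> 0 <= H ->
  pairwise (fun x y : 'rV[R]_p => rho <= norm2 (x - y)) s ->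
  (forall x j, x \in s -> `|x ord0 j - x0 ord0 j| <= H) ->
  (size s)%:R <= (2 * H * (Num.sqrt p%:R + 1) / rho + 1) ^+ p.
Proof.
move=> rho0 H0 pw sH; set sp := Num.sqrt p%:R + 1.
have sp0 : 0 < sp by rewrite ltr_wpDl// sqrtr_ge0.
pose h := rho / sp; have h0 : 0 < h by rewrite divr_gt0.
pose u (x : 'rV[R]_p) j := (x ord0 j - x0 ord0 j + H) / h.
have u_bound x j : x \in s -> 0 <= u x j <= 2 * H / h.
  move=> xs; have := sH x j xs; rewrite ler_norml => /andP[h1 h2].
  by rewrite divr_ge0 ?(ltW h0)//= ?ler_pM2r ?invr_gt0//; lra.
pose N := (Num.truncn (2 * H / h)).
have uN x j : x \in s -> (Num.truncn (u x j) < N.+1)%N.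
  by move=> xs; rewrite ltnS le_truncn//; have /andP[] := u_bound x j xs.
pose f (x : 'rV[R]_p) : {ffun 'I_p -> 'I_N.+1} := [ffun j => inord (Num.truncn (u x j))].
have sub_s x y : x \in s -> y \in s -> f x = f y -> norm2 (x - y) < rho.
  move=> xs ys fxy; apply: (@le_lt_trans _ _ (Num.sqrt p%:R * h)).
    apply: norm2_le_coord => j; rewrite !mxE.
    have E : Num.truncn (u x j) = Num.truncn (u y j).
      by have /ffunP /(_ j) /(congr1 val) := fxy; rewrite !ffunE /= !inordK ?uN.
    have /andP[ux0 _] := u_bound x j xs; have /andP[uy0 _] := u_bound y j ys.
    have /andP[x1 x2] := truncn_itv ux0; have /andP[y1 y2] := truncn_itv uy0.
    rewrite E -natr1 in x1 x2; rewrite -natr1 in y2.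
    have -> : x ord0 j - y ord0 j = (u x j - u y j) * h by rewrite /u; field; rewrite lt0r_neq0.
    rewrite normrM (gtr0_norm h0) -[leRHS]mul1r ler_pM2r// ler_norml.
    by apply/andP; split; lra.
  by rewrite /h mulrA ltr_pdivrMr// mulrC ltr_pM2l// /sp ltrDl.
have fu : uniq (map f s).
  rewrite uniq_pairwise pairwise_map; apply/(pairwiseP 0) => i j si sj ij.
  have /(pairwiseP 0)/(_ i j si sj ij) := pw; rewrite leNgt; apply: contraNneq => fij.
  by apply: sub_s => //; exact: mem_nth.
have := max_card (mem (map f s)); rewrite (card_uniqP fu) size_map card_ffun !card_ord => le.
apply: (@le_trans _ _ ((N.+1)%:R ^+ p)); first by rewrite -natrX ler_nat.
apply: lerXn2r; rewrite ?nnegrE ?ler0n//.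
  by rewrite addr_ge0// divr_ge0 ?mulr_ge0 ?(ltW sp0) ?(ltW rho0).
rewrite -natr1 lerD2r; have -> : 2 * H * sp / rho = 2 * H / h by rewrite /h; field; rewrite !lt0r_neq0.
have H'0 : 0 <= 2 * H / h by apply: divr_ge0 (ltW h0); exact: mulr_ge0.
by have /andP[] := truncn_itv H'0.
Qed.

End Packing.

Section FewSeparators.
Context {R : realType} {p n : nat}.
Variables (XX : set 'rV[R]_p) (z : dataset R p n) (As : seq (set 'rV[R]_p)).
Variables (c t ell Delta : R).
Hypotheses (c0 : 0 < c) (t0 : 0 < t) (ell0 : 0 < ell).
Hypothesis bX : forall x y, XX x -> XX y -> norm2 (x - y) <= Delta.
Hypothesis hAs : separated_partition XX As.
Hypothesis zX : forall i, XX (z i).1.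
Hypothesis obs0 : forall A, A \in As -> (0 < #|obs z A|)%N.
Hypothesis diam0 : forall A, A \in As -> 0 < diameter A.
Hypothesis lam : forall A, A \in As -> c <= lambda_cell z A.
Hypothesis heavy : forall A, A \in As -> t * ell <= diameter A ^+ 2 * #|obs z A|%:R.

Lemma cell_diameter_ge A x y : A \in As -> A x -> A y -> norm2 (x - y) <= diameter A.
Proof.
move=> AAs; apply: diameter_ge; have [_ sub _] := hAs.
by move=> u v /(sub A AAs) Xu /(sub A AAs); exact: bX.
Qed.

Lemma obsP A i : reflect (A (z i).1) (i \in obs z A).
Proof. by rewrite inE; exact: asboolP. Qed.

(* [X_i = v . (x_i - mean)] is centred, at least [- m] and at most
   [diameter A |v|], so its variance is at most [m diameter A |v|]. *)
Lemma mean_margin A (v : 'rV[R]_p) (b : R) : A \in As -> v != 0 ->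
  (forall i, i \in obs z A -> b <= dotv v (z i).1) ->
  c * diameter A * norm2 v <= dotv v (cell_mean z A) - b.
Proof.
move=> AAs v0 hb; set d := diameter A; set xb := cell_mean z A; set m := _ - b.
have C0 := obs0 AAs; have d0 := diam0 AAs.
have cC : 0 < #|obs z A|%:R :> R by rewrite ltr0n.
have N0 : 0 < norm2 v by rewrite norm2_gt0.
have cen : \sum_(i in obs z A) dotv v ((z i).1 - xb) = 0.
  rewrite -dotv_sumr sumrB sumr_const /xb /cell_mean -scaler_nat scalerA divff ?lt0r_neq0//.
  by rewrite scale1r subrr dotv0r.
have := cell_variance v d0 C0; rewrite -/xb -/d => V.
have : \sum_(i in obs z A) dotv v ((z i).1 - xb) ^+ 2 <=
    \sum_(i in obs z A) (m * (d * norm2 v) + (d * norm2 v - m) * dotv v ((z i).1 - xb)).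
  (* With D = v . (x_i - xb) and e = d |v|, this is (D + m) (e - D) >= 0. *)
  apply: ler_sum => i iC.
  have lo : - m <= dotv v ((z i).1 - xb) by rewrite dotvBr /m opprB lerD2r hb.
  have hi : dotv v ((z i).1 - xb) <= d * norm2 v.
    rewrite (le_trans (ler_norm _))// (le_trans (cauchy_schwarz _ _))// mulrC ler_wpM2r ?norm2_ge0//.
    apply: norm2_mean_le => // k kC; apply: (cell_diameter_ge AAs); exact/obsP.
  by set D := dotv _ _ in lo hi *; set e := d * _ in hi *; nra.
rewrite big_split /= sumr_const -mulr_sumr cen mulr0 addr0 -mulr_natl => V2.
have V3 : lambda_cell z A * (d * norm2 v) * (#|obs z A|%:R * (d * norm2 v)) <=
    m * (#|obs z A|%:R * (d * norm2 v)).
  have := le_trans V V2; rewrite -norm2_sqr; congr (_ <= _); last by ring.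
  by rewrite !expr2; ring.
rewrite ler_pM2r ?mulr_gt0// in V3.
by apply: le_trans V3; rewrite -mulrA ler_wpM2r ?mulr_ge0 ?(ltW d0) ?(ltW N0) ?lam.
Qed.

Lemma cell_rel_neq A B : A \in As -> B \in As -> A != B -> cell_rel A B.
Proof.
have [_ _ /(pairwiseP set0) pw] := hAs.
move=> /(nthP set0)[i iA <-] /(nthP set0)[j jA <-].
have [ij|ji|->] := ltngtP i j; last by rewrite eqxx.
  by move=> _; exact: pw.
by move=> _; rewrite cell_rel_sym; exact: pw.
Qed.

(* Cells met by the box are separated from [A].  Those of diameter at most
   [diameter A / tau] are few since they are heavy; each of the others is shrunk
   towards one of its observations in the box to a point that, by
   [mean_margin], is far from the points of the other cells. *)
Lemma few_separators (A : set 'rV[R]_p) tau : A \in As -> 1 <= tau ->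
  exists G : seq ('rV[R]_p * R),
    [/\ (size G <= 2 * p + size As)%N /\
        (size G)%:R <= 2 * p%:R + n%:R * diameter A ^+ 2 / (t * ell * tau ^+ 2)
          + (2 * (Num.sqrt p%:R + 1) * tau / c + 1) ^+ p,
        forall h, h \in G -> h.1 != 0,
        forall i h, i \in obs z A -> h \in G -> h.2 <= dotv h.1 (z i).1
      & forall i, (forall h, h \in G -> h.2 <= dotv h.1 (z i).1) ->
          i \in obs z A \/ exists2 h, h \in G & dotv h.1 (z i).1 = h.2].
Proof.
move=> AAs tau1; set d := diameter A.
have d0 : 0 < d by exact: diam0.
have tau0 : 0 < tau by exact: lt_le_trans tau1.
have /card_gt0P[i0 i0A] := obs0 AAs; set x0 := (z i0).1.
pose box (x : 'rV[R]_p) := forall j, `|x ord0 j - x0 ord0 j| <= d.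
pose Bs := [seq B <- As | (B != A) && `[< exists2 i, i \in obs z B & box (z i).1 >]].
have BsP B : B \in Bs -> [/\ B \in As, cell_rel A B & exists2 i, i \in obs z B & box (z i).1].
  rewrite mem_filter => /andP[/andP[BA /asboolP hB] BAs]; split=> //.
  by apply: cell_rel_neq; rewrite // eq_sym.
have /choice[sep sepP] : forall B, exists h : 'rV[R]_p * R, B \in Bs ->
    [/\ h.1 != 0, forall x, A x -> h.2 <= dotv h.1 x & forall x, B x -> dotv h.1 x <= h.2].
  move=> B; have [BB|_] := boolP (B \in Bs); last by exists (0, 0).
  by have [_ /asboolP[_ [v [b [h1 h2 h3]]]] _] := BsP B BB; exists (v, b).
have /choice[y yP] : forall B, exists y : 'rV[R]_p, B \in Bs ->
    [/\ B y, exists2 i, i \in obs z B & y = (z i).1 & box y].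
  move=> B; have [BB|_] := boolP (B \in Bs); last by exists 0.
  by have [_ _ [i iB bi]] := BsP B BB; exists (z i).1 => _; split=> //; [exact/obsP|exists i].
(* The [2 * p] faces of the box around [x0] also serve as separators: they confine the observations
   to a region where, besides [A], only cells in [Bs] occur. *)
pose G1 := [seq (delta_mx ord0 j, x0 ord0 j - d) | j <- enum 'I_p] : seq ('rV[R]_p * R).
pose G2 := [seq (- delta_mx ord0 j, - (x0 ord0 j + d)) | j <- enum 'I_p] : seq ('rV[R]_p * R).
have xd i : i \in obs z A -> box (z i).1.
  move=> iA j; have := coord_le_norm2 ((z i).1 - x0) j; rewrite !mxE => /le_trans; apply.
  by apply: (cell_diameter_ge AAs); exact/obsP.
exists (map sep Bs ++ G1 ++ G2); split.
- have s1 : size G1 = p by rewrite size_map size_enum_ord.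
  have s2 : size G2 = p by rewrite size_map size_enum_ord.
  split.
    rewrite !size_cat s1 s2 size_map addnn -mul2n addnC leq_add2l.
    by rewrite size_filter count_size.
  rewrite !size_cat s1 s2 size_map -(count_predC (fun B => diameter B <= d / tau) Bs).
  rewrite -!size_filter !natrD.
  set S1 := seq.filter _ _; set S2 := seq.filter _ Bs.
  have h1 : (size S1)%:R <= n%:R * d ^+ 2 / (t * ell * tau ^+ 2).
    have pw : pairwise cell_rel S1.
      have [_ _ pw] := hAs; apply: subseq_pairwise pw.
      by apply: subseq_trans (filter_subseq _ _) (filter_subseq _ _).
    have := obs_disjoint_sum z pw; rewrite -(ler_nat R) natr_sum => le.
    have : (size S1)%:R * (t * ell * tau ^+ 2 / d ^+ 2) <= n%:R.
      apply: le_trans le.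
      have -> : (size S1)%:R * (t * ell * tau ^+ 2 / d ^+ 2) =
          \sum_(B <- S1) (t * ell * tau ^+ 2 / d ^+ 2).
        by rewrite big_const_seq count_predT iter_addr addr0 mulr_natl.
      rewrite [leLHS]big_seq [leRHS]big_seq; apply: ler_sum => B.
      rewrite mem_filter => /andP[dB /BsP[BAs _ _]].
      rewrite ler_pdivrMr ?exprn_gt0//.
      apply: (@le_trans _ _ (diameter B ^+ 2 * #|obs z B|%:R * tau ^+ 2)).
        by rewrite ler_wpM2r ?sqr_ge0 ?heavy.
      rewrite mulrAC mulrC ler_wpM2l ?ler0n// -exprMn lerXn2r ?nnegrE ?mulr_ge0 ?(ltW (diam0 BAs)) ?(ltW tau0) ?(ltW d0)//.
      by rewrite -ler_pdivlMr.
    rewrite ler_pdivlMr ?mulr_gt0 ?exprn_gt0// => h.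
    by rewrite -ler_pdivrMr ?exprn_gt0// -mulrA.
  have h2 : (size S2)%:R <= (2 * (Num.sqrt p%:R + 1) * tau / c + 1) ^+ p.
    (* The ratio is chosen so that the margin becomes c d / tau whatever the diameter of [B]. It
       also puts the shrunk point within d / tau <= d of [y B], hence within 2 d of [x0] in each
       coordinate. *)
    pose th (B : set 'rV[R]_p) := (d / tau) / diameter B.
    pose q (B : set 'rV[R]_p) := y B + th B *: (cell_mean z B - y B).
    have S2P B : B \in S2 -> [/\ B \in As, 0 <= th B <= 1 & B \in Bs].
      rewrite mem_filter /= -ltNge => /andP[dB BB]; have [BAs _ _] := BsP B BB.
      split=> //; have dB0 := diam0 BAs; apply/andP; split.
        by rewrite /th !divr_ge0 ?ltW.
      by rewrite /th ler_pdivrMr// mul1r ltW.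
    have marg B (v : 'rV[R]_p) b : B \in S2 -> v != 0 -> (forall x, B x -> b <= dotv v x) ->
        c * (d / tau) * norm2 v <= dotv v (q B) - b.
      move=> BS v0 hb; have [BAs /andP[th0 th1] BB] := S2P B BS; have [By _ _] := yP B BB.
      have := @mean_margin B v b BAs v0 (fun i iB => hb _ (elimT (obsP B i) iB)).
      have -> : dotv v (q B) - b =
          (1 - th B) * (dotv v (y B) - b) + th B * (dotv v (cell_mean z B) - b).
        by rewrite /q dotvDr dotvZr dotvBr; ring.
      move=> h; have := ler_wpM2l th0 h; have := hb _ By.
      have -> : th B * (c * diameter B * norm2 v) = c * (d / tau) * norm2 v.
        by rewrite /th; field; rewrite !lt0r_neq0 ?diam0.
      move=> h3 h4; apply: le_trans h4 _; rewrite lerDr mulr_ge0 ?subr_ge0//.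
    have pw : pairwise (fun x y : 'rV[R]_p => 2 * c * (d / tau) <= norm2 (x - y)) (map q S2).
      rewrite pairwise_map; have : pairwise cell_rel S2.
        have [_ _ pw] := hAs; apply: subseq_pairwise pw.
        by apply: subseq_trans (filter_subseq _ _) (filter_subseq _ _).
      apply: sub_in_pairwise (allss S2) => B B' BS BS' /asboolP[_ [v [b [v0 vB vB']]]] /=.
      have h1' := marg B v b BS v0 vB.
      have h2' : c * (d / tau) * norm2 (- v) <= dotv (- v) (q B') - (- b).
        by apply: marg; rewrite ?oppr_eq0// => x /vB' hx; rewrite dotvNl lerN2.
      rewrite norm2N dotvNl in h2'.
      have N0 : 0 < norm2 v by rewrite norm2_gt0.
      rewrite -(ler_pM2r N0); apply: le_trans (le_trans (ler_norm _) (cauchy_schwarz _ _)).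
      by rewrite dotvBl dotvC (dotvC _ v); lra.
    have bd (x : 'rV[R]_p) j : x \in map q S2 -> `|x ord0 j - x0 ord0 j| <= 2 * d.
      move=> /mapP[B BS ->]; have [BAs /andP[th0 th1] BB] := S2P B BS.
      have [By [i iB yi] bo] := yP B BB.
      have dB := diam0 BAs.
      have -> : q B ord0 j - x0 ord0 j = (y B ord0 j - x0 ord0 j) + th B * (cell_mean z B - y B) ord0 j.
        by rewrite /q !mxE; ring.
      apply: le_trans (ler_normD _ _) _; rewrite mulr_natl mulr2n lerD ?bo// normrM ger0_norm//.
      apply: (@le_trans _ _ (th B * diameter B)).
        rewrite ler_wpM2l//; apply: le_trans (coord_le_norm2 _ _) _; rewrite -norm2N opprB.
        by apply: norm2_mean_le; [exact: obs0|move=> k /obsP kB; exact: cell_diameter_ge].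
      rewrite /th divfK ?lt0r_neq0// ler_pdivrMr// ler_peMr// ltW//.
    have := packing (mulr_gt0 (mulr_gt0 (ltr0Sn R 1) c0) (divr_gt0 d0 tau0)) (mulr_ge0 (ler0n R 2) (ltW d0)) pw bd.
    rewrite size_map => /le_trans; apply.
    rewrite le_eqVlt; apply/orP; left; apply/eqP; congr (_ ^+ _); congr (_ + 1).
    by field; rewrite !lt0r_neq0.
  by lra.
- move=> h; rewrite !mem_cat => /or3P[|/mapP[j _ ->]|/mapP[j _ ->]] /=.
  + by move=> /mapP[B BB ->]; have [] := sepP B BB.
  + exact: delta_row_neq0.
  + by rewrite oppr_eq0 delta_row_neq0.
- move=> i h iA; rewrite !mem_cat => /or3P[|/mapP[j _ ->]|/mapP[j _ ->]] /=.
  + by move=> /mapP[B BB ->]; have [_ + _] := sepP B BB; apply; exact/obsP.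
  + by rewrite dotv_delta; have := xd i iA j; rewrite ler_norml => /andP[]; lra.
  + by rewrite dotvNl !dotv_delta; have := xd i iA j; rewrite ler_norml => /andP[]; lra.
- move=> i hi; have bi : box (z i).1.
    move=> j; rewrite ler_norml.
    have := hi (delta_mx ord0 j, x0 ord0 j - d); have := hi (- delta_mx ord0 j, - (x0 ord0 j + d)).
    rewrite /= dotvNl !dotv_delta !mem_cat.
    have -> : (- delta_mx ord0 j, - (x0 ord0 j + d)) \in G2 by apply/mapP; exists j; rewrite ?mem_enum.
    have -> : (delta_mx ord0 j, x0 ord0 j - d) \in G1 by apply/mapP; exists j; rewrite ?mem_enum.
    rewrite !orbT => /(_ isT) h1 /(_ isT) h2; apply/andP; split; lra.
  have [cov _ _] := hAs; have /hasP[B BAs /asboolP Bi] := cov _ (zX i).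
  have [BA|BA] := eqVneq B A; first by left; apply/obsP; rewrite -BA.
  right; have BB : B \in Bs.
    by rewrite mem_filter BA BAs !andbT/=; apply/asboolP; exists i => //; exact/obsP.
  have sB : sep B \in map sep Bs by apply: map_f.
  have [_ _ h] := sepP B BB; exists (sep B); first by rewrite mem_cat sB.
  by apply/le_anti; rewrite h//= hi// mem_cat sB.
Qed.

End FewSeparators.

(** * Uniform bounds over intersections of halfspaces *)

Lemma measure_bigcup_seq_le {R : realType} {d : measure_display} {T : measurableType d}
    (mu : {measure set T -> \bar R}) (I : choiceType) (s : seq I) (F : I -> set T) :
  (forall i, measurable (F i)) ->
  (mu (\bigcup_(i in [set` s]) F i) <= \sum_(i <- s) mu (F i))%E.
Proof.
move=> mF; rewrite bigcup_seq; elim: s => [|i s IH]; first by rewrite !big_nil measure0.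
rewrite !big_cons (le_trans (measureU2 _ _ _))//; last by rewrite leeD2l.
by apply: bigsetU_measurable.
Qed.

Lemma probability_bigcup_le {R : realType} {d : measure_display} {T : measurableType d}
    (P : probability T R) (I : finType) (F : {set I}) (B : I -> set T) (c : R) (y : \bar R) :
  (forall i, measurable (B i)) -> 0 <= c -> (0 <= y)%E ->
  (forall i, i \in F -> (P (B i) <= c%:E * y)%E) ->
  (P (\bigcup_(i in [set` F]) B i) <= (#|F|%:R * c)%:E * y)%E.
Proof.
move=> mB c0 y0 hB; have -> : [set` F] = [set` enum F].
  by apply/seteqP; split=> i /=; rewrite mem_enum.
apply: le_trans (measure_bigcup_seq_le P _ mB) _.
rewrite big_enum_cond /=; under eq_bigl do rewrite andbT.
apply: (@le_trans _ _ (\sum_(i in F) c%:E * y)%E); first exact: lee_sum.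
rewrite -ge0_sume_distrl// sumEFin sumr_const mulr_natl//.
Qed.

Section FamilyBounds.
Context {R : realType} {d : measure_display} {T : measurableType d}.
Variables (P : probability T R) (n : nat) (J : T -> {ffun 'I_n -> 'I_n}) (e : 'I_n -> T -> R).
Hypothesis mJ : forall j, measurable (J @^-1` [set j]).
Hypothesis me : forall a, measurable_fun setT (e a).

Definition bag_count (S : {set 'I_n}) (w : T) : R := #|finset (fun i => J w i \in S)|%:R.
Definition bag_noise (S : {set 'I_n}) (w : T) : R := \sum_(i | J w i \in S) e (J w i) w.

Lemma measurable_by_bag (F : {ffun 'I_n -> 'I_n} -> set T) : (forall j, measurable (F j)) ->
  measurable [set w | F (J w) w].
Proof.
move=> mF; rewrite (_ : [set w | _] = \bigcup_(j in [set: {ffun 'I_n -> 'I_n}]) (J @^-1` [set j] `&` F j)).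
  by apply: fin_bigcup_measurable => [|j _]; [exact: finite_finset|exact: measurableI].
apply/seteqP; split=> [w h|w [j _ [<-]]//]; by exists (J w).
Qed.

Lemma measurable_noise_ge (S : {set 'I_n}) (t x : R) :
  measurable [set w | x <= \sum_(i | J w i \in S) t * e (J w i) w].
Proof.
apply: (measurable_by_bag (F := fun j => [set w | x <= \sum_(i | j i \in S) t * e (j i) w])) => j.
have m : measurable_fun setT (fun w => \sum_(i | j i \in S) t * e (j i) w).
  under eq_fun do rewrite big_mkcond; apply: measurable_sum => i.
  by case: (j i \in S) => //; exact: measurable_funM.
by have := measurable_fun_le measurableT (measurable_cst x) m; rewrite setTI.
Qed.

Lemma measurable_count_ge (S : {set 'I_n}) (t x : R) : measurable [set w | x <= t * bag_count S w].
Proof.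
apply: (measurable_by_bag (F := fun j => [set w | x <= t * #|finset (fun i => j i \in S)|%:R])) => j.
by have := measurable_fun_le measurableT (@measurable_cst _ _ T R setT x) (@measurable_cst _ _ T R setT (t * #|finset (fun i => j i \in S)|%:R)); rewrite setTI.
Qed.

Variables (AX : set T) (K b : R).
Hypothesis mAX : measurable AX.
Hypothesis K0 : 0 <= K.
Let small := [set w | forall a : 'I_n, `|e a w| <= b].
Hypothesis msmall : measurable small.
Hypothesis noise : forall (S : {set 'I_n}) (t x : R), `|t| * b <= 1 / 4 ->
  (P (AX `&` small `&` [set w | (x <= \sum_(i | J w i \in S) t * e (J w i) w)%R]) <=
   (expR (- x + K * t ^+ 2 * #|S|%:R))%:E * P AX)%E.
Hypothesis count : forall (S : {set 'I_n}) (t x : R),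
  (P (AX `&` [set w | (x <= t * bag_count S w)%R]) <=
   (expR (- x + (expR t - 1) * #|S|%:R))%:E * P AX)%E.

(** Each of four failures has probability at most exp(-2 E) P(AX), and there are at most exp E sets.
    The tilt sqrt(E / (|S| + m)) balances the two terms of the exponent; [m] keeps it within the
    range allowed by the truncation when [S] is small, at the price of |S| + m in place of |S|. *)
Lemma bag_bounds (F : {set {set 'I_n}}) (E m : R) : 0 < E -> 0 < m ->
  Num.sqrt (E / m) * b <= 1 / 4 -> #|F|%:R <= expR E ->
  exists Bad : set T, [/\ measurable Bad, (P Bad <= (4 * expR (- E))%:E * P AX)%E &
    forall w, AX w -> small w -> ~ Bad w -> forall S, S \in F ->
      [/\ `|bag_noise S w| <= (K + 2) * Num.sqrt (E * (#|S|%:R + m)),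
          #|S|%:R <= 4 * bag_count S w + 8 * E &
          bag_count S w <= 2 * #|S|%:R + 4 * E]].
Proof.
move=> E0 m0 tb FE.
pose s (S : {set 'I_n}) : R := #|S|%:R + m.
have s0 S : 0 < s S by rewrite ltr_wpDl.
pose t (S : {set 'I_n}) := Num.sqrt (E / s S).
have t0 S : 0 < t S by rewrite sqrtr_gt0 divr_gt0.
have t2 S : t S ^+ 2 = E / s S by rewrite sqr_sqrtr// divr_ge0// ltW.
pose B1 (S : {set 'I_n}) := AX `&` small `&` [set w | (K + 2) * E <= \sum_(i | J w i \in S) t S * e (J w i) w].
pose B2 (S : {set 'I_n}) := AX `&` small `&` [set w | (K + 2) * E <= \sum_(i | J w i \in S) (- t S) * e (J w i) w].
(* The count needs a lower bound only if |S| >= 8 E; otherwise the second conclusion is trivial and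
   the event is taken empty. *)
pose B3 (S : {set 'I_n}) := if 8 * E <= #|S|%:R then AX `&` [set w | - (#|S|%:R / 4) <= (-1) * bag_count S w] else set0.
pose B4 (S : {set 'I_n}) := AX `&` [set w | #|S|%:R + 2 * E <= 1 / 2 * bag_count S w].
have mB3 S : measurable (B3 S).
  by rewrite /B3; case: ifP => // _; apply: measurableI => //; exact: measurable_count_ge.
have mB S : measurable (B1 S `|` B2 S `|` B3 S `|` B4 S).
  do 3?apply: measurableU => //; repeat apply: measurableI => //; (exact: measurable_noise_ge || exact: measurable_count_ge).
exists (\bigcup_(S in [set` F]) (B1 S `|` B2 S `|` B3 S `|` B4 S)); split.
- by apply: fin_bigcup_measurable => [|S _]; [exact: finite_finset|exact: mB].
- apply: (@le_trans _ _ ((#|F|%:R * (4 * expR (- (2 * E))))%:E * P AX)%E); last first.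
    rewrite lee_wpmul2r// lee_fin mulrCA ler_wpM2l//.
    have -> : expR (- E) = expR E * expR (- (2 * E)) by rewrite -expRD; congr expR; ring.
    by rewrite ler_wpM2r ?expR_ge0.
  apply: probability_bigcup_le; [exact: mB|by rewrite mulr_ge0 ?expR_ge0|exact: measure_ge0|].
  move=> S SF.
  have tS1 : `|t S| * b <= 1 / 4.
    rewrite gtr0_norm//; have [b0|b0] := leP 0 b; last first.
      by apply: (@le_trans _ _ 0); rewrite ?divr_ge0// ltW// pmulr_rlt0.
    apply: le_trans tb; rewrite ler_wpM2r// ler_wsqrtr// ler_wpM2l ?(ltW E0)// lef_pV2 ?posrE//.
    by rewrite lerDr.
  have bound12 : - ((K + 2) * E) + K * t S ^+ 2 * #|S|%:R <= - (2 * E).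
    rewrite t2; have : K * (E / s S) * #|S|%:R <= K * E.
      rewrite -!mulrA ler_wpM2l// ler_piMr ?(ltW E0)// mulrC ler_pdivrMr// mul1r /s.
      by rewrite lerDl ltW.
    by lra.
  have P1 : (P (B1 S) <= (expR (- (2 * E)))%:E * P AX)%E.
    by apply: le_trans (noise _ _ tS1) _; rewrite lee_wpmul2r// lee_fin ler_expR.
  have P2 : (P (B2 S) <= (expR (- (2 * E)))%:E * P AX)%E.
    rewrite -normrN in tS1.
    by apply: le_trans (noise _ _ tS1) _; rewrite lee_wpmul2r// lee_fin ler_expR sqrrN.
  have e1 : 9 / 4 <= expR 1 :> R.
    have h : 3 / 2 <= expR (1 / 2) :> R by have := expR_ge1Dx (1 / 2 : R); lra.
    have -> : expR 1 = expR (1 / 2) * expR (1 / 2) :> R by rewrite -expRD; congr expR; lra.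
    by nra.
  have em1 : expR (-1) <= 1 / 2 :> R.
    have := expRxMexpNx_1 (1 : R); have := expR_gt0 (-1 : R); nra.
  have e2 : expR (1 / 2) - 1 <= 1 :> R.
    by have := @expR_le_quadratic R (1 / 2) (lexx _); lra.
  have S0 : 0 <= #|S|%:R :> R by [].
  have P3 : (P (B3 S) <= (expR (- (2 * E)))%:E * P AX)%E.
    rewrite /B3; case: ifP => [SE|_]; last by rewrite measure0 mule_ge0// lee_fin expR_ge0.
    by apply: le_trans (count _ _ _) _; rewrite lee_wpmul2r// lee_fin ler_expR; nra.
  have P4 : (P (B4 S) <= (expR (- (2 * E)))%:E * P AX)%E.
    by apply: le_trans (count _ _ _) _; rewrite lee_wpmul2r// lee_fin ler_expR; nra.
  have mB1 : measurable (B1 S) by do 2?apply: measurableI => //; exact: measurable_noise_ge.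
  have mB2 : measurable (B2 S) by do 2?apply: measurableI => //; exact: measurable_noise_ge.
  have mB4 : measurable (B4 S) by apply: measurableI => //; exact: measurable_count_ge.
  apply: (@le_trans _ _ (P (B1 S) + P (B2 S) + P (B3 S) + P (B4 S))%E).
    apply: le_trans (measureU2 _ _ _) _ => //; first by do 2?apply: measurableU.
    rewrite leeD2r//; apply: le_trans (measureU2 _ _ _) _ => //; first exact: measurableU.
    by rewrite leeD2r//; exact: measureU2.
  apply: le_trans (leeD (leeD (leeD P1 P2) P3) P4) _.
  rewrite -!ge0_muleDl ?adde_ge0 ?lee_fin ?expR_ge0// -!EFinD.
  by rewrite lee_wpmul2r// lee_fin; lra.
- move=> w Aw sw nB S SF.
  have nBS B' : (B' `<=` B1 S `|` B2 S `|` B3 S `|` B4 S) -> ~ B' w.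
    by move=> sub B'w; apply: nB; exists S => //; exact: sub.
  have n1 : ~ B1 S w by apply: nBS => ? ?; left; left; left.
  have n2 : ~ B2 S w by apply: nBS => ? ?; left; left; right.
  have n3 : ~ B3 S w by apply: nBS => ? ?; left; right.
  have n4 : ~ B4 S w by apply: nBS => ? ?; right.
  split.
  + have ES : Num.sqrt (E * s S) * t S = E.
      rewrite /t -sqrtrM; last by rewrite mulr_ge0 ?ltW.
      have -> : E * s S * (E / s S) = E ^+ 2 by field; rewrite lt0r_neq0.
      by rewrite sqrtr_sqr ger0_norm ?ltW.
    have h1 : t S * bag_noise S w < (K + 2) * E.
      rewrite ltNge; apply/negP => h; apply: n1; split=> //=.
      by rewrite -mulr_sumr.
    have h2 : - t S * bag_noise S w < (K + 2) * E.
      rewrite ltNge; apply/negP => h; apply: n2; split=> //=.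
      by rewrite -mulr_sumr.
    rewrite -(ler_pM2l (t0 S)) -/(s S).
    have -> : t S * ((K + 2) * Num.sqrt (E * s S)) = (K + 2) * E.
      by transitivity ((K + 2) * (Num.sqrt (E * s S) * t S)); [ring|rewrite ES].
    rewrite -{1}(gtr0_norm (t0 S)) -normrM ler_norml; apply/andP; split; lra.
  + rewrite leNgt; apply/negP => h; apply: n3; rewrite /B3.
    have c0 : 0 <= bag_count S w by exact: ler0n.
    by case: ifP => [_|]; [split=> //=; lra|move/negbT; rewrite -ltNge; lra].
  + rewrite leNgt; apply/negP => h; apply: n4; split=> //=; lra.
Qed.

End FamilyBounds.

(** * Counting intersections of lists of sets and their perturbations *)

Section Meets.
Variable I : finType.
Implicit Types (s : seq {set I}) (H : {set {set I}}).

Definition seq_meet s : {set I} := finset (fun a => all (fun S : {set I} => a \in S) s).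

Definition ffun_meet k (f : {ffun 'I_k -> {set I}}) : {set I} :=
  finset (fun a => [forall j, a \in f j]).

(** Repeating the head does not change the intersection, so lists of length at most [k] can be
    counted as functions on ['I_k]. *)
Definition pad k s : {ffun 'I_k -> {set I}} := [ffun j : 'I_k => nth (head finset.set0 s) s j].

Lemma mem_pad k s H : (0 < size s)%N -> {subset s <= H} -> pad k s \in ffun_on (mem H).
Proof.
case: s => //= S0 s _ sH; apply/ffun_onP => j; rewrite ffunE; apply: sH.
have [js|js] := ltnP j (size (S0 :: s)); first exact: mem_nth.
by rewrite nth_default// mem_head.
Qed.

Lemma meet_pad k s (g : {set I} -> {set I}) : (0 < size s <= k)%N ->
  seq_meet (map g s) = ffun_meet [ffun j => g (pad k s j)].
Proof.
move=> /andP[s0 sk]; apply/setP => a; rewrite !finset.in_set all_map; apply/allP/forallP => h.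
  move=> j; rewrite !ffunE; apply: h; case: (s) s0 => //= S0 s' _.
  have [js|js] := ltnP j (size (S0 :: s')); first exact: mem_nth.
  by rewrite nth_default// mem_head.
move=> S /(nthP (head finset.set0 s))[i si <-]; have := h (Ordinal (leq_trans si sk)).
by rewrite !ffunE.
Qed.

Definition meet_tuples k H : {set {set I}} := [set ffun_meet f | f : {ffun 'I_k -> {set I}} in ffun_on (mem H)].

Lemma card_meet_tuples k H : (#|meet_tuples k H| <= #|H| ^ k)%N.
Proof. by rewrite (leq_trans (leq_imset_card _ _))// card_ffun_on card_ord. Qed.

Lemma mem_meet_tuples s H : (0 < size s)%N -> {subset s <= H} -> seq_meet s \in meet_tuples (size s) H.
Proof.
move=> s0 sH; rewrite -[s in seq_meet s]map_id (@meet_pad (size s)) ?s0 ?leqnn//.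
apply/imsetP; exists (pad (size s) s); last by congr ffun_meet; apply/ffunP => j; rewrite !ffunE.
exact: mem_pad.
Qed.

(** With [g] the choice of a nearest net element, these are both sides of the error made by
    replacing every set of an intersection by its image. *)
Definition meet_diffs k (g : {set I} -> {set I}) H : {set {set I}} :=
  [set ffun_meet f :\: ffun_meet [ffun j => g (f j)] | f : {ffun 'I_k -> {set I}} in ffun_on (mem H)] :|:
  [set ffun_meet [ffun j => g (f j)] :\: ffun_meet f | f : {ffun 'I_k -> {set I}} in ffun_on (mem H)].

Lemma card_meet_diffs k g H : (#|meet_diffs k g H| <= 2 * #|H| ^ k)%N.
Proof.
rewrite (leq_trans (leq_card_setU _ _))// mul2n -addnn leq_add// (leq_trans (leq_imset_card _ _))//;
by rewrite card_ffun_on card_ord.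
Qed.

Lemma mem_meet_diffs k g s H : (0 < size s <= k)%N -> {subset s <= H} ->
  (seq_meet s :\: seq_meet (map g s) \in meet_diffs k g H) && (seq_meet (map g s) :\: seq_meet s \in meet_diffs k g H).
Proof.
move=> sk sH; have s0 : (0 < size s)%N by case/andP: sk.
have E : seq_meet s = ffun_meet (pad k s).
  by rewrite -[s in LHS]map_id (meet_pad _ sk); congr ffun_meet; apply/ffunP => j; rewrite !ffunE.
rewrite E (meet_pad g sk) !finset.in_setU; apply/andP; split; apply/orP; [left|right];
by apply/imsetP; exists (pad k s) => //; exact: mem_pad.
Qed.

(** A point at which the two intersections differ lies in one of the symmetric differences. *)
Lemma card_meet_diff (D m k : nat) (g : {set I} -> {set I}) s : (size s <= k)%N ->
  (forall S, S \in s -> (D * #|symdiff S (g S)| <= m)%N) ->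
  (D * #|seq_meet s :\: seq_meet (map g s)| <= k * m)%N /\ (D * #|seq_meet (map g s) :\: seq_meet s| <= k * m)%N.
Proof.
move=> sk hs.
pose U := \bigcup_(S <- s) symdiff S (g S).
have cU : (D * #|U| <= k * m)%N.
  apply: (@leq_trans (size s * m)); last by rewrite leq_mul2r sk orbT.
  have : (#|U| <= \sum_(S <- s) #|symdiff S (g S)|)%N.
    rewrite /U; elim: (s) => [|S s' IH]; first by rewrite !big_nil cards0.
    by rewrite !big_cons (leq_trans (leq_card_setU _ _))// leq_add2l.
  move=> h; apply: (leq_trans (leq_mul (leqnn D) h)); rewrite big_distrr /=.
  rewrite -sum1_size big_distrl /= !big_seq; apply: leq_sum => S Ss.
  by rewrite mul1n hs.
have mU a S : S \in s -> a \in symdiff S (g S) -> a \in U.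
  by rewrite /U; elim: (s) => //= S' s' IH; rewrite inE big_cons finset.in_setU => /orP[/eqP <- ->//|/IH h /h ->]; rewrite orbT.
split; apply: leq_trans cU; rewrite leq_mul2l subset_leq_card ?orbT//; apply/fintype.subsetP => a.
  rewrite finset.in_setD !finset.in_set all_map => /andP[/allPn[S Ss /= aS] /allP h].
  by apply: (mU a S Ss); rewrite /symdiff !inE aS (h S Ss).
rewrite finset.in_setD !finset.in_set all_map => /andP[/allPn[S Ss /= aS] /allP h].
by apply: (mU a S Ss); rewrite /symdiff !inE aS; move: (h S Ss) => /= ->; rewrite orbT.
Qed.

End Meets.

(** * The event on which all intersections of traces have controlled noise *)

Section NoiseEvent.
Context {R : realType} {d : measure_display} {T : measurableType d} {p : nat}.
Variables (P : probability T R) (n : nat) (J : T -> {ffun 'I_n -> 'I_n}) (e : 'I_n -> T -> R).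
Variable x : 'I_n -> T -> 'rV[R]_p.
Hypothesis mJ : forall j, measurable (J @^-1` [set j]).
Hypothesis me : forall a, measurable_fun setT (e a).
Variables (K b : R).
Hypothesis K0 : 0 <= K.
Let small := [set w | forall a : 'I_n, `|e a w| <= b].
Let AX (H : {set {set 'I_n}}) := [set w | traces (x ^~ w) = H].
Hypothesis mAX : forall H, measurable (AX H).
Hypothesis noise : forall H (S : {set 'I_n}) (t y : R), `|t| * b <= 1 / 4 ->
  (P (AX H `&` small `&` [set w | (y <= \sum_(i | J w i \in S) t * e (J w i) w)%R]) <=
   (expR (- y + K * t ^+ 2 * #|S|%:R))%:E * P (AX H))%E.
Hypothesis count : forall H (S : {set 'I_n}) (t y : R),
  (P (AX H `&` [set w | (y <= t * bag_count J S w)%R]) <=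
   (expR (- y + (expR t - 1) * #|S|%:R))%:E * P (AX H))%E.
Variable q : nat.
Hypotheses (nq : (0 < n < 2 ^ q)%N) (pq : (2 * p + 4 <= q)%N).

(* Bounds the logarithm of the number of intersections of [F] elements of a net
   with at most [q ^ (9 * p.+1)] elements. *)
Definition entropy (F : nat) : R := (9 * p.+1 * F)%:R * ln q%:R + q%:R.
(* Bounds the logarithm of the number of sets by which an intersection of traces
   is altered: its differences with the intersection of the nearest elements of
   the net, and the sets with at most [p * q ^ 2] elements. *)
Definition entropy2 : R := (p.+2 * q ^ 3)%:R.

Variables (m1 m2 : R).
Hypotheses (m10 : 0 < m1) (m2n : n%:R <= q%:R ^+ 4 * m2) (m2q : (p * q ^ 2)%:R <= m2).
Hypotheses (small1 : Num.sqrt (entropy (q ^ 2) / m1) * b <= 1 / 4)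
  (small2 : Num.sqrt (entropy2 / m2) * b <= 1 / 4).

Let q1 : (1 < q)%N. Proof. lia. Qed.
Let q0 : (0 < q)%N. Proof. exact: ltnW. Qed.
Let qR1 : 1 <= q%:R :> R. Proof. by rewrite ler1n; lia. Qed.
Let lnq0 : 0 <= ln q%:R :> R. Proof. exact: ln_ge0. Qed.

Lemma entropy_ge F : q%:R <= entropy F.
Proof. by rewrite /entropy lerDr mulr_ge0. Qed.

Lemma entropy_le F F' : (F <= F')%N -> entropy F <= entropy F'.
Proof. by move=> FF; rewrite lerD2r ler_wpM2r// ler_nat leq_mul2l FF orbT. Qed.

Let m20 : 0 < m2.
Proof.
have : 0 < n%:R :> R by rewrite ltr0n; case/andP: nq.
by move=> /lt_le_trans /(_ m2n); rewrite pmulr_rgt0// exprn_gt0// (lt_le_trans _ qR1).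
Qed.

(** The net at resolution q^6 has at most (q^9)^(p+1) elements: 6 for the resolution, 2 for the
    factor 2 (p+1) q + 1 <= q^2, 1 for rounding. *)
Lemma net_card_le (F : nat) (N : {set {set 'I_n}}) :
  (#|N| <= (q ^ 6 * (2 * p.+1 * q).+1).+1 ^ p.+1)%N -> #|meet_tuples F N|%:R <= expR (entropy F).
Proof.
move=> cN.
have cN9 : (#|N| <= q ^ (9 * p.+1))%N.
  apply: (leq_trans cN); rewrite expnM leq_exp2r//.
  have h : ((2 * p.+1 * q).+1 <= q ^ 2)%N.
    apply: (@leq_trans ((2 * p.+1).+1 * q)); first by rewrite mulSn -add1n leq_add2r.
    rewrite -mulnn leq_mul2r; apply/orP; right; move: pq; clear; lia.
  apply: (@leq_trans (q ^ 6 * q ^ 2).+1); first by rewrite ltnS leq_mul2l h orbT.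
  by rewrite -expnD ltn_exp2l.
have : (#|meet_tuples F N| <= q ^ (9 * p.+1 * F))%N.
  rewrite (leq_trans (card_meet_tuples _ _))// expnM.
  by case: F => [|F]; rewrite ?expn0// leq_exp2r.
rewrite -(ler_nat R) => /le_trans; apply.
have -> : (q ^ (9 * p.+1 * F))%:R = expR ((9 * p.+1 * F)%:R * ln q%:R) :> R.
  by rewrite expRM_natl lnK ?natrX// posrE (lt_le_trans _ qR1).
by rewrite ler_expR /entropy lerDl.
Qed.

Let small_sets (g : {set 'I_n} -> {set 'I_n}) (H : {set {set 'I_n}}) :=
  [set S in meet_diffs (q ^ 2) g H | (q ^ 4 * #|S| <= n)%N] :|:
  [set S : {set 'I_n} | (#|S| <= p * q ^ 2)%N].

(** A crude count suffices: n + 1 <= 2^q turns both kinds of sets into powers of 2, and the factor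
    [p.+2] in [entropy2], instead of [p.+1], absorbs a remaining factor 4. *)
Lemma card_small_sets_le g (H : {set {set 'I_n}}) : (#|H| <= n.+1 ^ p.+1)%N -> #|small_sets g H|%:R <= expR entropy2.
Proof.
move=> cH; have /andP[n0 n2] := nq.
have c1 : (#|small_sets g H| <= 2 * (n.+1 ^ p.+1) ^ (q ^ 2) + n.+1 ^ (p * q ^ 2))%N.
  rewrite (leq_trans (leq_card_setU _ _))// leq_add//; last first.
    by have := card_small_sets 'I_n (p * q ^ 2); rewrite card_ord.
  apply: (@leq_trans #|meet_diffs (q ^ 2) g H|).
    by apply/subset_leq_card/fintype.subsetP => S; rewrite inE => /andP[].
  by rewrite (leq_trans (card_meet_diffs _ _ _))// leq_mul2l leq_exp2r ?cH// expn_gt0 q0.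
have c2 : (2 * (n.+1 ^ p.+1) ^ (q ^ 2) + n.+1 ^ (p * q ^ 2) <= 2 ^ (p.+2 * q ^ 3))%N.
  have h k : (n.+1 ^ k <= 2 ^ (q * k))%N by rewrite expnM; case: k => // k; rewrite leq_exp2r.
  rewrite -expnM; have := h (p.+1 * q ^ 2)%N; have := h (p * q ^ 2)%N => h1 h2.
  apply: (@leq_trans (2 ^ 2 * 2 ^ (q * (p.+1 * q ^ 2)))).
    have h3 : (2 ^ (q * (p * q ^ 2)) <= 2 ^ (q * (p.+1 * q ^ 2)))%N.
      by rewrite leq_exp2l// leq_mul2l leq_mul2r leqnSn !orbT.
    by rewrite (_ : 2 ^ 2 = 2 + 2)%N// mulnDl leq_add ?leq_mul2l ?h2 ?orbT// (leq_trans h1)// (leq_trans h3)// leq_pmull.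
  rewrite -expnD leq_exp2l// (_ : q ^ 3 = q * q ^ 2)%N; last by rewrite -expnS.
  have : (2 <= q * q ^ 2)%N by rewrite -expnS (leq_trans q1)// -{1}(expn1 q) leq_exp2l.
  by rewrite mulnCA; move: (q * q ^ 2)%N; clear; lia.
have := leq_trans c1 c2; rewrite -(ler_nat R) => /le_trans; apply.
rewrite /entropy2 natrX -[X in expR X]mulr1 expRM_natl lerXn2r ?nnegrE ?expR_ge0//.
by have := expR_ge1Dx (1 : R); lra.
Qed.

(** [V] will consist of the observations on separating hyperplanes that belong to other cells. The
    bound refers to the bagged count of the set, not to its number of data points, because A5 speaks
    of bagged cells; the count of [V] is what [few_on_hyperplanes] will need. *)
Definition noise_bounded (w : T) : Prop :=
  forall s : seq {set 'I_n}, (0 < size s <= q ^ 2)%N -> {subset s <= traces (x ^~ w)} ->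
  forall V : {set 'I_n}, (#|V| <= p * q ^ 2)%N ->
    `|bag_noise J e (seq_meet s :\: V) w| <= (K + 2) *
      (Num.sqrt (entropy (size s) * (4 * bag_count J (seq_meet s :\: V) w
          + 16 * m2 + 32 * entropy2 + 8 * entropy (size s) + m1))
       + 3 * Num.sqrt (entropy2 * (m2 + m2)))
    /\ bag_count J V w <= 2 * m2 + 4 * entropy2.

Let entropy2_gt0 : 0 < entropy2.
Proof. by rewrite ltr0n muln_gt0 expn_gt0 q0. Qed.

Let entropy_gt0 F : 0 < entropy F.
Proof. exact: lt_le_trans (lt_le_trans ltr01 qR1) (entropy_ge F). Qed.

Let q_le_entropy2 : q%:R <= entropy2.
Proof. by rewrite ler_nat (leq_trans (leq_pmull q (ltn0Sn p.+1)))// leq_mul2l -{1}(expn1 q) leq_exp2l. Qed.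

(** On [AX H] the net and the map [g] depend on [H] only, which makes the union bounds legitimate.
    There is one bad event for each number of halfspaces, because the entropy must match the number
    actually used, and one for the small sets: q^2 + 2 in total. *)
Lemma noise_event_given (H : {set {set 'I_n}}) : exists Bad : set T, [/\ measurable Bad,
  (P Bad <= (4 * (q ^ 2 + 2)%:R * expR (- q%:R))%:E * P (AX H))%E &
  forall w, AX H w -> small w -> ~ Bad w -> noise_bounded w].
Proof.
have msmall : measurable small.
  rewrite (_ : small = \bigcap_(a in [set: 'I_n]) [set w | (`|e a w| <= b)%R]); last first.
    by apply/seteqP; split=> [w h' a _|w h' a]; exact: h'.
  apply: fin_bigcap_measurable => [|a _]; first exact: finite_finset.
  have mea : measurable_fun setT (fun w => `|e a w|) by apply: measurableT_comp.
  by have := measurable_fun_le measurableT mea (@measurable_cst _ _ T R setT b); rewrite setTI.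
have [[w0 HE]|nex] := pselect (exists w0, traces (x ^~ w0) = H); last first.
  exists set0; split=> //; first by rewrite measure0 mule_ge0// lee_fin !mulr_ge0 ?expR_ge0.
  by move=> w Aw; case: nex; exists w.
have q60 : (0 < q ^ 6)%N by rewrite expn_gt0 q0.
(* At resolution q^6, replacing at most q^2 traces alters an intersection on at most n / q^4 points
   on each side, hence on at most [m2]. *)
have [N [NH cN cov]] := traces_net (x ^~ w0) q60 nq; rewrite HE in NH cov.
have /choice[g gP] : forall A, exists B, A \in H -> B \in N /\ (q ^ 6 * #|symdiff A B| <= n)%N.
  move=> A; have [AH|_] := boolP (A \in H); last by exists finset.set0.
  by have [B BN AB] := cov A AH; exists B.
have cH : (#|H| <= n.+1 ^ p.+1)%N by have := card_traces (x ^~ w0); rewrite HE card_ord.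
have Hnoise := noise H; have Hcount := count H.
have /choice[Bad1 Bad1P] : forall F : 'I_(q ^ 2).+1, exists Bad : set T,
    [/\ measurable Bad, (P Bad <= (4 * expR (- q%:R))%:E * P (AX H))%E &
    forall w, AX H w -> small w -> ~ Bad w -> forall S, S \in meet_tuples F N ->
      [/\ `|bag_noise J e S w| <= (K + 2) * Num.sqrt (entropy F * (#|S|%:R + m1)),
          #|S|%:R <= 4 * bag_count J S w + 8 * entropy F &
          bag_count J S w <= 2 * #|S|%:R + 4 * entropy F]].
  move=> F; have sF : Num.sqrt (entropy F / m1) * b <= 1 / 4.
    have [b0|b0] := leP 0 b; last first.
      by apply: (@le_trans _ _ 0); rewrite ?divr_ge0// mulr_ge0_le0 ?sqrtr_ge0 ?(ltW b0).
    apply: le_trans small1; rewrite ler_wpM2r// ler_wsqrtr// ler_pM2r ?invr_gt0// entropy_le//.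
    by rewrite -ltnS.
  have [Bad [mB PB hB]] := bag_bounds mJ me (mAX H) K0 msmall Hnoise Hcount (entropy_gt0 F)
    m10 sF (net_card_le F cN).
  exists Bad; split=> //; apply: le_trans PB _; rewrite lee_wpmul2r// lee_fin ler_wpM2l//.
  by rewrite ler_expR lerN2 entropy_ge.
have [Bad2 [mB2 PB2 hB2]] := bag_bounds mJ me (mAX H) K0 msmall Hnoise Hcount entropy2_gt0
    m20 small2 (card_small_sets_le g cH).
exists (\bigcup_(F in [set` [set: 'I_(q ^ 2).+1]%SET]) Bad1 F `|` Bad2); split.
- apply: measurableU => //; apply: fin_bigcup_measurable => [|F _]; first exact: finite_finset.
  by have [] := Bad1P F.
- apply: le_trans (measureU2 _ _ _) _ => //.
    apply: fin_bigcup_measurable => [|F _]; first exact: finite_finset.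
    by have [] := Bad1P F.
  have U1 := @probability_bigcup_le _ _ _ P _ [set: 'I_(q ^ 2).+1]%SET Bad1 (4 * expR (- q%:R))
    (P (AX H)) (fun F => let: And3 h _ _ := Bad1P F in h) (mulr_ge0 (ler0n _ 4) (expR_ge0 _))
    (measure_ge0 _ _) (fun F _ => let: And3 _ h _ := Bad1P F in h).
  have U2 : (P Bad2 <= (4 * expR (- q%:R))%:E * P (AX H))%E.
    apply: le_trans PB2 _; rewrite lee_wpmul2r// lee_fin ler_wpM2l//.
    by rewrite ler_expR lerN2.
  apply: le_trans (leeD U1 U2) _; rewrite -ge0_muleDl ?lee_fin ?mulr_ge0 ?expR_ge0//.
  rewrite -EFinD lee_wpmul2r// lee_fin cardsT card_ord natrD -natr1.
  by rewrite le_eqVlt; apply/orP; left; apply/eqP; ring.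
- move=> w Aw sw nB s ss sH V cV; rewrite Aw in sH.
  have /andP[s0 sq] := ss.
  set I := seq_meet (map g s); set S := seq_meet s :\: V.
  set D1 := seq_meet s :\: I; set D2 := I :\: seq_meet s; set V' := V :&: seq_meet s.
  have nB1 (F : 'I_(q ^ 2).+1) : ~ Bad1 F w by move=> h; apply: nB; left; exists F => //=; rewrite inE.
  have nB2 : ~ Bad2 w by move=> h; apply: nB; right.
  have IN : I \in meet_tuples (size s) N.
    rewrite -(size_map g); apply: mem_meet_tuples; rewrite ?size_map// => _ /mapP[A /sH AH ->].
    by have [] := gP A AH.
  have sqS : (size s < (q ^ 2).+1)%N by rewrite ltnS.
  have [_ _ /(_ w Aw sw (nB1 _) _ IN)[nI cI _]] := Bad1P (Ordinal sqS).
  have small_le U : U \in small_sets g H -> #|U|%:R <= m2.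
    rewrite !inE => /orP[/andP[_]|] h.
      have q4 : 0 < q%:R ^+ 4 :> R by rewrite exprn_gt0// (lt_le_trans _ qR1).
      rewrite -(ler_pM2l q4); apply: le_trans m2n; by rewrite -natrX -natrM ler_nat.
    by apply: le_trans m2q; rewrite ler_nat.
  have hsm U : U \in small_sets g H -> `|bag_noise J e U w| <= (K + 2) * Num.sqrt (entropy2 * (m2 + m2)) /\
      bag_count J U w <= 2 * m2 + 4 * entropy2.
    move=> US; have [h1 _ h3] := hB2 w Aw sw nB2 U US; have := small_le U US => cU; split.
      apply: le_trans h1 _; rewrite ler_wpM2l ?addr_ge0// ler_wsqrtr// ler_wpM2l ?(ltW entropy2_gt0)//.
      by rewrite lerD2r.
    by move: cU h3; lra.
  have [cD1 cD2] := card_meet_diff sq (fun A As => (gP A (sH A As)).2).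
  have /andP[mD1 mD2] := mem_meet_diffs g ss sH.
  have q2n (c' : nat) : (q ^ 6 * c' <= q ^ 2 * n)%N -> (q ^ 4 * c' <= n)%N.
    have -> : (q ^ 6 = q ^ 2 * q ^ 4)%N by rewrite -expnD.
    by rewrite -mulnA leq_pmul2l// expn_gt0 q0.
  have sD1 : D1 \in small_sets g H by rewrite finset.in_setU finset.in_set mD1 q2n.
  have sD2 : D2 \in small_sets g H by rewrite finset.in_setU finset.in_set mD2 q2n.
  have sV' : V' \in small_sets g H.
    rewrite finset.in_setU [X in _ || X]finset.in_set (leq_trans _ cV) ?orbT//.
    by rewrite subset_leq_card// subsetIl.
  have sV : V \in small_sets g H by rewrite finset.in_setU [X in _ || X]finset.in_set cV orbT.
  have [nD1 _] := hsm _ sD1; have [nD2 kD2] := hsm _ sD2; have [nV' kV'] := hsm _ sV'.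
  have [_ kV] := hsm _ sV; split=> //.
  (* Identity of indicators: [S] is the intersection [I] of net elements, plus [D1], minus [D2],
     minus the part of [V] inside the original intersection. *)
  have E : bag_noise J e S w = bag_noise J e I w + bag_noise J e D1 w - bag_noise J e D2 w - bag_noise J e V' w.
    pose ind (U : {set 'I_n}) i : R := (J w i \in U)%:R * e (J w i) w.
    have nE (U : {set 'I_n}) : bag_noise J e U w = \sum_i ind U i.
      by rewrite /bag_noise big_mkcond; apply: eq_bigr => i _; rewrite /ind; case: ifP; rewrite ?mul1r ?mul0r.
    rewrite !nE -!sumrN -!big_split /=; apply: eq_bigr => i _.
    rewrite /ind -!mulNr -!mulrDl; congr (_ * _); rewrite /S /D1 /D2 /V' !(finset.in_setD, finset.in_setI).
    by case: (_ \in seq_meet s); case: (_ \in I); case: (_ \in V); rewrite /= ?subrr ?subr0 ?add0r ?addr0 ?subrr.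
  have kS : bag_count J I w <= bag_count J S w + bag_count J D2 w + bag_count J V' w :> R.
    pose bg (U : {set 'I_n}) := finset (fun i => J w i \in U).
    suff : (#|bg I| <= #|bg S| + #|bg D2| + #|bg V'|)%N by rewrite -(ler_nat R) !natrD.
    apply: leq_trans (leq_trans (leq_card_setU _ _) (leq_add (leq_card_setU _ _) (leqnn _))).
    apply/subset_leq_card/fintype.subsetP => i; have bgE U : (i \in bg U) = (J w i \in U) by rewrite finset.in_set.
    rewrite !finset.in_setU !bgE /S /D2 /V' !(finset.in_setD, finset.in_setI).
    by case: (_ \in seq_meet s); case: (_ \in I); case: (_ \in V).
  have nI' : `|bag_noise J e I w| <= (K + 2) * Num.sqrt (entropy (size s) * (4 * bag_count J S w
          + 16 * m2 + 32 * entropy2 + 8 * entropy (size s) + m1)).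
    apply: le_trans nI _; rewrite ler_wpM2l ?addr_ge0// ler_wsqrtr// ler_wpM2l ?(ltW (entropy_gt0 _))//.
    rewrite lerD2r; move: cI kS kD2 kV' => /=; lra.
  rewrite E mulrDr mulrCA.
  have h (a1 a2 a3 a4 : R) : `|a1 + a2 - a3 - a4| <= `|a1| + `|a2| + `|a3| + `|a4|.
    by rewrite (le_trans (ler_normB _ _))// lerD2r (le_trans (ler_normB _ _))// lerD2r ler_normD.
  by apply: le_trans (h _ _ _ _) _; move: nI' nD1 nD2 nV'; lra.
Qed.
(** The trace events are disjoint, so the factors P(AX H) add up to at most 1. *)
Lemma noise_event : exists Bad : set T, [/\ measurable Bad,
  (P Bad <= (4 * (q ^ 2 + 2)%:R * expR (- q%:R))%:E)%E &
  forall w, (forall a, `|e a w| <= b) -> ~ Bad w -> noise_bounded w].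
Proof.
have /choice[Bad BadP] := noise_event_given.
have mB H : measurable (Bad H) by have [] := BadP H.
exists (\bigcup_(H in [set` enum {set {set 'I_n}}]) Bad H); split.
- by apply: fin_bigcup_measurable => [|H _]; [exact: finite_seq|exact: mB].
- apply: le_trans (measure_bigcup_seq_le P _ mB) _; rewrite big_enum /=.
  apply: (@le_trans _ _ (\sum_H (4 * (q ^ 2 + 2)%:R * expR (- q%:R))%:E * P (AX H))%E).
    by apply: lee_sum => H _; have [] := BadP H.
  rewrite -ge0_sume_distrr// -measure_fintype_bigcup//; last first.
    by apply/trivIsetP => H H' _ _ HH; rewrite -subset0 => w [E1 E2]; case/eqP: HH; exact: etrans (esym E1) E2.
  rewrite -[leRHS]mule1 lee_wpmul2l ?lee_fin ?mulr_ge0 ?expR_ge0//.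
  apply: probability_le1; apply: fin_bigcup_measurable => //; exact: finite_finset.
- move=> w hw nB; have [_ _] := BadP (traces (x ^~ w)); apply=> // h; apply: nB.
  by exists (traces (x ^~ w)) => //=; rewrite mem_enum.
Qed.

End NoiseEvent.

(** * Events of high probability *)

Section HighProbability.
Context {R : realType} {d : measure_display} {T : measurableType d}.
Variable P : probability T R.
Implicit Types E : nat -> set T.

Lemma cvg_probability1P (F : nat -> set T) : (forall n, measurable (F n)) ->
  (P \o F) n @[n --> \oo] --> 1%E <-> (fine (P (~` F n)) @[n --> \oo] --> 0).
Proof.
move=> mF; have E n : P (F n) = (1 - fine (P (~` F n)))%:E.
  rewrite probability_setC// fineB ?fin_num_measure//= opprB addrC subrK fineK//.
  exact: fin_num_measure.
split=> h; last first.
  rewrite (_ : P \o F = EFin \o (fun n => 1 - fine (P (~` F n)))); last by apply/funext => n; exact: E.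
  apply: cvg_EFin; first exact: nearW.
  rewrite -[X in _ --> X]subr0; apply: cvgB => //; exact: cvg_cst.
have {}h : (fun n => (1 - fine (P (~` F n)))%:E) n @[n --> \oo] --> 1%:E.
  by under eq_fun do rewrite -E.
move/fine_cvgP : h => [_ h].
rewrite (_ : (fun n => _) = fun n => 1 - (1 - fine (P (~` F n)))); last by apply/funext => n; ring.
rewrite -[X in _ --> X](subrr 1); apply: cvgB => //; exact: cvg_cst.
Qed.

(** Eventual conditions suffice: for the other [n] the empty event is used in [whp]. *)
Lemma whp_bad (Bad : nat -> set T) E (kappa : nat -> R) :
  kappa @ \oo --> 0 -> (\forall n \near \oo, [/\ measurable (Bad n), (P (Bad n) <= (kappa n)%:E)%E
    & ~` Bad n `<=` E n]) -> whp P E.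
Proof.
move=> k0 h; exists (fun n => if `[< measurable (Bad n) /\ ~` Bad n `<=` E n >] then ~` Bad n else set0).
have mF n : measurable (if `[< measurable (Bad n) /\ ~` Bad n `<=` E n >] then ~` Bad n else set0).
  by case: asboolP => [[mB _]|_]; [exact: measurableC|exact: measurable0].
split=> // [n|]; first by case: asboolP => [[]//|_]; exact: sub0set.
apply/cvg_probability1P => //; apply: (squeeze_cvgr _ (cvg_cst 0) k0).
near=> n; have [mB PB BE] : [/\ measurable (Bad n), (P (Bad n) <= (kappa n)%:E)%E & ~` Bad n `<=` E n] by near: n.
rewrite fine_ge0//=; case: asboolP => [_|[]//]; rewrite setCK -lee_fin fineK//.
exact: fin_num_measure.
Unshelve. all: by end_near.
Qed.

Lemma whp_bad_exists E : whp P E -> exists Bad : nat -> set T,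
  [/\ forall n, measurable (Bad n), forall n, ~` Bad n `<=` E n
    & fine (P (Bad n)) @[n --> \oo] --> 0].
Proof.
move=> [F [mF FE /cvg_probability1P]]; move=> /(_ mF) h.
exists (fun n => ~` F n); split=> // n; first exact: measurableC.
by rewrite setCK.
Qed.

Lemma whp_sub E E' : (\forall n \near \oo, E n `<=` E' n) -> whp P E -> whp P E'.
Proof.
move=> EE /whp_bad_exists[Bad [mB BE B0]]; apply: whp_bad B0 _.
near=> n; split=> //; first by rewrite fineK// fin_num_measure.
by apply: subset_trans (BE n) _; near: n.
Unshelve. all: by end_near.
Qed.

Lemma whp_and E E' : whp P E -> whp P E' -> whp P (fun n => E n `&` E' n).
Proof.
move=> /whp_bad_exists[B1 [m1 s1 c1]] /whp_bad_exists[B2 [m2 s2 c2]].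
apply: (@whp_bad (fun n => B1 n `|` B2 n) _ (fun n => fine (P (B1 n)) + fine (P (B2 n)))).
  by rewrite -[X in _ --> X](addr0 0); exact: cvgD.
apply: nearW => n; split; first exact: measurableU.
  by rewrite EFinD !fineK ?fin_num_measure//; exact: measureU2.
by rewrite setCU => w [/s1 ? /s2].
Qed.

Lemma whp_nearT E : (\forall n \near \oo, E n = setT) -> whp P E.
Proof.
move=> h; apply: (@whp_bad (fun=> set0) _ (fun=> 0)); first exact: cvg_cst.
by near=> n; split; [exact: measurable0|rewrite measure0|rewrite (_ : E n = setT)//; near: n].
Unshelve. all: by end_near.
Qed.

Lemma whp_forall (M : nat) (E : 'I_M -> nat -> set T) : (forall m, whp P (E m)) ->
  whp P (fun n => [set w | forall m, E m n w]).
Proof.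
move=> hE; suff h (s : seq 'I_M) : whp P (fun n => [set w | forall m, m \in s -> E m n w]).
  by apply: whp_sub (h (enum 'I_M)); apply: nearW => n w hw m; apply: hw; rewrite mem_enum.
elim: s => [|m s IH].
  by apply: whp_nearT; apply: nearW => n; apply/seteqP; split.
apply: whp_sub (whp_and (hE m) IH); apply: nearW => n w [h1 h2] k; rewrite inE => /orP[/eqP ->//|].
exact: h2.
Qed.

End HighProbability.

(** * General position *)

Section HyperplaneCount.
Context {R : realType} {p n : nat}.
Variables (XX : set 'rV[R]_p) (z : dataset R p n) (As : seq (set 'rV[R]_p)) (c eta Delta : R).
Hypothesis bX : forall x y, XX x -> XX y -> norm2 (x - y) <= Delta.
Hypothesis hAs : partition_with XX disjoint_cells As.
Hypothesis zX : forall i, XX (z i).1.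
Hypothesis hA : forall A, A \in As -> [/\ (0 < #|obs z A|)%N, 0 < diameter A,
  diameter A <= eta & c <= lambda_cell z A].

(* The variance of a cell that meets the hyperplane is bounded by the
   proportion of its observations off the hyperplane. *)
Lemma hyperplane_count (v : 'rV[R]_p) (b : R) : 0 <= c -> v != 0 ->
  c * #|finset (fun i => dotv v (z i).1 == b)|%:R <=
  #|finset (fun i => 0 < `|dotv v (z i).1 - b| <= norm2 v * eta)|%:R.
Proof.
move=> c0 v0; set On := finset _; set Near := finset _.
have [cov sub pw] := hAs; have N0 : 0 < norm2 v by rewrite norm2_gt0.
have cell A : A \in As -> c * #|obs z A :&: On|%:R <= #|obs z A :&: Near|%:R.
  move=> AAs; have [C0 d0 deta lam] := hA AAs.
  have [->|/set0Pn[h]] := eqVneq (obs z A :&: On) finset.set0; first by rewrite cards0 mulr0.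
  rewrite finset.in_setI [X in _ && X]finset.in_set => /andP[hC /eqP hb].
  have inA i : i \in obs z A -> A (z i).1 by rewrite inE => /asboolP.
  have dist i : i \in obs z A -> `|dotv v (z i).1 - b| <= norm2 v * diameter A.
    move=> iC; rewrite -hb -dotvBr (le_trans (cauchy_schwarz _ _))// ler_wpM2l ?norm2_ge0//.
    apply: (@diameter_ge _ _ A Delta); [|exact: inA..].
    by move=> x y /(sub A AAs) Xx /(sub A AAs); exact: bX.
  have cC : 0 < #|obs z A|%:R :> R by rewrite ltr0n.
  set xb := cell_mean z A; set m := dotv v xb - b.
  have cen : \sum_(i in obs z A) dotv v ((z i).1 - xb) = 0.
    rewrite -dotv_sumr sumrB sumr_const /xb /cell_mean -scaler_nat scalerA divff ?lt0r_neq0//.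
    by rewrite scale1r subrr dotv0r.
  have V : \sum_(i in obs z A) dotv v ((z i).1 - xb) ^+ 2 <= \sum_(i in obs z A) (dotv v (z i).1 - b) ^+ 2.
    have -> : \sum_(i in obs z A) (dotv v (z i).1 - b) ^+ 2 =
        \sum_(i in obs z A) (dotv v ((z i).1 - xb) ^+ 2 + (2 * m * dotv v ((z i).1 - xb) + m ^+ 2)).
      by apply: eq_bigr => i _; rewrite dotvBr /m; ring.
    rewrite big_split /= lerDl big_split /= -mulr_sumr cen mulr0 add0r sumr_ge0// => i _.
    exact: sqr_ge0.
  have V2 : \sum_(i in obs z A) (dotv v (z i).1 - b) ^+ 2 <=
      (norm2 v * diameter A) ^+ 2 * #|obs z A :&: Near|%:R.
    rewrite mulr_natr -sumr_const big_mkcond [leRHS]big_mkcond; apply: ler_sum => i _.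
    rewrite finset.in_setI [X in _ && X]finset.in_set; case: ifP => //= iC.
    have dv : norm2 v * diameter A <= norm2 v * eta by rewrite ler_wpM2l ?norm2_ge0.
    rewrite normr_gt0 (le_trans (dist i iC) dv) andbT.
    have [->|_] := eqVneq (dotv v (z i).1 - b) 0; first by rewrite expr0n.
    rewrite -real_normK ?num_real// lerXn2r ?nnegrE ?dist//.
    by rewrite mulr_ge0 ?norm2_ge0 ?(ltW d0).
  have := cell_variance v d0 C0; rewrite -/xb -norm2_sqr => W.
  have {W V V2} := le_trans W (le_trans V V2).
  have -> : lambda_cell z A * (#|obs z A|%:R * diameter A ^+ 2 * norm2 v ^+ 2) =
      (norm2 v * diameter A) ^+ 2 * (lambda_cell z A * #|obs z A|%:R) by ring.
  rewrite ler_pM2l ?exprn_gt0 ?mulr_gt0// => W; apply: le_trans W.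
  rewrite ler_pM// ?ler_nat ?subset_leq_card ?subsetIl//.
apply: (@le_trans _ _ (c * (\sum_(A <- As) #|obs z A :&: On|)%N%:R)).
  rewrite ler_wpM2l// ler_nat.
  have : On \subset \bigcup_(A <- As) (obs z A :&: On).
    apply/fintype.subsetP => i iOn; have /hasP[A AAs Ai] := cov _ (zX i).
    rewrite (big_rem A AAs) /= finset.in_setU finset.in_setI iOn andbT.
    by rewrite [X in X || _]finset.in_set Ai.
  move=> /subset_leq_card /leq_trans; apply; elim: (As) => [|A s IH]; first by rewrite !big_nil cards0.
  by rewrite !big_cons (leq_trans (leq_card_setU _ _))// leq_add2l.
apply: (@le_trans _ _ (\sum_(A <- As) #|obs z A :&: Near|)%N%:R).
  rewrite !natr_sum mulr_sumr !big_seq; exact: ler_sum.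
by rewrite ler_nat sum_obs_setI.
Qed.

End HyperplaneCount.

Section HyperplaneNull.
Context {R : realType} {p : nat} {d : measure_display} {T : measurableType d}.
Variables (P : probability T R) (X : nat -> T -> 'rV[R]_p) (Y : nat -> T -> R).
Hypothesis hiid : iid P (fun i w => (X i w, Y i w)).

Local Notation xsp := (g_sigma_algebraType (@open 'rV[R]_p)).

Lemma X_identically_distributed (B : set xsp) i : measurable B ->
  P (X i @^-1` B) = P (X 0%N @^-1` B).
Proof.
move=> mB; have mB' : measurable (fst @^-1` B : set (xyspace (R := R) (p := p))).
  by have := measurable_xpart (R := R) (p := p) measurableT mB; rewrite setTI.
by case: hiid => _ h _; have := h i _ mB'.
Qed.

Lemma probability_bagged_position n (J : T -> {ffun 'I_n -> 'I_n}) (i : 'I_n) (B : set xsp) :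
  (0 < n)%N -> uniform_resampling P (fun i w => (X i w, Y i w)) J -> measurable B ->
  P [set w | B (X (J w i) w)] = P (X 0%N @^-1` B).
Proof.
move=> n0 hJ mB.
have := @probability_resample _ _ _ P _ _ (XY X Y) (measurable_XY hiid) n J (fun j => (hJ j).1)
  (fun j => (hJ j).2) n (fun j => X (j i) @^-1` B).
move=> ->; last first.
  by move=> j; have := @off_measurable_X R p d T X Y n (j i) measurableT B mB; rewrite setTI.
under eq_bigr do rewrite X_identically_distributed//.
have fP : P (X 0%N @^-1` B) \is a fin_num.
  by apply: fin_num_measure; have := measurable_X hiid 0 measurableT mB; rewrite setTI.
rewrite -(fineK fP) sumEFin sumr_const card_ffun !card_ord -EFinM; congr (_%:E).
by rewrite -[fine _ *+ _]mulr_natl mulrA mulVf ?mul1r// pnatr_eq0 -lt0n expn_gt0 n0.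
Qed.

Lemma measurable_hyperplane_level (v : 'rV[R]_p) (D : set R) : measurable D ->
  measurable ((fun x => dotv v x) @^-1` D : set xsp).
Proof. by move=> mD; have := measurable_dotv v measurableT mD; rewrite setTI. Qed.

Variable (J : forall n, T -> {ffun 'I_n -> 'I_n}).
Hypothesis hJ : forall n, uniform_resampling P (fun i w => (X i w, Y i w)) (J n).
Variable c : R.
Hypothesis c0 : 0 < c.
Variables (v : 'rV[R]_p) (b : R).
Hypothesis hcount : forall eta, 0 < eta -> whp P (fun n => [set w |
  c * #|finset (fun i : 'I_n => dotv v (X (J n w i) w) == b)|%:R <=
  #|finset (fun i : 'I_n => 0 < `|dotv v (X (J n w i) w) - b| <= eta)|%:R]).

Let On : set xsp := (fun x => dotv v x) @^-1` [set b].
Let Near (eta : R) : set xsp := (fun x => dotv v x) @^-1` [set y | 0 < `|y - b| <= eta].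

Let mOn : measurable On. Proof. exact: measurable_hyperplane_level. Qed.

Let mNear eta : measurable (Near eta).
Proof.
apply: measurable_hyperplane_level.
have m : measurable_fun setT (fun y : R => `|y - b|).
  by apply: measurableT_comp => //; apply: measurable_funB.
rewrite (_ : [set y | _] = [set y | 0 < `|y - b|] `&` [set y | `|y - b| <= eta]); last first.
  by apply/seteqP; split=> y /= => [/andP[]|[-> ->]].
apply: measurableI.
  by have := measurable_fun_ltr (@measurable_cst _ _ R R setT 0) m; move=> /(_ measurableT [set true] I); rewrite setTI.
by have := measurable_fun_le measurableT m (@measurable_cst _ _ R R setT eta); rewrite setTI.
Qed.

(** The slabs exclude the hyperplane itself, so they decrease to the empty set. *)
Lemma Near_cvg0 : P (X 0%N @^-1` Near k.+1%:R^-1) @[k --> \oo] --> 0%E.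
Proof.
rewrite -[X in _ --> X](measure0 P).
have <- : \bigcap_k (X 0%N @^-1` Near k.+1%:R^-1) = set0.
  rewrite -subset0 => w hw; have /andP[h0 _] := hw 0%N I.
  have [k _ hk] := near_infty_natSinv_lt (PosNum h0).
  have := hw k I => /andP[_]; have /= := hk k (leqnn k); rewrite ltNge => /negP + h; exact.
apply: nonincreasing_cvg_mu => //.
- by rewrite (le_lt_trans (probability_le1 _ _)) ?ltry//; have := measurable_X hiid 0 measurableT (mNear 1%:R^-1); rewrite setTI.
- by move=> k; have := measurable_X hiid 0 measurableT (mNear k.+1%:R^-1); rewrite setTI.
- by apply: bigcap_measurableType => k _; have := measurable_X hiid 0 measurableT (mNear k.+1%:R^-1); rewrite setTI.
- move=> k l kl; apply/subsetPset => w /andP[h1 h2]; apply/andP; split=> //.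
  by rewrite (le_trans h2)// lef_pV2 ?posrE// ler_nat.
Qed.

(** Each of the [n] positions has the law of X_0, so taking expectations in the count inequality
    compares c P(On) with P(Near), up to the probability of failure. If P(On) were positive, a thin
    slab and then a large [n] would contradict this. *)
Lemma hyperplane_null : P (X 0%N @^-1` On) = 0%E.
Proof.
have mX0 B : measurable (B : set xsp) -> measurable (X 0%N @^-1` B).
  by move=> mB; have := measurable_X hiid 0 measurableT mB; rewrite setTI.
have fP A : measurable A -> P A \is a fin_num by exact: fin_num_measure.
set h := fine (P (X 0%N @^-1` On)).
have hE : P (X 0%N @^-1` On) = h%:E by rewrite fineK//; apply: fP; exact: mX0.
suff : ~~ (0 < h) by rewrite -leNgt hE => h0; congr EFin; apply/le_anti; rewrite h0 fine_ge0.
apply/negP => h0.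
have [k Pk] : exists k, fine (P (X 0%N @^-1` Near k.+1%:R^-1)) < c * h / 2.
  have /fine_cvgP[_ cv] := Near_cvg0.
  have e0 : 0 < c * h / 2 by rewrite divr_gt0 ?mulr_gt0.
  have /cvgrPdist_lt/(_ _ e0)[k _ hk] := cv; exists k; have := hk k (leqnn k).
  by rewrite /= sub0r normrN ger0_norm// fine_ge0.
have eta0 : 0 < k.+1%:R^-1 :> R by rewrite invr_gt0.
have [Bad [mB BE cB]] := whp_bad_exists (hcount eta0).
have [n [n0 Bn]] : exists n, (0 < n)%N /\ fine (P (Bad n)) < h / 2.
  have e0 : 0 < h / 2 by rewrite divr_gt0.
  have /cvgrPdist_lt/(_ _ e0)[N _ hN] := cB; exists (maxn N 1); rewrite leq_maxr; split=> //.
  have := hN (maxn N 1) (leq_maxl _ _).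
  by rewrite /= sub0r normrN ger0_norm// fine_ge0.
pose at_ (B : set xsp) (i : 'I_n) := [set w | B (X (J n w i) w)].
have mat B i : measurable B -> measurable (at_ B i).
  move=> mB'; have := @measurable_by_bag _ _ n (J n) (fun j => (hJ j).1) (fun j => X (j i) @^-1` B); apply => j.
  by have := measurable_X hiid (j i) measurableT mB'; rewrite setTI.
have Pat B i : measurable B -> P (at_ B i) = P (X 0%N @^-1` B).
  by move=> mB'; exact: probability_bagged_position.
set F := ~` Bad n; have mF : measurable F by exact: measurableC.
have ind A : measurable A -> (\int[P]_w (\1_A w)%:E)%E = P A.
  by move=> mA; rewrite integral_indic// setIT.
have le_int : (\int[P]_w (\sum_(i < n) (c * \1_(at_ On i `&` F) w)%:E) <=
    \int[P]_w (\sum_(i < n) (\1_(at_ (Near k.+1%:R^-1) i) w)%:E))%E.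
  apply: ge0_le_integral => //.
  - by move=> w _; apply: sume_ge0 => i _; rewrite lee_fin mulr_ge0// ltW.
  - apply: emeasurable_sum => i; apply/measurable_EFinP; apply: measurable_funM => //.
    by apply: measurable_indic; apply: measurableI => //; exact: mat.
  - apply: emeasurable_sum => i; apply/measurable_EFinP; apply: measurable_indic; exact: mat.
  - move=> w _; rewrite !sumEFin lee_fin.
    have [Fw|Fw] := pselect (F w); last first.
      rewrite big1 ?sumr_ge0// => i _; rewrite indicE memNset ?mulr0//.
      by move=> [].
    have := BE n w Fw; rewrite /= -mulr_sumr.
    have cE (Q : pred 'I_n) : #|finset Q|%:R = \sum_(i < n) (Q i)%:R :> R.
      rewrite -sum1_card natr_sum big_mkcond; apply: eq_bigr => i _; rewrite finset.in_set.
      by case: (Q i).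
    rewrite !cE => hc.
    apply: (le_trans (_ : _ <= _) (le_trans hc _)); rewrite ?ler_pM2l//; apply: ler_sum => i _.
      rewrite indicE; case: (boolP (_ \in _)) => [|_]; last exact: ler0n.
      by rewrite inE => -[/= -> _]; rewrite eqxx.
    rewrite indicE; case: (boolP (_ < _ <= _)) => hi; last exact: ler0n.
    by rewrite mem_set.
have mf B (i : 'I_n) (a : R) F' : measurable (B : set xsp) -> measurable F' ->
    measurable_fun setT (fun w => (a * \1_(at_ B i `&` F') w)%:E).
  move=> mB' mF'; apply/measurable_EFinP; apply: measurable_funM => //.
  by apply: measurable_indic; apply: measurableI => //; exact: mat.
move: le_int; rewrite (@ge0_integral_sum _ _ _ P _ measurableT _ (fun i w => (c * \1_(at_ On i `&` F) w)%:E)).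
2: by move=> i; exact: mf.
2: by move=> i w _; rewrite lee_fin mulr_ge0// ltW.
rewrite (@ge0_integral_sum _ _ _ P _ measurableT _ (fun i w => (\1_(at_ (Near k.+1%:R^-1) i) w)%:E)).
2: by move=> i; apply/measurable_EFinP; apply: measurable_indic; exact: mat.
2: by move=> i w _; rewrite lee_fin.
have -> : (\sum_(i < n) \int[P]_w (\1_(at_ (Near k.+1%:R^-1) i) w)%:E)%E =
    (n%:R * fine (P (X 0%N @^-1` Near k.+1%:R^-1)))%:E.
  rewrite (eq_bigr (fun=> (fine (P (X 0%N @^-1` Near k.+1%:R^-1)))%:E)).
    by rewrite sumEFin sumr_const card_ord mulr_natl.
  move=> i _; rewrite ind; last exact: mat.
  by rewrite Pat// fineK//; apply: fP; exact: mX0.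
have low i : ((c * (h / 2))%:E <= \int[P]_w (c * \1_(at_ On i `&` F) w)%:E)%E.
  have mI : measurable (at_ On i `&` F) by apply: measurableI => //; exact: mat.
  under eq_integral do rewrite EFinM.
  rewrite ge0_integralZl//=; [|by apply/measurable_EFinP; exact: measurable_indic|by rewrite lee_fin ltW].
  rewrite ind// EFinM lee_pmul2l//.
  have : (P (at_ On i) <= P (at_ On i `&` F) + P (Bad n))%E.
    apply: le_trans (measureU2 _ _ _) => //; apply: le_measure; rewrite ?inE; [exact: mat|exact: measurableU|].
    by move=> w h1; have [?|?] := pselect (Bad n w); [right|left].
  rewrite Pat// hE -(fineK (fP _ mI)) -(fineK (fP _ (mB n))) -EFinD !lee_fin; lra.
move=> le2; have {le2} := le_trans (lee_sum _ (fun i _ => low i)) le2.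
rewrite sumEFin sumr_const card_ord lee_fin -[X in X <= _]mulr_natl ler_pM2l ?ltr0n//.
by move: Pk; set y := fine _; lra.
Qed.

End HyperplaneNull.

(** * Determinants that detect affine dependence *)

Section Minors.
Context {R : realType} {p : nat}.
Implicit Types (x s : 'rV[R]_p) (y : nat -> 'rV[R]_p).

(** Coordinates of (1, x), indexed by natural numbers so that leading minors of every size make
    sense; the full minor of p + 1 points on a common hyperplane vanishes. *)
Definition aug x (j : nat) : R :=
  if j is j'.+1 then (if insub j' is Some i then x ord0 i else 0) else 1.

Definition aug_mx k y : 'M[R]_k := \matrix_(i, j) aug (y i) j.

Definition with_last k y s : nat -> 'rV[R]_p := fun i => if i == k then s else y i.

(* Expansion along the last row: the coefficient of coordinate [k - 1] is the
   preceding minor. *)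
Lemma minor_affine k y : (0 < k <= p)%N -> \det (aug_mx k y) != 0 ->
  exists (v : 'rV[R]_p) (b : R), v != 0 /\
    forall s, \det (aug_mx k.+1 (with_last k y s)) = dotv v s - b.
Proof.
move=> /andP[k0 kp] dk; pose A s := aug_mx k.+1 (with_last k y s).
pose cf j := cofactor (A 0) ord_max j.
have cfE s j : cofactor (A s) ord_max j = cf j.
  rewrite /cf /cofactor; congr (_ * \det _); apply/matrixP => i l.
  by rewrite !mxE /with_last lift_max (ltn_eqF (ltn_ord i)).
pose v : 'rV[R]_p := \row_(i < p) (if (i < k)%N then cf (inord i.+1) else 0).
exists v, (- cf ord0); split.
  have pk : (k.-1 < p)%N by rewrite prednK.
  apply/eqP => /rowP /(_ (Ordinal pk)); rewrite !mxE /= prednK// leqnn.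
  have -> : inord k = ord_max :> 'I_k.+1 by apply: val_inj; rewrite /= inordK.
  rewrite /cf /cofactor /= addnn -mul2n mulnC exprM sqrr_sign mul1r => E; case/eqP: dk; rewrite -E.
  congr (\det _); apply/matrixP => i j.
  by rewrite !mxE !lift_max /with_last (ltn_eqF (ltn_ord i)).
move=> s; rewrite opprK (expand_det_row _ ord_max).
under eq_bigr do rewrite cfE mxE /with_last eqxx.
rewrite big_ord_recl mul1r addrC; congr (_ + _).
rewrite (eq_bigr (fun i : 'I_k => aug s i.+1 * cf (inord i.+1))); last first.
  move=> i _; rewrite lift0; congr (_ * cf _).
  by apply: val_inj; rewrite [RHS]inordK ?ltnS ?lift0.
rewrite (big_ord_widen p (fun i => aug s i.+1 * cf (inord i.+1)))// /dotv big_mkcond.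
apply: eq_bigr => i _; rewrite !mxE /aug; case: ifP; rewrite ?mul0r// => ik.
by rewrite insubT ?ltn_ord// => ip; rewrite mulrC; congr (_ * s _ _); exact: val_inj.
Qed.

Lemma minor1 y : \det (aug_mx 1 y) = 1.
Proof. by rewrite det_mx11 mxE. Qed.

Lemma aug_mx_eq k y y' : (forall i, (i < k)%N -> y i = y' i) -> aug_mx k y = aug_mx k y'.
Proof. by move=> h; apply/matrixP => i j; rewrite !mxE h. Qed.

(** Points with v . x = b give rows (1, x) orthogonal to the nonzero vector (-b, v). *)
Lemma card_on_hyperplane (I : finType) (x : I -> 'rV[R]_p) (v : 'rV[R]_p) (b : R) : v != 0 ->
  (forall a : nat -> I, {in gtn p.+1 &, injective a} -> \det (aug_mx p.+1 (x \o a)) != 0) ->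
  (#|finset (fun i => dotv v (x i) == b)| <= p)%N.
Proof.
move=> v0 gp; rewrite leqNgt; apply/negP; set H := finset _ => cH.
have /set0Pn[i0 _] : H != finset.set0 by rewrite -cards_eq0 -lt0n (leq_trans _ cH).
pose a k := nth i0 (enum H) k.
have szH : size (enum H) = #|H| by rewrite -cardE.
have aH k : (k < p.+1)%N -> dotv v (x (a k)) = b.
  move=> kp; apply/eqP; have : a k \in H by rewrite -mem_enum mem_nth// szH (leq_trans kp).
  by rewrite inE.
have := gp a; case/(_ _)/negP.
  move=> k l; rewrite !inE => kp lp /eqP; rewrite nth_uniq ?enum_uniq ?szH ?(leq_trans _ cH)//.
  by move/eqP.
apply/eqP; rewrite -det_tr; apply/eqP/det0P.
exists (\row_j (if nat_of_ord j is j'.+1 then (if insub j' is Some i then v ord0 i else 0) else - b)).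
  apply: contraNneq v0 => /rowP h; apply/eqP/rowP => i; rewrite mxE.
  have := h (inord i.+1); rewrite !mxE inordK ?ltnS// insubT ?ltn_ord// => ip <-.
  by congr (v _ _); exact: val_inj.
apply/rowP => k; rewrite !mxE big_ord_recl !mxE /= mulr1.
rewrite -(aH k (ltn_ord k)) addrC; apply/eqP; rewrite subr_eq0; apply/eqP.
apply: eq_bigr => i _; rewrite !mxE lift0 /aug insubT ?ltn_ord// => ip.
by congr (v _ _ * x _ _ _); exact: val_inj.
Qed.

End Minors.

Section GeneralPosition.
Context {R : realType} {p : nat} {d : measure_display} {T : measurableType d}.
Variables (P : probability T R) (X : nat -> T -> 'rV[R]_p) (Y : nat -> T -> R).
Hypothesis hiid : iid P (fun i w => (X i w, Y i w)).
Local Notation xsp := (g_sigma_algebraType (@open 'rV[R]_p)).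
Local Notation xysp := (xyspace (R := R) (p := p)).
Hypothesis hnull : forall (v : 'rV[R]_p) (b : R), v != 0 ->
  P (X 0%N @^-1` ((fun x => dotv v x) @^-1` [set b])) = 0%E.

Lemma measurable_det (d' : measure_display) (S : measurableType d') k (A : S -> 'M[R]_k) :
  (forall i j, measurable_fun setT (fun s => A s i j)) -> measurable_fun setT (fun s => \det (A s)).
Proof.
move=> mA; apply: measurable_sum => s; apply: measurable_funM => //.
by apply: measurable_prod => i _; exact: mA.
Qed.

Lemma measurable_aug j : measurable_fun setT (fun x : xsp => aug x j).
Proof.
case: j => [|j] /=; first exact: measurable_cst.
case: insubP => [i _ _|_]; last exact: measurable_cst.
rewrite (_ : (fun x => _) = (fun x => dotv (delta_mx ord0 i) x)); last first.
  by apply/funext => x; rewrite dotv_delta.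
exact: measurable_dotv.
Qed.

Lemma measurable_minor k (a : nat -> nat) :
  measurable [set w | \det (aug_mx k (fun i => X (a i) w)) = 0].
Proof.
have m : measurable_fun setT (fun w => \det (aug_mx k (fun i => X (a i) w))).
  apply: measurable_det => i j; under eq_fun do rewrite mxE.
  exact: measurableT_comp (measurable_aug j) (measurable_X hiid (a i)).
by have := m measurableT [set 0] (measurable_set1 0); rewrite setTI.
Qed.

(** Freeze the first [k] points, which are independent of the last. The next minor is then a
    nonconstant affine function of the last point, so it vanishes on a null hyperplane, and Fubini
    concludes. *)
Lemma minor_neq0_step k (a : nat -> nat) : (0 < k <= p)%N -> {in gtn k.+1 &, injective a} ->
  P ([set w | \det (aug_mx k (fun i => X (a i) w)) != 0] `&`
     [set w | \det (aug_mx k.+1 (fun i => X (a i) w)) = 0]) = 0%E.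
Proof.
move=> kp inj; pose W := XY X Y; pose off := off_algebra W (a k).
pose m1 (u : off) := \det (aug_mx k (fun i => X (a i) u)).
pose m2 (z : off * xysp) :=
  \det (aug_mx k.+1 (with_last k (fun i => X (a i) z.1) z.2.1)).
have mXoff i : (i < k)%N -> measurable_fun setT (fun u : off => X (a i) u : xsp).
  move=> ik; have m : measurable_fun setT (W (a i) : off -> xysp).
    apply: measurable_off_algebra; apply/eqP => E.
    by have := inj i k; rewrite !inE => /(_ (leqW ik) (ltnSn k) E) /eqP; rewrite (ltn_eqF ik).
  exact: measurableT_comp measurable_xpart m.
have mm1 : measurable_fun setT m1.
  apply: measurable_det => i j; under eq_fun do rewrite mxE.
  exact: measurableT_comp (measurable_aug j) (mXoff i (ltn_ord i)).
have mm2 : measurable_fun setT m2.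
  apply: measurable_det => i j; under eq_fun do rewrite mxE.
  rewrite /with_last; case: eqP => [_|/eqP ik].
    exact: measurableT_comp (measurable_aug j) (measurableT_comp measurable_xpart measurable_snd).
  apply: (measurableT_comp (measurable_aug j)).
  have ik' : (i < k)%N by rewrite ltn_neqAle ik -ltnS ltn_ord.
  exact: (measurableT_comp (mXoff i ik') measurable_fst).
pose D : set (off * xysp) := [set z | m1 z.1 != 0 /\ m2 z = 0].
have mD : measurable D.
  rewrite (_ : D = ~` ((m1 \o fst : off * xysp -> R) @^-1` [set 0]) `&` m2 @^-1` [set 0]); last first.
    by apply/seteqP; split=> z [/= /eqP h1 h2]; split=> //; apply/eqP.
  apply: measurableI; last by have := mm2 measurableT _ (measurable_set1 0); rewrite setTI.
  have mf : measurable_fun setT (m1 \o fst : off * xysp -> R) by exact: measurableT_comp.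
  by apply: measurableC; have := mf measurableT _ (measurable_set1 0); rewrite setTI.
have -> : [set w | \det (aug_mx k (fun i => X (a i) w)) != 0] `&`
    [set w | \det (aug_mx k.+1 (fun i => X (a i) w)) = 0] = [set w | D (w, W (a k) w)].
  have E w : m2 (w, W (a k) w) = \det (aug_mx k.+1 (fun i => X (a i) w)).
    rewrite /m2 /=; congr (\det _); apply: aug_mx_eq => i _.
    by rewrite /with_last; case: eqP => [->|].
  by apply/seteqP; split=> w [h1 h2]; split=> //=; rewrite ?E// -E.
have F0 z : (0 <= (\1_D z)%:E :> \bar R)%E by rewrite lee_fin.
have mF : measurable_fun setT (fun z => (\1_D z)%:E : \bar R).
  by apply/measurable_EFinP; exact: measurable_indic.
have := fubini_off (measurable_XY hiid) (indep_XY hiid) mF F0.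
rewrite [X in _ = X -> _]integral0_eq; last first.
  move=> w _; have [m0|m0] := eqVneq (m1 w) 0.
    by apply: integral0_eq => w' _; rewrite indicE memNset// => -[/=]; rewrite m0 eqxx.
  have [v [b [v0 hv]]] := minor_affine kp m0.
  pose H : set T := X (a k) @^-1` ((fun x => dotv v x) @^-1` [set b]).
  have mL : measurable ((fun x => dotv v x) @^-1` [set b] : set xsp) by exact: measurable_hyperplane_level.
  have mH : measurable H by have := measurable_X hiid (a k) measurableT mL; rewrite setTI.
  have PH : P H = 0%E by rewrite /H (X_identically_distributed hiid (a k) mL) hnull.
  rewrite (_ : (fun w' => _) = (fun w' => (\1_H w')%:E)).
    by rewrite integral_indic// setIT.
  apply/funext => w'; congr (_%:E); rewrite !indicE; congr (_%:R); congr nat_of_bool.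
  apply/idP/idP; rewrite !inE.
    by move=> [_]; rewrite /m2 hv /= => /eqP; rewrite subr_eq0 => /eqP.
  by move=> /= h; split=> //; rewrite /m2 hv /= h subrr.
have mDw : measurable [set w | D (w, W (a k) w)].
  have mid : measurable_fun setT (id : T -> off) by apply: measurable_id_off_algebra; exact: measurable_XY hiid.
  have mp : measurable_fun setT (fun w : T => ((w : off), W (a k) w)).
    apply: measurable_fun_pair => //; exact: measurable_XY hiid _.
  by have := mp measurableT _ mD; rewrite setTI.
move=> <-; rewrite -[LHS](_ : (\int[P]_w (\1_[set w | D (w, W (a k) w)] w)%:E)%E = _)//.
by rewrite integral_indic// setIT.
Qed.

Lemma minor_neq0 k (a : nat -> nat) : (k < p.+1)%N -> {in gtn k.+1 &, injective a} ->
  P [set w | \det (aug_mx k.+1 (fun i => X (a i) w)) = 0] = 0%E.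
Proof.
elim: k => [|k IH] kp inj.
  by under eq_set do rewrite minor1; rewrite (_ : [set _ | _] = set0)// -subset0 => w /= /eqP; rewrite oner_eq0.
have inj' : {in gtn k.+1 &, injective a}.
  by move=> i j; rewrite !inE => ik jk; apply: inj; rewrite inE leqW.
apply/eqP; rewrite -measure_le0; have <- := IH (ltnW kp) inj'.
rewrite -[leRHS]adde0 -(@minor_neq0_step k.+1 a)//.
apply: le_trans (measureU2 _ _ _).
- apply: le_measure; rewrite ?inE; first exact: measurable_minor.
    apply: measurableU; first exact: measurable_minor.
    apply: measurableI; last exact: measurable_minor.
    by have := measurableC (measurable_minor k.+1 a); congr measurable; apply/seteqP; split=> w /eqP.
  move=> w /= h; have [h1|h1] := eqVneq (\det (aug_mx k.+1 (fun i => X (a i) w))) 0; first by left.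
  by right.
- exact: measurable_minor.
- apply: measurableI; last exact: measurable_minor.
  by have := measurableC (measurable_minor k.+1 a); congr measurable; apply/seteqP; split=> w /eqP.
Qed.

(** The uncountably many hyperplanes reduce to finitely many determinants, one for each injective
    choice of p + 1 indices. *)
Lemma general_position n : exists Bad : set T, [/\ measurable Bad, P Bad = 0%E &
  forall w, ~ Bad w -> forall (v : 'rV[R]_p) (b : R), v != 0 ->
    (#|finset (fun i : 'I_n => dotv v (X i w) == b)| <= p)%N].
Proof.
pose B (f : {ffun 'I_p.+1 -> 'I_n}) : set T := if injectiveb f then
  [set w | \det (aug_mx p.+1 (fun i => X (f (inord i)) w)) = 0] else set0.
have mB f : measurable (B f).
  by rewrite /B; case: ifP => // _; exact: (measurable_minor p.+1 (fun i => f (inord i))).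
exists (\bigcup_(f in [set` enum {ffun 'I_p.+1 -> 'I_n}]) B f); split.
- by apply: fin_bigcup_measurable => // f _; exact: finite_seq.
- apply/eqP; rewrite -measure_le0; apply: le_trans (measure_bigcup_seq_le P _ mB) _.
  rewrite big1// => f _; rewrite /B; case: ifP => // /injectiveP finj.
  apply: (@minor_neq0 p (fun i => f (inord i))) => // i j; rewrite !inE => ip jp /val_inj /finj.
  by move=> /(congr1 val); rewrite /= !inordK.
- move=> w nB v b v0; apply: card_on_hyperplane v0 _ => a inj.
  apply/eqP => h; apply: nB; exists [ffun i : 'I_p.+1 => a i]; first by rewrite /= mem_enum.
  rewrite /B; case: ifPn => [_|/injectiveP[]].
    rewrite /= -[RHS]h; congr (\det _); apply: aug_mx_eq => i ip.
    by rewrite ffunE inordK.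
  by move=> i j; rewrite !ffunE => /inj ij; apply: val_inj; apply: ij; rewrite inE.
Qed.

End GeneralPosition.

(** * Asymptotics and consistency *)

Section Scales.
Context {R : realType}.

(** The integer [q] of the bounds: of order ln n, with n < 2^q. *)
Definition bits (n : nat) : nat := (trunc_log 2 n).+1.

Lemma bits_bounds n : (1 < n)%N ->
  [/\ (0 < n < 2 ^ bits n)%N, ln n%:R <= (bits n)%:R :> R & (bits n)%:R <= 4 * ln n%:R :> R].
Proof.
move=> n1; have n0 : (0 < n)%N by exact: ltnW.
have /andP[lo hi] := trunc_log_bounds (erefl : (1 < 2)%N) n0.
have ln2a : 1 / 2 <= ln 2 :> R.
  rewrite -[leLHS]expRK ler_ln ?posrE ?expR_gt0//.
  have := @expR_le_quadratic R (1 / 2) (lexx _); lra.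
have ln2b : ln 2 <= 1 :> R.
  rewrite -[leRHS]expRK ler_ln ?posrE ?expR_gt0//; have := expR_ge1Dx (1 : R); lra.
have up : ln n%:R <= (bits n)%:R :> R.
  apply: (@le_trans _ _ (ln (2 ^+ bits n))).
    by rewrite ler_ln ?posrE ?ltr0n ?exprn_gt0// -natrX ler_nat ltnW.
  by rewrite lnXn// -[leLHS]mulr_natl ler_piMr.
have dn : (trunc_log 2 n)%:R * (1 / 2) <= ln n%:R :> R.
  apply: (@le_trans _ _ (ln (2 ^+ trunc_log 2 n))); last first.
    by rewrite ler_ln ?posrE ?ltr0n ?exprn_gt0// -natrX ler_nat.
  by rewrite lnXn// -[leRHS]mulr_natl ler_wpM2l.
split=> //; first by rewrite n0 hi.
have t1 : 1 <= (trunc_log 2 n)%:R :> R by rewrite ler1n trunc_log_gt0 n1.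
by rewrite /bits -natr1; lra.
Qed.

Lemma exp_beats_power (C : R) (k : nat) : exists M, forall x, M <= x -> C * x ^+ k <= expR x.
Proof.
exists (Num.max 1 (`|C| * (k.+1)`!%:R)) => x; rewrite ge_max => /andP[x1 xC].
have x0 : 0 <= x by lra.
have f0 : 0 < (k.+1)`!%:R :> R by rewrite ltr0n fact_gt0.
apply: (@le_trans _ _ (x ^+ k.+1 / (k.+1)`!%:R)); last first.
  by have := expR_ge1Dxn k x0; lra.
rewrite ler_pdivlMr// exprS mulrAC; apply: le_trans (_ : `|C| * (k.+1)`!%:R * x ^+ k <= _).
  by rewrite ler_wpM2r ?exprn_ge0// ler_wpM2r ?(ltW f0)// ler_norm.
by rewrite ler_wpM2r ?exprn_ge0.
Qed.

Lemma near_ln_ge (M : R) : \forall n \near \oo, M <= ln n%:R :> R.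
Proof.
near=> n; rewrite -[leLHS]expRK ler_ln ?posrE ?expR_gt0//.
  by near: n; exact: nbhs_infty_ger.
by rewrite ltr0n; near: n; exact: nbhs_infty_gt.
Unshelve. all: by end_near.
Qed.

Lemma near_lnln_ge (M : R) : \forall n \near \oo, M <= ln (ln n%:R) :> R.
Proof.
near=> n; rewrite -[leLHS]expRK; have h : expR M <= ln n%:R :> R by near: n; exact: near_ln_ge.
by rewrite ler_ln ?posrE ?expR_gt0// (lt_le_trans _ h)// expR_gt0.
Unshelve. all: by end_near.
Qed.

Lemma near_bits_power (C : R) (k : nat) : \forall n \near \oo, C * (bits n)%:R ^+ k <= n%:R.
Proof.
have [M hM] := exp_beats_power (`|C| * 4 ^+ k) k.
near=> n; have n1 : (1 < n)%N by near: n; exact: nbhs_infty_gt.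
have [_ _ b4] := bits_bounds n1.
apply: (@le_trans _ _ (`|C| * 4 ^+ k * ln n%:R ^+ k)).
  rewrite -mulrA -exprMn; apply: (@le_trans _ _ (`|C| * (bits n)%:R ^+ k)).
    by rewrite ler_wpM2r ?exprn_ge0// ler_norm.
  rewrite ler_wpM2l// lerXn2r ?nnegrE//; by rewrite mulr_ge0// ln_ge0// ler1n ltnW.
rewrite -[leRHS]lnK ?posrE ?ltr0n ?(ltnW n1)//; apply: hM.
by near: n; exact: near_ln_ge.
Unshelve. all: by end_near.
Qed.

Lemma near_bits_ge (M : R) : \forall n \near \oo, M <= (bits n)%:R.
Proof.
near=> n; have n1 : (1 < n)%N by near: n; exact: nbhs_infty_gt.
have [_ b4 _] := bits_bounds n1; apply: le_trans b4.
by near: n; exact: near_ln_ge.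
Unshelve. all: by end_near.
Qed.

(** Polynomials in ln ln n are negligible against ln n; this pays for the packing term of
    [few_separators] at the scale tau = ln ln n. *)
Lemma near_lnln_power (C c : R) (k : nat) : 0 <= c ->
  \forall n \near \oo, C * ln (ln n%:R) + ln (ln n%:R) * (c * ln (ln n%:R) + 1) ^+ k <= ln n%:R :> R.
Proof.
move=> c0; have [M hM] := exp_beats_power (`|C| + (c + 1) ^+ k) k.+1.
near=> n; have x1 : 1 <= ln (ln n%:R) :> R by near: n; exact: near_lnln_ge.
have xM : M <= ln (ln n%:R) by near: n; exact: near_lnln_ge.
have l1 : 1 <= ln n%:R :> R by near: n; exact: near_ln_ge.
move: x1 xM; set x := ln (ln n%:R) => x1 xM.
have -> : ln n%:R = expR x by rewrite lnK// posrE; lra.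
apply: le_trans (hM x xM).
rewrite mulrDl lerD//.
  apply: (@le_trans _ _ (`|C| * x)); first by rewrite ler_wpM2r ?ler_norm//; lra.
  by rewrite ler_wpM2l// exprS ler_peMr ?exprn_ege1//; lra.
have h : (c * x + 1) ^+ k <= ((c + 1) * x) ^+ k.
  by apply: lerXn2r; rewrite ?nnegrE; nra.
rewrite exprMn in h; have -> : (c + 1) ^+ k * x ^+ k.+1 = x * ((c + 1) ^+ k * x ^+ k) by rewrite exprS; ring.
by apply: ler_wpM2l h; lra.
Unshelve. all: by end_near.
Qed.

End Scales.

(** * Entropy and noise against the lower bound of A5 *)

Section Budget.
Context {R : realType}.
Local Notation ent p q := (@entropy R p q).
Local Notation ent2 p q := (@entropy2 R p q).
Local Notation CE p D := (27 * p.+1%:R * (1 + D) + 4).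

(** Here [S2] stands for the squared diameter times the count of a cell. A halfspace costs ln q <= 3
    tau. Thin neighbours number at most D S2 / (t tau^2), which leaves a power of tau to spare; the
    other terms of [F] cost at most [ell], absorbed by [t * ell <= S2]. In the constant, 27 = 9 * 3,
    and 4 comes from q <= 4 ell. *)
Lemma entropy_scaled (p q : nat) (D c1 t tau ell : R) (F : nat) (S2 : R) :
  0 < D -> 0 < t -> 1 <= tau -> tau = ln ell -> 1 <= ell -> (0 < q)%N -> q%:R <= 4 * ell ->
  (2 * p + 1)%:R * tau + tau * (c1 * tau + 1) ^+ p <= ell -> 0 <= S2 -> t * ell <= S2 ->
  F%:R <= (2 * p + 1)%:R + D * S2 / (t * tau ^+ 2) + (c1 * tau + 1) ^+ p ->
  ent p q F <= CE p D * S2 / t.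
Proof.
move=> D0 t0 tau1 tauE ell1 q0 q_le power_le S0 tS hF.
have tau0 : 0 < tau by exact: lt_le_trans tau1.
have ell0 : 0 < ell by exact: lt_le_trans ell1.
have lnq : ln q%:R <= 3 * tau.
  apply: (@le_trans _ _ (ln (4 * ell))); first by rewrite ler_ln ?posrE ?ltr0n// mulr_gt0.
  rewrite lnM ?posrE//.
  rewrite -tauE; suff : ln 4 <= 2 :> R by lra.
  rewrite -[leRHS]expRK ler_ln ?posrE ?expR_gt0//.
  have h := expR_ge1Dx (1 : R); have -> : (2 : R) = 1 + 1 by ring.
  by rewrite expRD; nra.
have Ftau : F%:R * tau <= ell + D * S2 / t.
  apply: le_trans (ler_wpM2r (ltW tau0) hF) _.
  have -> : ((2 * p + 1)%:R + D * S2 / (t * tau ^+ 2) + (c1 * tau + 1) ^+ p) * tau =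
     ((2 * p + 1)%:R * tau + tau * (c1 * tau + 1) ^+ p) + D * S2 / t / tau.
    by field; rewrite !lt0r_neq0.
  apply: lerD => //; rewrite ler_pdivrMr// ler_peMr// divr_ge0 ?mulr_ge0// ltW//.
have St : ell <= S2 / t by rewrite ler_pdivlMr// mulrC.
rewrite /entropy natrM.
have p0 : 0 <= p.+1%:R :> R by [].
have -> : (9 * p.+1)%:R * F%:R * ln q%:R = 9 * p.+1%:R * (F%:R * ln q%:R) :> R by rewrite natrM; ring.
have h1 : F%:R * ln q%:R <= 3 * (ell + D * S2 / t).
  by apply: le_trans (ler_wpM2l (ler0n _ F) lnq) _; lra.
have h2 : 9 * p.+1%:R * (F%:R * ln q%:R) <= 9 * p.+1%:R * (3 * (ell + D * S2 / t)).
  by rewrite ler_wpM2l// mulr_ge0.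
have h3 : p.+1%:R * ell <= p.+1%:R * (S2 / t) by rewrite ler_wpM2l.
have -> : CE p D * S2 / t = 27 * (p.+1%:R * (S2 / t)) + 27 * (p.+1%:R * (D * S2 / t)) + 4 * (S2 / t).
  by ring.
by lra.
Qed.

(** Both terms are kept below half of del C dA / (K + 2). In the first, everything but 4 N is
    bounded by multiples of n / q <= D C, and [E1] is at most proportional to dA^2 C / t, so a large
    [t] suffices. In the second, q^3 times n / q^4 is again n / q. *)
Lemma noise_budget (p q n : nat) (D K t ell : R) (F : nat) (E1 N C dA del del' : R) :
  0 < D -> 0 <= K -> 0 < t -> 1 <= ell -> ell <= q%:R ->
  (112 * p.+2 * q ^ 4)%:R <= n%:R :> R -> (16 <= q)%N -> (F <= q ^ 2)%N ->
  0 < C -> 0 <= N <= C -> 0 < dA -> 0 < del -> t * ell <= dA ^+ 2 * C ->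
  E1 = ent p q F -> E1 <= CE p D * (dA ^+ 2 * C) / t -> n%:R <= D * ell * C ->
  del' = (del / (2 * (K + 2))) ^+ 2 -> 4 * (1 + D) * CE p D / t <= del' -> 18 * p.+2%:R * D <= del' * t ->
  (K + 2) * (Num.sqrt (E1 * (4 * N + 16 * (n%:R / q%:R ^+ 4) + 32 * ent2 p q + 8 * E1 + n%:R / q%:R))
    + 3 * Num.sqrt (ent2 p q * (n%:R / q%:R ^+ 4 + n%:R / q%:R ^+ 4))) <= del * C * dA.
Proof.
move=> D0 K0 t0 ell1 le_q n_large q16 Fq C0 /andP[N0 NC] dA0 del0 tS E1E E1S nC del'E h1 h2.
have qR : 16 <= q%:R :> R by rewrite ler_nat.
have qR0 : 0 < q%:R :> R by lra.
set S2 := dA ^+ 2 * C in tS E1S; have S20 : 0 < S2 by rewrite mulr_gt0 ?exprn_gt0.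
set B := Num.sqrt (del' * (S2 * C)).
have BE : B = del / (2 * (K + 2)) * (C * dA).
  rewrite /B del'E (_ : S2 * C = (C * dA) ^+ 2); last by rewrite /S2; ring.
  have K2 : 0 <= 2 * (K + 2) by lra.
  rewrite -exprMn sqrtr_sqr ger0_norm//; apply: mulr_ge0; first exact: divr_ge0 (ltW del0) K2.
  by apply: mulr_ge0; exact: ltW.
have nq : n%:R / q%:R <= D * C.
  rewrite ler_pdivrMr//; apply: le_trans nC _.
  by rewrite -mulrA (mulrC ell) mulrA ler_wpM2l// mulr_ge0 ?ltW.
have E10 : 0 <= E1.
  by rewrite E1E /entropy addr_ge0 ?mulr_ge0 ?ln_ge0//; lra.
have E1q : E1 <= 10 * p.+2%:R * q%:R ^+ 3.
  rewrite E1E /entropy.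
  have lnqq : ln q%:R <= q%:R :> R by have := @le_ln1Dx R (q%:R - 1); rewrite addrCA subrr addr0; lra.
  have Fq' : (9 * p.+1 * F)%:R <= 9 * p.+2%:R * q%:R ^+ 2 :> R.
    by rewrite -natrX -!natrM ler_nat leq_mul// leq_mul.
  have lnq0 : 0 <= ln q%:R :> R by apply: ln_ge0; lra.
  have := ler_pM (ler0n R _) lnq0 Fq' lnqq.
  have -> : 9 * p.+2%:R * q%:R ^+ 2 * q%:R = 9 * (p.+2%:R * q%:R ^+ 3) :> R by ring.
  have : q%:R <= p.+2%:R * q%:R ^+ 3 :> R.
    rewrite -natrX -natrM ler_nat (leq_trans (_ : _ <= q ^ 3)%N)//; last by rewrite leq_pmull.
    by rewrite -{1}(expn1 q) leq_exp2l // (leq_trans _ q16).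
  by lra.
(* 112 = 32 + 8 * 10 collects [32 * entropy2] and [8 * E1], both at most of order q^3. *)
have n4 : 112 * p.+2%:R * q%:R ^+ 3 <= n%:R / q%:R :> R.
  rewrite ler_pdivlMr//; apply: le_trans n_large.
  by rewrite natrM natrX natrM le_eqVlt; apply/orP; left; apply/eqP; ring.
have n16 : 16 * (n%:R / q%:R ^+ 4) <= n%:R / q%:R :> R.
  have -> : 16 * (n%:R / q%:R ^+ 4) = n%:R / q%:R * (16 / q%:R ^+ 3) :> R.
    by field; rewrite lt0r_neq0.
  rewrite ler_piMr ?divr_ge0// ler_pdivrMr ?exprn_gt0// mul1r.
  by apply: le_trans qR _; rewrite exprS ler_peMr ?exprn_ege1//; lra.
have e2 : ent2 p q = p.+2%:R * q%:R ^+ 3 :> R by rewrite /entropy2 natrM natrX.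
have pE0 : 0 <= p.+2%:R * q%:R ^+ 3 :> R by rewrite mulr_ge0// exprn_ge0.
have s1 : Num.sqrt (E1 * (4 * N + 16 * (n%:R / q%:R ^+ 4) + 32 * ent2 p q + 8 * E1 + n%:R / q%:R)) <= B.
  rewrite ler_wsqrtr//; apply: (@le_trans _ _ (E1 * (4 * (1 + D) * C))).
    by rewrite ler_wpM2l// e2; lra.
  apply: (@le_trans _ _ (CE p D * S2 / t * (4 * (1 + D) * C))).
    by rewrite ler_wpM2r// !mulr_ge0 ?(ltW C0)//; lra.
  have -> : CE p D * S2 / t * (4 * (1 + D) * C) = (4 * (1 + D) * CE p D / t) * (S2 * C) by ring.
  by apply: ler_wpM2r => //; apply: mulr_ge0; exact: ltW.
have s2 : 3 * Num.sqrt (ent2 p q * (n%:R / q%:R ^+ 4 + n%:R / q%:R ^+ 4)) <= B.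
  have -> : 3 = Num.sqrt (3 ^+ 2) :> R by rewrite sqrtr_sqr ger0_norm.
  rewrite -sqrtrM ?sqr_ge0// ler_wsqrtr// e2.
  have -> : 3 ^+ 2 * (p.+2%:R * q%:R ^+ 3 * (n%:R / q%:R ^+ 4 + n%:R / q%:R ^+ 4)) =
      18 * p.+2%:R * (n%:R / q%:R) :> R by field; rewrite lt0r_neq0.
  apply: (@le_trans _ _ (18 * p.+2%:R * (D * C))); first by rewrite ler_wpM2l// mulr_ge0.
  rewrite (mulrA _ D) [leRHS]mulrA ler_wpM2r ?(ltW C0)//; apply: le_trans h2 _.
  rewrite ler_wpM2l//; first by rewrite del'E sqr_ge0.
  by apply: le_trans tS; apply: ler_peMr => //; exact: ltW.
apply: (@le_trans _ _ ((K + 2) * (B + B))); first by rewrite ler_wpM2l ?addr_ge0// lerD.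
by rewrite BE le_eqVlt; apply/orP; left; apply/eqP; field; apply/lt0r_neq0; lra.
Qed.

End Budget.

(** * Deterministic bounds for one bagged sample *)

Section Sample.
Context {R : realType} {p : nat}.

(** Lowering the level to the largest value below [b] makes the halfspace open without changing its
    trace; the default [b - 1] serves when there is no such value. *)
Lemma closed_trace (I : finType) (x : I -> 'rV[R]_p) (v : 'rV[R]_p) (b : R) :
  finset (fun a => b <= dotv v (x a)) \in traces x.
Proof.
apply/tracesP; exists v, (\big[Num.max/b - 1]_(a | dotv v (x a) < b) dotv v (x a)) => a.
rewrite finset.in_set; apply/idP/idP => [h|].
  by apply: lt_le_trans h; apply: bigmax_lt => //; rewrite ltrBlDr ltrDl.
by rewrite leNgt; apply: contraL => h; rewrite -leNgt; exact: le_bigmax_cond.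
Qed.

Lemma regular_cells n (z : dataset R p n) (XX : set 'rV[R]_p) As (c t eta Delta : R) :
  (forall u v, XX u -> XX v -> norm2 (u - v) <= Delta) -> (forall A, A \in As -> A `<=` XX) ->
  0 < ln n%:R :> R -> 0 <= t -> max_diameter As <= eta -> c <= min_lambda z As ->
  t < min_scaled_size z As ->
  forall A, A \in As -> [/\ (0 < #|obs z A|)%N, 0 < diameter A, diameter A <= eta,
    c <= lambda_cell z A & t * ln n%:R <= diameter A ^+ 2 * #|obs z A|%:R].
Proof.
move=> bX sub ell0 t0 diam_le lambda_ge size_ge A AAs.
have [k ks AE] : exists2 k, (k < size As)%N & A = nth set0 As k.
  by exists (index A As); rewrite ?index_mem ?nth_index.
have h1 := le_trans (seq_max_ge set0 diameter ks) diam_le.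
have h2 := le_trans lambda_ge (seq_min_le set0 (lambda_cell z) ks).
have h3 := lt_le_trans size_ge (seq_min_le set0 (fun A => diameter A ^+ 2 * #|obs z A|%:R / ln n%:R) ks).
rewrite -AE in h1 h2 h3.
have h4 : t * ln n%:R < diameter A ^+ 2 * #|obs z A|%:R by rewrite -ltr_pdivlMr.
have h5 : 0 < diameter A ^+ 2 * #|obs z A|%:R by apply: le_lt_trans h4; apply: mulr_ge0 => //; exact: ltW.
have C0 : (0 < #|obs z A|)%N.
  by rewrite lt0n; apply: contraTN h5 => /eqP ->; rewrite mulr0n mulr0 ltxx.
split=> //; last exact: ltW.
rewrite lt0r; apply/andP; split.
  by apply: contraTN h5 => /eqP ->; rewrite expr0n mul0r ltxx.
have /card_gt0P[i] := C0; rewrite inE => /asboolP iA.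
apply: le_trans (norm2_ge0 ((z i).1 - (z i).1)) _; apply: (@diameter_ge _ _ A Delta) => //.
by move=> u v /(sub A AAs) Xu /(sub A AAs); exact: bX.
Qed.

Variables (XX : set 'rV[R]_p) (f : 'rV[R]_p -> R) (g : 'rV[R]_p -> 'rV[R]_p) (ls : solver R p).
Variables (L : nat) (a : 'I_L -> R) (D : R) (tb : seq nat -> nat)
  (crit : forall n, dataset R p n -> seq (set 'rV[R]_p) -> R).
Hypothesis htb : forall s, s != [::] -> tb s \in s.
Variables (n : nat) (j : {ffun 'I_n -> 'I_n}) (x : 'I_n -> 'rV[R]_p) (y : 'I_n -> R).
Let z : dataset R p n := fun i => (x (j i), y (j i)).
Variable As : seq (set 'rV[R]_p).
Variables (q : nat) (K c t eta ups del del' Delta : R).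
Let ell : R := ln n%:R.
Let tau : R := ln ell.
Hypothesis hls : least_squares_solver ls.
Hypothesis cvx : convex_set XX.
Hypothesis tang : forall u v, XX u -> XX v -> f u + dotv (g u) (v - u) <= f v.
Hypothesis ug : forall u v, XX u -> XX v -> norm2 (v - u) <= eta -> norm2 (g v - g u) <= ups.
Hypothesis bX : forall u v, XX u -> XX v -> norm2 (u - v) <= Delta.
Hypothesis xX : forall a, XX (x a).
Hypotheses (D0 : 0 < D) (K0 : 0 <= K) (t0 : 0 < t) (c0 : 0 < c) (ups0 : 0 <= ups) (del0 : 0 < del).
Hypotheses (n0 : (0 < n)%N) (tau1 : 1 <= tau) (ell1 : 1 <= ell) (Dell1 : 1 <= D * ell).
Hypotheses (q_le : q%:R <= 4 * ell) (le_q : ell <= q%:R) (q16 : (16 <= q)%N).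
Hypothesis power_le :
  (2 * p + 1)%:R * tau + tau * (2 * (Num.sqrt p%:R + 1) / c * tau + 1) ^+ p <= ell.
Hypothesis n_large : (112 * p.+2 * q ^ 4)%:R <= n%:R :> R.
Hypothesis size_ok : forall k : nat, k%:R <= D * ell -> (2 * p + k < q ^ 2)%N.
Hypothesis count_small : forall V : {set 'I_n}, (#|V| <= p * q ^ 2)%N ->
  #|finset (fun i => j i \in V)|%:R < @nmin R p D n.
Hypothesis gp : forall (v : 'rV[R]_p) (b : R), v != 0 ->
  (#|finset (fun a => dotv v (x a) == b)| <= p)%N.
Hypothesis noise : forall s : seq {set 'I_n}, (0 < size s <= q ^ 2)%N -> {subset s <= traces x} ->
  forall V : {set 'I_n}, (#|V| <= p * q ^ 2)%N ->
    `|\sum_(i | j i \in seq_meet s :\: V) (y (j i) - f (x (j i)))| <= (K + 2) *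
      (Num.sqrt (@entropy R p q (size s) * (4 * #|finset (fun i => j i \in seq_meet s :\: V)|%:R
          + 16 * (n%:R / q%:R ^+ 4) + 32 * @entropy2 R p q + 8 * @entropy R p q (size s) + n%:R / q%:R))
       + 3 * Num.sqrt (@entropy2 R p q * (n%:R / q%:R ^+ 4 + n%:R / q%:R ^+ 4))).
Hypothesis part : cap_partition XX a D ls tb crit z As.
Hypothesis diam_le : max_diameter As <= eta.
Hypothesis lambda_ge : c <= min_lambda z As.
Hypothesis size_ge : t < min_scaled_size z As.
Hypothesis del'E : del' = (del / (2 * (K + 2))) ^+ 2.
Hypothesis tune1 : 4 * (1 + D) * (27 * p.+1%:R * (1 + D) + 4) / t <= del'.
Hypothesis tune2 : 18 * p.+2%:R * D <= del' * t.

Let ell0 : 0 < ell. Proof. exact: lt_le_trans ell1. Qed.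

Lemma card_on_hyperplanes (G : seq ('rV[R]_p * R)) : (forall h, h \in G -> h.1 != 0) ->
  (#|finset (fun a => has (fun h => dotv h.1 (x a) == h.2) G)| <= p * size G)%N.
Proof.
elim: G => [|h G IH] hG.
  by rewrite muln0 leqn0 cards_eq0; apply/eqP/setP => i; rewrite !inE.
have -> : finset (fun a => has (fun h => dotv h.1 (x a) == h.2) (h :: G)) =
    finset (fun a => dotv h.1 (x a) == h.2) :|: finset (fun a => has (fun h => dotv h.1 (x a) == h.2) G).
  by apply/setP => i; rewrite finset.in_setU !finset.in_set.
rewrite (leq_trans (leq_card_setU _ _))//= mulnS leq_add ?gp ?hG ?mem_head// IH// => h' h'G.
by rewrite hG// inE h'G orbT.
Qed.

Let nmin_ge : n%:R / (D * ell) <= @nmin R p D n.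
Proof. by rewrite /nmin le_max lexx. Qed.

Let few_ok (k : nat) : k%:R * @nmin R p D n <= n%:R -> k%:R <= D * ell.
Proof.
move=> h; have n0R : 0 < n%:R :> R by rewrite ltr0n.
have De : 0 < D * ell by exact: mulr_gt0.
have := le_trans (ler_wpM2l (ler0n _ k) nmin_ge) h.
by rewrite mulrCA ger_pMr// ler_pdivrMr// mul1r.
Qed.

(** General position limits the data points on each hyperplane to [p]; since a bag may repeat a
    point, the number of observations requires [count_small] in addition. *)
Lemma sample_few : few_on_hyperplanes D z.
Proof.
move=> s /allP s0 sn; set V := finset (fun a => has (fun h => dotv h.1 (x a) == h.2) s).
have -> : finset (fun i => has (fun h => dotv h.1 (z i).1 == h.2) s) = finset (fun i => j i \in V).
  by apply/setP => i; rewrite !finset.in_set.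
apply: count_small; apply: (leq_trans (card_on_hyperplanes s0)).
rewrite leq_mul2l; apply/orP; right; apply: leq_trans (ltnW (size_ok (few_ok sn))).
exact: leq_addl.
Qed.

Lemma sample_partition : separated_partition XX As /\ (size As)%:R <= D * ell /\
  forall A, A \in As -> n%:R <= D * ell * #|obs z A|%:R.
Proof.
have De : 0 < D * ell by exact: mulr_gt0.
have [sep [E|lc]] := cap_partition_separated htb sample_few part.
  split=> //; rewrite E; split=> // A; rewrite inE => /eqP ->.
  have -> : obs z XX = [set: 'I_n]%SET by apply/setP => i; rewrite !inE; apply/asboolP; exact: xX.
  by rewrite cardsT card_ord ler_peMl.
have [_ _ pw] := sep; split=> //; split; first exact: few_ok (size_large_cells pw lc).
move=> A AAs; rewrite mulrC -ler_pdivrMr//; apply: le_trans nmin_ge _.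
by move/allP: lc; apply.
Qed.

Lemma sample_cells A : A \in As -> [/\ (0 < #|obs z A|)%N, 0 < diameter A, diameter A <= eta,
  c <= lambda_cell z A & t * ell <= diameter A ^+ 2 * #|obs z A|%:R].
Proof.
have [[_ sub _] _] := sample_partition.
exact: (regular_cells bX sub ell0 (ltW t0) diam_le lambda_ge size_ge).
Qed.

(** The part of a cell beyond a hyperplane is cut out by the separators of the cell and one more
    halfspace, which explains 2 p + 1 in the entropy bound. The closed separating halfspaces may
    also retain boundary observations of other cells; these are removed as [V]. *)
Lemma sample_noise A (v : 'rV[R]_p) (b : R) : A \in As ->
  `|\sum_(i in obs z A | b < dotv v (z i).1) ((z i).2 - f (z i).1)| <=
    del * #|obs z A|%:R * diameter A.
Proof.
move=> AAs; have [C0 d0 deta lam heavy] := sample_cells AAs.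
have [sep [sAs nC]] := sample_partition.
have zX i : XX (z i).1 by exact: xX.
have [G [[sG1 sG2] Gn Gin Gout]] := few_separators c0 t0 ell0 bX sep zX
  (fun A AAs => let: And5 h _ _ _ _ := sample_cells AAs in h)
  (fun A AAs => let: And5 _ h _ _ _ := sample_cells AAs in h)
  (fun A AAs => let: And5 _ _ _ h _ := sample_cells AAs in h)
  (fun A AAs => let: And5 _ _ _ _ h := sample_cells AAs in h) AAs tau1.
pose s : seq {set 'I_n} := finset (fun a => b < dotv v (x a)) ::
  [seq finset (fun a => h.2 <= dotv h.1 (x a)) | h <- G].
pose V := finset (fun a => has (fun h => dotv h.1 (x a) == h.2) G && ~~ `[< A (x a) >]).
have size_s : size s = (size G).+1 by rewrite /= size_map.
have sq : (size s <= q ^ 2)%N.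
  by rewrite size_s (leq_ltn_trans sG1)// size_ok.
have cV : (#|V| <= p * q ^ 2)%N.
  apply: (leq_trans (_ : _ <= p * size G)%N); last first.
    by rewrite leq_mul2l; apply/orP; right; apply: leq_trans sq; rewrite size_s.
  apply: leq_trans (card_on_hyperplanes Gn); apply/subset_leq_card/fintype.subsetP => k.
  by rewrite !finset.in_set => /andP[].
have sT : {subset s <= traces x}.
  move=> S; rewrite inE => /orP[/eqP ->|/mapP[h _ ->]]; last exact: closed_trace.
  by apply/tracesP; exists v, b => k; rewrite finset.in_set.
have memE i : (j i \in seq_meet s :\: V) = (i \in obs z A) && (b < dotv v (z i).1).
  have mV : (j i \in V) = has (fun h => dotv h.1 (x (j i)) == h.2) G && ~~ `[< A (x (j i)) >].
    by rewrite finset.in_set.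
  have mS : (j i \in seq_meet s) = (b < dotv v (x (j i))) && all (fun h => h.2 <= dotv h.1 (x (j i))) G.
    rewrite finset.in_set /= finset.in_set all_map; congr (_ && _).
    by apply: eq_all => h; rewrite /= finset.in_set.
  have mA : (i \in obs z A) = `[< A (x (j i)) >] by rewrite finset.in_set.
  rewrite finset.in_setD mV mS; apply/idP/idP.
    rewrite negb_and negbK => /andP[nhA /andP[hb /allP hG]]; rewrite hb andbT.
    have [//|[h hGh hE]] := Gout i hG; move: nhA => /orP[/hasPn /(_ h hGh)|]; last by rewrite mA.
    by rewrite hE eqxx.
  move=> /andP[iA hb]; rewrite hb -mA iA andbF /=; apply/allP => h hG; exact: Gin.
have := noise (s := s) _ sT cV; rewrite sq => /(_ isT).
have -> : \sum_(i | j i \in seq_meet s :\: V) (y (j i) - f (x (j i))) =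
    \sum_(i in obs z A | b < dotv v (z i).1) ((z i).2 - f (z i).1).
  by apply: eq_bigl => i; rewrite memE.
move=> /le_trans; apply.
apply: (@noise_budget R p q n D K t ell (size s) _ _ #|obs z A|%:R (diameter A) del del') => //.
- by rewrite ltr0n.
- rewrite ler0n ler_nat subset_leq_card//; apply/fintype.subsetP => i.
  by rewrite finset.in_set memE => /andP[].
- apply: (@entropy_scaled R p q D (2 * (Num.sqrt p%:R + 1) / c) t tau ell) => //.
  + exact: leq_trans q16.
  + by rewrite mulr_ge0// exprn_ge0// ltW.
  + rewrite size_s -natr1.
    have E1 : (2 * p + 1)%:R = 2 * p%:R + 1 :> R by rewrite natrD natrM.
    have E2 : 2 * (Num.sqrt p%:R + 1) * tau / c = 2 * (Num.sqrt p%:R + 1) / c * tau by ring.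
    have tau0 : 0 < tau by exact: lt_le_trans tau1.
    have E3 : n%:R * diameter A ^+ 2 / (t * ell * tau ^+ 2) <=
        D * (diameter A ^+ 2 * #|obs z A|%:R) / (t * tau ^+ 2).
      rewrite ler_pdivrMr ?mulr_gt0 ?exprn_gt0//.
      have -> : D * (diameter A ^+ 2 * #|obs z A|%:R) / (t * tau ^+ 2) * (t * ell * tau ^+ 2) =
          D * ell * #|obs z A|%:R * diameter A ^+ 2 by field; rewrite !lt0r_neq0.
      by rewrite ler_wpM2r ?sqr_ge0// nC.
    rewrite E2 in sG2; rewrite E1; move: sG2 E3; lra.
- exact: nC.
Qed.

Lemma sample_close u : XX u -> `|cap_fun ls z As u - f u| <=
  (2 * ups + del) * eta + (ups + 4 * Num.sqrt p%:R * del) / c * (Delta + eta).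
Proof.
have [[cov sub _] _] := sample_partition.
apply: (cap_fun_close hls cvx tang ug bX c0 ups0 (ltW del0) cov sub) => A AAs.
have [C0 d0 deta lam _] := sample_cells AAs; split=> // T [->|[k [b ->]]].
  (* [v = 0] at level -1 selects the whole cell. *)
  have := sample_noise 0 (-1) AAs; congr (`| _ | <= _).
  by apply: eq_bigl => i; rewrite dotv0l ltrN10.
have := sample_noise (delta_mx ord0 k) b AAs; congr (`| _ | <= _).
by apply: eq_bigl => i; rewrite dotv_delta.
Qed.

End Sample.

Section TruncationEvent.
Context {R : realType} {p : nat} {d : measure_display} {T : measurableType d}.
Variables (P : probability T R) (XX : set 'rV[R]_p) (f0 : 'rV[R]_p -> R).
Variables (X : nat -> T -> 'rV[R]_p) (Y : nat -> T -> R).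
Hypothesis hX : forall i w, XX (X i w).
Hypothesis hiid : iid P (fun i w => (X i w, Y i w)).
Hypothesis hf0 : cond_expectation P XX (X 0%N) (EFin \o Y 0%N) (EFin \o f0).
Hypothesis cXX : closed XX.
Variables (c : R) (h : 'rV[R]_p -> \bar R) (B : R).
Hypotheses (c0 : 0 < c) (B0 : 0 <= B).
Hypothesis hexp : cond_expectation P XX (X 0%N)
  (fun w => (expR (c * `|Y 0%N w - f0 (X 0%N w)|))%:E) h.
Hypothesis hB : forall x, XX x -> (h x <= B%:E)%E.

Let meps i : measurable_fun setT (eps f0 X Y i).
Proof. exact: measurable_eps hX hiid hf0 cXX i. Qed.

Lemma measurable_eps_gt i (b : R) : measurable [set w | b < `|eps f0 X Y i w|].
Proof.
have m : measurable_fun setT (fun w => `|eps f0 X Y i w|) by apply: measurableT_comp.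
have := measurable_fun_ltr (@measurable_cst _ _ T R setT b) m.
by move=> /(_ measurableT [set true] I); rewrite setTI.
Qed.

Lemma eps_tail i (b : R) : (P [set w | (b < `|eps f0 X Y i w|)%R] <= (B * expR (- (c * b)))%:E)%E.
Proof.
have -> : P [set w | b < `|eps f0 X Y i w|] = P [set w | b < `|eps f0 X Y 0 w|].
  have mr := measurable_residual hf0 cXX.
  have mr' : measurable_fun setT (fun z => `|residual XX f0 z|) by apply: measurableT_comp.
  have mB : measurable [set z | b < `|residual XX f0 z|].
    have := measurable_fun_ltr (@measurable_cst _ _ _ R setT b) mr'.
    by move=> /(_ measurableT [set true] I); rewrite setTI.
  have E k : [set w | b < `|eps f0 X Y k w|] = XY X Y k @^-1` [set z | b < `|residual XX f0 z|].
    by apply/seteqP; split=> w /=; rewrite (residualE f0 Y hX).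
  by rewrite !E; case: hiid => _ + _; apply.
set A := [set w | _]; have mA : measurable A by exact: measurable_eps_gt.
have := exp_moment_le hX hiid cXX B0 hexp hB measurableT.
rewrite preimage_setT probability_setT mule1 => hm.
have : (\int[P]_w ((expR (c * b))%:E * (\1_A w)%:E) <= B%:E)%E.
  apply: le_trans hm; apply: ge0_le_integral => //.
  - by apply/measurable_EFinP; apply: measurable_funM => //; exact: measurable_indic.
  - apply/measurable_EFinP; apply: measurableT_comp => //; apply: measurable_funM => //.
    exact: measurableT_comp.
  - move=> w _; rewrite -EFinM lee_fin indicE; have [wA|_] := boolP (w \in A); last by rewrite mulr0 expR_ge0.
    by rewrite mulr1 ler_expR ler_pM2l// ltW//; move: wA; rewrite inE.
rewrite ge0_integralZl//; [|by apply/measurable_EFinP; exact: measurable_indic].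
rewrite integral_indic// setIT => h1.
have fA : P A \is a fin_num by exact: fin_num_measure.
have PE : P A = (fine (P A))%:E by rewrite fineK.
have h2 : ((expR (c * b))%:E * (fine (P A))%:E <= B%:E)%E by rewrite -PE; exact: h1.
rewrite PE lee_fin; move: h2; rewrite -EFinM lee_fin => h2.
by rewrite expRN ler_pdivlMr ?expR_gt0// mulrC.
Qed.

(** The level 2 ln n / c makes each tail of order n^-2, which leaves 1 / n after the union over the
    observations. *)
Lemma whp_truncation : whp P (fun n => [set w | forall a : 'I_n, `|eps f0 X Y a w| <= 2 / c * ln n%:R]).
Proof.
apply: (@whp_bad _ _ _ P (fun n => \bigcup_(a in [set: 'I_n]) [set w | 2 / c * ln n%:R < `|eps f0 X Y a w|])
  _ (fun n => B * (2 * harmonic n))).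
  rewrite -[X in _ --> X](mulr0 B); apply: cvgM; first exact: cvg_cst.
  by rewrite -[X in _ --> X](mulr0 2); apply: cvgM; [exact: cvg_cst|exact: cvg_harmonic].
near=> n; have n1 : (1 < n)%N by near: n; exact: nbhs_infty_gt.
split.
- by apply: fin_bigcup_measurable => [|a _]; [exact: finite_finset|exact: measurable_eps_gt].
- rewrite (_ : [set: 'I_n] = [set` [set: 'I_n]%SET]); last by apply/seteqP; split=> a //=; rewrite inE.
  have n0 : 0 < n%:R :> R by rewrite ltr0n ltnW.
  apply: le_trans (@probability_bigcup_le _ _ _ P _ _ _ (B * n%:R^-1 ^+ 2) 1%E _ _ _ _) _ => //.
  + by move=> a; exact: measurable_eps_gt.
  + by rewrite mulr_ge0.
  + move=> a _; rewrite mule1; apply: le_trans (eps_tail _ _) _; rewrite lee_fin ler_wpM2l//.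
    have -> : c * (2 / c * ln n%:R) = 2 * ln n%:R :> R by field; rewrite lt0r_neq0.
    by rewrite expRN expRM_natl lnK ?posrE// exprVn.
  + have -> : #|[set: 'I_n]%SET|%:R * (B * n%:R^-1 ^+ 2) = B * n%:R^-1.
      by rewrite cardsT card_ord; field; exact: lt0r_neq0.
    rewrite mule1 lee_fin ler_wpM2l// /harmonic /= ler_pdivlMr// mulrC ler_pdivrMr//.
    by rewrite -natrM ler_nat; lia.
- move=> w nb a; rewrite leNgt; apply/negP => h1; apply: nb; by exists a.
Unshelve. all: by end_near.
Qed.

End TruncationEvent.

Section NoiseWhp.
Context {R : realType} {p : nat} {d : measure_display} {T : measurableType d}.
Variables (P : probability T R) (XX : set 'rV[R]_p) (f0 : 'rV[R]_p -> R).
Variables (X : nat -> T -> 'rV[R]_p) (Y : nat -> T -> R).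
Hypothesis hX : forall i w, XX (X i w).
Hypothesis hiid : iid P (fun i w => (X i w, Y i w)).
Hypothesis hYint : P.-integrable setT (EFin \o Y 0%N).
Hypothesis hf0 : cond_expectation P XX (X 0%N) (EFin \o Y 0%N) (EFin \o f0).
Hypothesis cXX : closed XX.
Variable f0_bound : R.
Hypothesis f0_bounded : forall x, XX x -> `|f0 x| <= f0_bound.
Variables (c : R) (h : 'rV[R]_p -> \bar R) (B : R).
Hypotheses (c0 : 0 < c) (B0 : 0 <= B).
Hypothesis hexp : cond_expectation P XX (X 0%N)
  (fun w => (expR (c * `|Y 0%N w - f0 (X 0%N w)|))%:E) h.
Hypothesis hB : forall x, XX x -> (h x <= B%:E)%E.
Variable J : forall n, T -> {ffun 'I_n -> 'I_n}.
Hypothesis hJ : forall n, uniform_resampling P (fun i w => (X i w, Y i w)) (J n).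

(** The tilt is at most c / (8 q) and the truncation level at most 2 q / c, with product 1/4. *)
Lemma small_tilt (E m b q : R) : 0 < m -> 0 < q -> 0 <= b <= 2 / c * q ->
  64 * q ^+ 2 * E <= c ^+ 2 * m -> Num.sqrt (E / m) * b <= 1 / 4.
Proof.
move=> m0 q0 /andP[b0 bq] hE.
have s : Num.sqrt (E / m) <= c / (8 * q).
  rewrite -[leRHS]ger0_norm ?divr_ge0 ?mulr_ge0 ?(ltW c0) ?(ltW q0)// -sqrtr_sqr ler_wsqrtr//.
  rewrite ler_pdivrMr//.
  have -> : (c / (8 * q)) ^+ 2 * m = c ^+ 2 * m / (64 * q ^+ 2) by field; rewrite lt0r_neq0.
  by rewrite ler_pdivlMr ?mulr_gt0 ?exprn_gt0// mulrC.
apply: le_trans (ler_pM (sqrtr_ge0 _) b0 s bq) _.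
by rewrite le_eqVlt; apply/orP; left; apply/eqP; field; rewrite !lt0r_neq0.
Qed.

Lemma failure_cvg0 :
  (4 * ((bits n) ^ 2 + 2)%:R * expR (- (bits n)%:R) : R) @[n --> \oo] --> (0 : R).
Proof.
apply/cvgrPdist_le => e e0.
have [M hM] := @exp_beats_power R 12 3.
near=> n; have qM : M <= (bits n)%:R :> R by near: n; exact: near_bits_ge.
have qe : e^-1 <= (bits n)%:R :> R by near: n; exact: near_bits_ge.
have q1 : 1 <= (bits n)%:R :> R by near: n; exact: near_bits_ge.
move: (hM _ qM) qe q1; rewrite natrD natrX; move: ((bits n)%:R : R) => q h12 qe q1.
have g0 : 0 <= 4 * (q ^+ 2 + 2) * expR (- q) by rewrite !mulr_ge0 ?expR_ge0 ?addr_ge0 ?sqr_ge0.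
rewrite sub0r normrN ger0_norm//.
rewrite expRN ler_pdivrMr ?expR_gt0//.
have eq1 : 1 <= e * q by rewrite mulrC -ler_pdivrMr// mul1r.
apply: (@le_trans _ _ (e * (12 * q ^+ 3))); last by rewrite ler_pM2l.
have -> : e * (12 * q ^+ 3) = e * q * (12 * q ^+ 2) by ring.
apply: (@le_trans _ _ (12 * q ^+ 2)); first nra.
by rewrite ler_peMl// mulr_ge0// sqr_ge0.
Unshelve. all: by end_near.
Qed.

(** The scale n / q is at most of the order of a cell, hence harmless when added to its count; n /
    q^4 is the replacement error of the net. Both exceed the entropies by enough powers of q for the
    truncation at order ln n to leave the tilts admissible. *)
Lemma whp_noise : whp P (fun n => [set w | noise_bounded (J n)
  (fun (i : 'I_n) w => eps f0 X Y i w) (fun (i : 'I_n) w => X i w) (14 * B / c ^+ 2) (bits n)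
  (n%:R / (bits n)%:R) (n%:R / (bits n)%:R ^+ 4) w]).
Proof.
pose good n (Bad : set T) := [/\ measurable Bad,
  (P Bad <= (4 * ((bits n) ^ 2 + 2)%:R * expR (- (bits n)%:R))%:E)%E &
  forall w, (forall a : 'I_n, `|eps f0 X Y a w| <= 2 / c * ln n%:R) -> ~ Bad w ->
    noise_bounded (J n) (fun (i : 'I_n) w => eps f0 X Y i w) (fun (i : 'I_n) w => X i w)
      (14 * B / c ^+ 2) (bits n) (n%:R / (bits n)%:R) (n%:R / (bits n)%:R ^+ 4) w].
have ex : \forall n \near \oo, exists Bad, good n Bad.
  near=> n.
  have n1 : (1 < n)%N by near: n; exact: nbhs_infty_gt.
  have [nq lq _] := @bits_bounds R n n1.
  have pq : (2 * p + 4 <= bits n)%N.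
    by rewrite -(ler_nat R); near: n; exact: near_bits_ge.
  have N1 : p%:R * (bits n)%:R ^+ 6 <= n%:R :> R by near: n; exact: near_bits_power.
  (* 9 = 2 + 3 + 4: two powers for the truncation level, three for the entropies, four for the scale
     n / q^4. *)
  have N2 : (64 * (10 * p.+2%:R) / c ^+ 2) * (bits n)%:R ^+ 9 <= n%:R :> R.
    by near: n; exact: near_bits_power.
  set q := bits n in nq lq pq N1 N2 *.
  have q0 : 0 < q%:R :> R by rewrite ltr0n.
  have q1 : 1 <= q%:R :> R by rewrite ler1n.
  have n0 : 0 < n%:R :> R by rewrite ltr0n ltnW.
  have b0 : 0 <= 2 / c * ln n%:R <= 2 / c * q%:R.
    by rewrite mulr_ge0 ?divr_ge0 ?(ltW c0) ?ln_ge0 ?ler1n ?(ltnW n1)//= ler_wpM2l// divr_ge0// ltW.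
  have cp : 0 <= 10 * p.+2%:R :> R by [].
  have N3 : 64 * (10 * p.+2%:R) * q%:R ^+ 9 <= c ^+ 2 * n%:R.
    by move: N2; rewrite mulrAC ler_pdivrMr ?exprn_gt0// (mulrC n%:R).
  have tilt E m k : E <= 10 * p.+2%:R * q%:R ^+ 3 -> (k <= 4)%N -> m = n%:R / q%:R ^+ k ->
      Num.sqrt (E / m) * (2 / c * ln n%:R) <= 1 / 4.
    move=> hE k4 ->; apply: (small_tilt (q := q%:R)) => //; first by rewrite divr_gt0 ?exprn_gt0.
    rewrite [leRHS]mulrA ler_pdivlMr ?exprn_gt0//; apply: le_trans N3.
    apply: (@le_trans _ _ (64 * q%:R ^+ 2 * (10 * p.+2%:R * q%:R ^+ 3) * q%:R ^+ 4)); last first.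
      by rewrite le_eqVlt; apply/orP; left; apply/eqP; ring.
    have h1 : 64 * q%:R ^+ 2 * E <= 64 * q%:R ^+ 2 * (10 * p.+2%:R * q%:R ^+ 3).
      by rewrite ler_wpM2l// mulr_ge0// exprn_ge0.
    apply: (le_trans (ler_wpM2r (exprn_ge0 _ (ltW q0)) h1)).
    by rewrite ler_wpM2l ?ler_weXn2l// !mulr_ge0 ?exprn_ge0.
  apply: (noise_event (fun j => (@hJ n j).1)).
  - by move=> a; exact: measurable_eps hX hiid hf0 cXX a.
  - by rewrite divr_ge0 ?sqr_ge0// mulr_ge0.
  - by move=> H; exact: (measurable_AX hiid (@jointly_measurable_traces _ _ _ H)).
  - move=> H S t y tb; have := noise_chernoff hX hiid hYint hf0 cXX f0_bounded c0 B0 hexp hB (ltnW n1)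
      (@hJ n) (@jointly_measurable_traces _ _ _ H) S y tb.
    by move=> /le_trans; apply; rewrite lee_wpmul2r// lee_fin ler_expR le_eqVlt; apply/orP; left;
      apply/eqP; field; exact: lt0r_neq0.
  - by move=> H S t y; exact: (count_chernoff hiid (ltnW n1) (@hJ n) (@jointly_measurable_traces _ _ _ H) S t y).
  - exact: nq.
  - exact: pq.
  - by rewrite divr_gt0.
  - by rewrite mulrC divfK// expf_neq0// lt0r_neq0.
  - rewrite ler_pdivlMr ?exprn_gt0//; apply: le_trans N1.
    by rewrite natrM natrX le_eqVlt; apply/orP; left; apply/eqP; ring.
  - apply: (tilt _ _ 1%N) => //.
    rewrite /entropy.
    have lnqq : ln q%:R <= q%:R :> R.
      by have := @le_ln1Dx R (q%:R - 1); rewrite addrCA subrr addr0; lra.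
    have h1 : (9 * p.+1 * q ^ 2)%:R * ln q%:R <= 9 * p.+1%:R * q%:R ^+ 3 :> R.
      have -> : 9 * p.+1%:R * q%:R ^+ 3 = 9 * p.+1%:R * q%:R ^+ 2 * q%:R :> R by ring.
      by rewrite natrM natrX natrM ler_wpM2l// mulr_ge0// exprn_ge0.
    have h2 : q%:R <= p.+2%:R * q%:R ^+ 3 :> R.
      have q3 : q%:R <= q%:R ^+ 3 :> R by rewrite exprS ler_peMr ?exprn_ege1// ltW.
      by apply: (le_trans q3); rewrite ler_peMl ?exprn_ge0 ?ler1n// ltW.
    have h3 : p.+1%:R * q%:R ^+ 3 <= p.+2%:R * q%:R ^+ 3 :> R.
      by rewrite ler_wpM2r ?exprn_ge0 ?ler_nat// ltW.
    by move: h1 h2 h3; lra.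
  - apply: (tilt _ _ 4%N) => //.
    by rewrite /entropy2 natrM natrX ler_wpM2r ?exprn_ge0//; lra.
(* For small [n] no such event need exist, and the choice is arbitrary there. *)
have /choice[Bad BadP] : forall n, exists Bad, (exists Bad', good n Bad') -> good n Bad.
  by move=> n; have [[Bad hBad]|no] := pselect (exists Bad', good n Bad'); [exists Bad|exists set0].
apply: whp_sub (whp_and (whp_truncation hX hiid hf0 cXX c0 B0 hexp hB)
  (@whp_bad _ _ _ P Bad (fun n => ~` Bad n) _ failure_cvg0 _)).
  near=> n; move=> w [hw nB].
  have [_ _] : good n (Bad n) by apply: BadP; near: n.
  by apply.
near=> n; have [mB PB _] : good n (Bad n) by apply: BadP; near: n.
by split.
Unshelve. all: by end_near.
Qed.

End NoiseWhp.

Section Preliminaries.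
Context {R : realType} {p : nat}.

Lemma compact_norm2_bounded (XX : set 'rV[R]_p) : compact XX ->
  exists Delta : R, forall x y, XX x -> XX y -> norm2 (x - y) <= Delta.
Proof.
move=> /compact_bounded [M0 [_ hM]]; exists (2 * (Num.sqrt p%:R * (M0 + 1))) => x y Xx Xy.
have hx u : XX u -> norm2 u <= Num.sqrt p%:R * (M0 + 1).
  move=> Xu; apply: norm2_le_coord => j; apply: le_trans (hM (M0 + 1) _ u Xu); last by rewrite ltrDl.
  rewrite (_ : `|u| = mx_norm u)// mx_normrE.
  exact: (le_bigmax _ (fun ij : 'I_1 * 'I_p => `|u ij.1 ij.2|) (ord0, j)).
by rewrite (le_trans (norm2D _ _))// norm2N mulr_natl mulr2n lerD ?hx.
Qed.

(** [nmin] is at least n / (D q), whereas a small set of data points occupies a number of places in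
    the bag of order n / q^4 + q^3: even with repetitions it cannot fill a cell. *)
Lemma count_budget (n q k : nat) (D : R) : 0 < D -> (1 < n)%N -> (0 < q)%N -> ln n%:R <= q%:R :> R ->
  8 * D <= q%:R -> 16 * D * k%:R * q%:R ^+ 4 <= n%:R ->
  2 * (n%:R / q%:R ^+ 4) + 4 * (k * q ^ 3)%:R < @nmin R p D n.
Proof.
move=> D0 n1 q0 lq Dq kq.
have l0 : 0 < ln n%:R :> R by apply: ln_gt0; rewrite ltr1n.
have q1 : 1 <= q%:R :> R by rewrite ler1n.
have qR : 0 < q%:R :> R by exact: lt_le_trans q1.
have n0 : 0 < n%:R :> R by rewrite ltr0n ltnW.
apply: (@lt_le_trans _ _ (n%:R / (D * q%:R))); last first.
  rewrite /nmin le_max; apply/orP; left; rewrite ler_wpM2l ?ler0n// lef_pV2 ?posrE ?mulr_gt0//.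
  by rewrite ler_pM2l.
set x : R := n%:R / (D * q%:R); have x0 : 0 < x by rewrite divr_gt0 ?mulr_gt0.
have h1 : 2 * (n%:R / q%:R ^+ 4) <= x / 4.
  have -> : 2 * (n%:R / q%:R ^+ 4) = x / 4 * (8 * D / q%:R ^+ 3).
    by rewrite /x; field; rewrite !lt0r_neq0.
  have x4 : 0 <= x / 4 by rewrite divr_ge0 ?ltW.
  apply: ler_piMr => //; rewrite ler_pdivrMr ?exprn_gt0// mul1r.
  by apply: le_trans Dq _; rewrite exprS ler_peMr ?exprn_ege1// ltW.
have h2 : 4 * (k * q ^ 3)%:R <= x / 4.
  rewrite natrM natrX /x -mulrA -invfM ler_pdivlMr ?mulr_gt0//; apply: le_trans kq.
  by rewrite le_eqVlt; apply/orP; left; apply/eqP; ring.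
by move: h1 h2 x0; lra.
Qed.

End Preliminaries.

(** * Consistency of a single bagged estimator *)

Section Convergence.
Context {R : realType} {p M : nat} {d : measure_display} {T : measurableType d}.
Variables (P : probability T R) (XX : set 'rV[R]_p) (f0 : 'rV[R]_p -> R).
Variables (X : nat -> T -> 'rV[R]_p) (Y : nat -> T -> R).
Hypothesis hX : forall i w, XX (X i w).
Hypothesis hiid : iid P (fun i w => (X i w, Y i w)).
Hypothesis hYint : P.-integrable setT (EFin \o Y 0%N).
Hypothesis hf0 : cond_expectation P XX (X 0%N) (EFin \o Y 0%N) (EFin \o f0).
Hypotheses (hXXconvex : convex_set XX) (hf0convex : convex_function XX f0).
Variables (L : nat) (a : 'I_L -> R) (D : R) (ls : solver R p) (tb : seq nat -> nat).
Variable crit : forall n, dataset R p n -> seq (set 'rV[R]_p) -> R.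
Hypotheses (hD : 0 < D) (hls : least_squares_solver ls) (htb : forall s, s != [::] -> tb s \in s).
Variables (J : forall n, T -> {ffun 'I_n -> 'I_n}) (As : forall n : nat, T -> seq (set 'rV[R]_p)).
Hypothesis hJ : forall n, uniform_resampling P (fun i w => (X i w, Y i w)) (J n).
Hypothesis hAs : forall n w, cap_partition XX a D ls tb crit (bagged X Y (J n) w) (As n w).
Hypotheses (hcompact : compact XX) (hC1 : continuously_differentiable_on XX f0).
Variables (f0_bound Delta : R).
Hypothesis f0_bounded : forall x, XX x -> `|f0 x| <= f0_bound.
Hypothesis bX : forall x y, XX x -> XX y -> norm2 (x - y) <= Delta.
Variables (c : R) (h : 'rV[R]_p -> \bar R) (B : R).
Hypotheses (c0 : 0 < c) (B0 : 0 <= B).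
Hypothesis hexp : cond_expectation P XX (X 0%N)
  (fun w => (expR (c * `|Y 0%N w - f0 (X 0%N w)|))%:E) h.
Hypothesis hB : forall x, XX x -> (h x <= B%:E)%E.
Hypothesis hdiam : cvg_in_prob P (fun n w => max_diameter (As n w)) 0.
Hypothesis hlambda : bounded_away_from_0_in_prob P
  (fun n w => min_lambda (bagged X Y (J n) w) (As n w)).
Hypothesis hsize : cvg_pinfty_in_prob P
  (fun n w => min_scaled_size (bagged X Y (J n) w) (As n w)).

Let cXX : closed XX. Proof. by apply: compact_closed hcompact; exact: norm_hausdorff. Qed.

Lemma covariate_hyperplane_null (v : 'rV[R]_p) (b : R) : v != 0 ->
  P (X 0%N @^-1` ((fun x => dotv v x) @^-1` [set b])) = 0%E.
Proof.
move=> v0; have [l l0 hl] := hlambda; have N0 : 0 < norm2 v by rewrite norm2_gt0.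
apply: (hyperplane_null hiid hJ l0) => eta eta0.
(* The threshold 0 in A5 makes every cell nonempty with positive diameter, which is all that is
   needed here. *)
apply: whp_sub (whp_and (hdiam (divr_gt0 eta0 N0)) (whp_and hl (hsize 0))).
near=> n; move=> w [hd [hl' hs]] /=.
have n1 : (1 < n)%N by near: n; exact: nbhs_infty_gt.
have part := cap_partition_disjoint htb (hAs n w); have [_ sub _] := part.
have ln0 : 0 < ln n%:R :> R by apply: ln_gt0; rewrite ltr1n.
have hd' : max_diameter (As n w) <= eta / norm2 v.
  by move: hd => /=; rewrite subr0; apply: le_trans; exact: ler_norm.
have cells A : A \in As n w -> [/\ (0 < #|obs (bagged X Y (J n) w) A|)%N, 0 < diameter A,
    diameter A <= eta / norm2 v & l <= lambda_cell (bagged X Y (J n) w) A].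
  by move=> AAs; have [] := regular_cells bX sub ln0 (lexx _) hd' hl' hs AAs.
have := @hyperplane_count R p n XX (bagged X Y (J n) w) (As n w) l (eta / norm2 v) Delta bX part
  (fun i => hX (J n w i) w) cells v b (ltW l0) v0.
by have -> : norm2 v * (eta / norm2 v) = eta by rewrite mulrC divfK// lt0r_neq0.
Unshelve. all: by end_near.
Qed.

Lemma whp_general_position : whp P (fun n => [set w | forall (v : 'rV[R]_p) (b : R), v != 0 ->
  (#|finset (fun i : 'I_n => dotv v (X i w) == b)| <= p)%N]).
Proof.
have /choice[Bad BadP] := general_position hiid covariate_hyperplane_null.
apply: (@whp_bad _ _ _ P Bad _ (fun=> 0)); first exact: cvg_cst.
by apply: nearW => n; have [mB PB hBad] := BadP n; split; rewrite ?PB.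
Qed.

Lemma cap_estimator_consistent (e : R) : 0 < e -> whp P (fun n => [set w |
  forall u, XX u -> `|cap_fun ls (bagged X Y (J n) w) (As n w) u - f0 u| <= e]).
Proof.
move=> e0; have [g [cg dg]] := hC1; have [l l0 hl] := hlambda.
have tang := tangent_le hXXconvex hf0convex dg.
have sp0 : 0 <= Num.sqrt p%:R :> R by exact: sqrtr_ge0.
pose De := Num.max Delta 0.
have De0 : 0 <= De by rewrite le_max lexx orbT.
have bX' x y : XX x -> XX y -> norm2 (x - y) <= De by move=> Xx Xy; rewrite le_max bX.
(* The error bound of [sample_close] per unit of tolerance, when [ups] and [del] both equal [u] and
   [eta] is at most 1. *)
pose Kc := 3 + (1 + 4 * Num.sqrt p%:R) / l * (De + 1).
have Kc0 : 0 < Kc by rewrite ltr_pwDl// mulr_ge0 ?divr_ge0 ?addr_ge0 ?mulr_ge0// ltW.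
pose u := e / Kc; have u0 : 0 < u by rewrite divr_gt0.
have [eta0 eta00 ug0] := uniform_gradient cg hcompact u0.
pose eta := Num.min eta0 1; have eta_gt0 : 0 < eta by rewrite lt_min eta00 ltr01.
have eta_le1 : eta <= 1 by rewrite ge_min lexx orbT.
have ug x y : XX x -> XX y -> norm2 (y - x) <= eta -> norm2 (g y - g x) <= u.
  by move=> Xx Xy; rewrite le_min => /andP[h1 _]; exact: ug0.
pose K := 14 * B / c ^+ 2; have K0 : 0 <= K by rewrite divr_ge0 ?sqr_ge0// mulr_ge0.
pose del' := (u / (2 * (K + 2))) ^+ 2.
have del'0 : 0 < del' by rewrite exprn_gt0// divr_gt0// mulr_gt0// ltr_wpDl.
(* A5 is available at every threshold; this one makes the noise budget meet the tolerance [u]. *)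
pose t := Num.max 1 (Num.max (4 * (1 + D) * (27 * p.+1%:R * (1 + D) + 4) / del') (18 * p.+2%:R * D / del')).
have t0 : 0 < t by rewrite lt_max ltr01.
have tune1 : 4 * (1 + D) * (27 * p.+1%:R * (1 + D) + 4) / t <= del'.
  rewrite ler_pdivrMr// [leRHS]mulrC -ler_pdivrMr//.
  by rewrite /t !le_max lexx !orbT.
have tune2 : 18 * p.+2%:R * D <= del' * t.
  rewrite [leRHS]mulrC -ler_pdivrMr//.
  by rewrite /t !le_max lexx !orbT.
pose c1 := 2 * (Num.sqrt p%:R + 1) / l.
have c10 : 0 <= c1 by rewrite divr_ge0 ?mulr_ge0 ?addr_ge0// ltW.
apply: whp_sub (whp_and (whp_and (hdiam eta_gt0) (whp_and hl (hsize t)))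
  (whp_and (whp_noise hX hiid hYint hf0 cXX f0_bounded c0 B0 hexp hB hJ) whp_general_position)).
near=> n; move=> w [[hd [hl' hs]] [nb gp]] v Xv.
have n1 : (1 < n)%N by near: n; exact: nbhs_infty_gt.
have tau1 : 1 <= ln (ln n%:R) :> R by near: n; exact: near_lnln_ge.
have ell1 : 1 <= ln n%:R :> R by near: n; exact: near_ln_ge.
have Dell : D^-1 <= ln n%:R :> R by near: n; exact: near_ln_ge.
have [_ lq ql] := @bits_bounds R n n1.
have q16 : (16 <= bits n)%N by rewrite -(ler_nat R); near: n; exact: near_bits_ge.
have qD : 8 * D <= (bits n)%:R :> R by near: n; exact: near_bits_ge.
have qpD : 2 * p%:R + D + 1 <= (bits n)%:R :> R by near: n; exact: near_bits_ge.
have power_le : (2 * p + 1)%:R * ln (ln n%:R) + ln (ln n%:R) * (c1 * ln (ln n%:R) + 1) ^+ p <= ln n%:R.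
  by near: n; exact: near_lnln_power.
have N1 : (112 * p.+2)%:R * (bits n)%:R ^+ 4 <= n%:R :> R by near: n; exact: near_bits_power.
have N2 : 16 * D * p.+2%:R * (bits n)%:R ^+ 4 <= n%:R :> R by near: n; exact: near_bits_power.
have q0 : (0 < bits n)%N by [].
have hd' : max_diameter (As n w) <= eta.
  by move: hd => /=; rewrite subr0; apply: le_trans; exact: ler_norm.
have fullT : finset.setT \in traces (fun i : 'I_n => X i w).
  by apply/tracesP; exists 0, (-1) => i; rewrite finset.in_setT dotv0l ltrN10.
have count_small (V : {set 'I_n}) : (#|V| <= p * (bits n) ^ 2)%N ->
    #|finset (fun i => J n w i \in V)|%:R < @nmin R p D n.
  (* The list with the full trace only is a dummy: what is used is the bound on the count of [V]. *)
  move=> cV; have [] := nb [:: finset.setT] _ _ V cV.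
  - by rewrite /= expn_gt0.
  - by move=> S; rewrite inE => /eqP ->.
  - by move=> _ /le_lt_trans; apply; exact: count_budget.
have size_ok (k : nat) : k%:R <= D * ln n%:R -> (2 * p + k < (bits n) ^ 2)%N.
  move=> hk; rewrite -(ltr_nat R) natrD natrM natrX.
  have h1 : D * ln n%:R <= D * (bits n)%:R by rewrite ler_pM2l.
  have q1 : 1 <= (bits n)%:R :> R by rewrite ler1n.
  have p0 : 0 <= p%:R :> R by [].
  move: hk h1 qpD q1 hD p0; move: ((bits n)%:R : R) (ln n%:R : R) => q' l'; nra.
have := @sample_close R p XX f0 g ls L a D tb crit htb n (J n w) (fun i => X i w) (fun i => Y i w)
  (As n w) (bits n) K l t eta u u del' De hls hXXconvex tang ug bX' (fun i => hX _ _) hD K0 t0 l0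
  (ltW u0) u0 (ltnW n1) tau1 ell1.
have Dell1 : 1 <= D * ln n%:R by rewrite mulrC -ler_pdivrMr// div1r.
have n_large : (112 * p.+2 * bits n ^ 4)%:R <= n%:R :> R by rewrite natrM natrX.
move=> /(_ Dell1 ql lq q16 power_le n_large size_ok count_small gp).
move=> /(_ (fun s s1 s2 V cV => (nb s s1 s2 V cV).1) (hAs n w) hd' hl' hs erefl tune1 tune2 v Xv).
move=> /le_trans; apply.
have lD : (u + 4 * Num.sqrt p%:R * u) / l * (De + eta) <= u * ((1 + 4 * Num.sqrt p%:R) / l * (De + 1)).
  have -> : (u + 4 * Num.sqrt p%:R * u) / l = u * ((1 + 4 * Num.sqrt p%:R) / l) by ring.
  by rewrite -mulrA ler_wpM2l ?(ltW u0)// ler_wpM2l ?lerD2l// divr_ge0 ?addr_ge0 ?mulr_ge0// ltW.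
have eE : e = u * Kc by rewrite /u divfK// lt0r_neq0.
rewrite eE /Kc [leRHS]mulrDr; apply: lerD => //.
have -> : 2 * u + u = u * 3 by ring.
by rewrite ler_piMr// mulr_ge0// ltW.
Unshelve. all: by end_near.
Qed.

End Convergence.

Theorem theorem3p2
  (R : realType) (p M : nat) (hM : (0 < M)%N)
  (d : measure_display) (T : measurableType d) (P : probability T R)
  (* the set X, the regression function and the data *)
  (XX : set 'rV[R]_p) (f0 : 'rV[R]_p -> R)
  (X : nat -> T -> 'rV[R]_p) (Y : nat -> T -> R)
  (hX : forall i w, XX (X i w))
  (hiid : iid P (fun i w => (X i w, Y i w)))
  (hYint : P.-integrable setT (EFin \o Y 0%N))
  (hf0 : cond_expectation P XX (X 0%N) (EFin \o Y 0%N) (EFin \o f0))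
  (hXXconvex : convex_set XX) (hf0convex : convex_function XX f0)
  (* parameters of the CAP algorithm *)
  (L : nat) (hL : (0 < L)%N) (a : 'I_L -> R) (ha : evenly_spaced_knots a)
  (D : R) (hD : 0 < D)
  (ls : solver R p) (hls : least_squares_solver ls)
  (tb : seq nat -> nat) (htb : forall s, s != [::] -> tb s \in s)
  (crit : forall n, dataset R p n -> seq (set 'rV[R]_p) -> R)
  (* bagged training sets and the partitions of the estimators *)
  (J : forall n, 'I_M -> T -> {ffun 'I_n -> 'I_n})
  (hJ : forall n m, uniform_resampling P (fun i w => (X i w, Y i w)) (J n m))
  (As : forall n, 'I_M -> T -> seq (set 'rV[R]_p))
  (hAs : forall n m w,
    cap_partition XX a D ls tb crit (bagged X Y (J n m) w) (As n m w))
  (* finite conditional second moment *)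
  (hY2 : exists2 h : 'rV[R]_p -> \bar R,
    cond_expectation P XX (X 0%N) (fun w => (Y 0%N w ^+ 2)%:E) h
    & {ae P, forall w, (h (X 0%N w) < +oo)%E})
  (* A1 *)
  (hcompact : compact XX)
  (zeta : R) (hlip : lipschitz_on2 zeta XX f0)
  (hC1 : continuously_differentiable_on XX f0)
  (* A2 *)
  (hexp : exists2 c : R, 0 < c & exists2 h : 'rV[R]_p -> \bar R,
    cond_expectation P XX (X 0%N)
      (fun w => (expR (c * `|Y 0%N w - f0 (X 0%N w)|))%:E) h
    & exists B : R, forall x, XX x -> (h x <= B%:E)%E)
  (* A3 *)
  (hdiam : forall m,
    cvg_in_prob P (fun n w => max_diameter (As n m w)) 0)
  (* A4 *)
  (hlambda : forall m, bounded_away_from_0_in_prob P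
    (fun n w => min_lambda (bagged X Y (J n m) w) (As n m w)))
  (* A5 *)
  (hsize : forall m, cvg_pinfty_in_prob P
    (fun n w => min_scaled_size (bagged X Y (J n m) w) (As n m w))) :
  cvg_in_prob P
    (fun n w => sup
      [set `|M%:R^-1 * (\sum_(m < M)
                cap_fun ls (bagged X Y (J n m) w) (As n m w) x) - f0 x|
        | x in XX])
    0.
Proof.
move: hexp => [c c0 [h hh [B0 hB0]]]; pose B := Num.max B0 0.
have [Delta bX] := compact_norm2_bounded hcompact.
(* A probability space is nonempty, which provides a point of [XX]; the Lipschitz condition and the
   bounded diameter of [XX] then bound [f0]. *)
have [w0 _] : exists w : T, True.
  apply: contrapT => no; have := probability_setT P.
  have -> : [set: T] = set0 by rewrite -subset0 => w _; apply: no; exists w.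
  by rewrite measure0 => /esym/eqP; rewrite onee_eq0.
have f0_bounded x : XX x -> `|f0 x| <= `|f0 (X 0%N w0)| + `|zeta| * Delta.
  move=> Xx; rewrite -[f0 x](subrK (f0 (X 0%N w0))) addrC (le_trans (ler_normD _ _))// lerD2l.
  rewrite (le_trans (hlip _ _ Xx (hX _ _)))//; apply: le_trans (ler_wpM2l (normr_ge0 _) (bX _ _ Xx (hX 0%N w0))).
  by rewrite ler_wpM2r ?norm2_ge0// ler_norm.
have B00 : 0 <= B by rewrite le_max lexx orbT.
have hB x : XX x -> (h x <= B%:E)%E.
  by move=> /hB0 /le_trans; apply; rewrite lee_fin le_max lexx.
have cons m := cap_estimator_consistent hX hiid hYint hf0 hXXconvex hf0convex hD hls htb
  (fun n => hJ n m) (fun n => hAs n m) hcompact hC1 f0_bounded bX c0 B00 hh hB (hdiam m) (hlambda m) (hsize m).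
move=> e e0; apply: whp_sub (whp_forall (fun m => cons m e e0)); apply: nearW => n w hw /=.
rewrite subr0; set S := [set _ | _ in _].
have SE y : S y -> 0 <= y <= e.
  move=> [x Xx <-]; rewrite normr_ge0 /=.
  have M0 : 0 < M%:R :> R by rewrite ltr0n.
  have -> : f0 x = M%:R^-1 * (\sum_(m < M) f0 x).
    by rewrite sumr_const card_ord -[f0 x *+ M]mulr_natl mulKf// lt0r_neq0.
  rewrite -mulrBr -sumrB normrM ger0_norm ?invr_ge0 ?(ltW M0)// ler_pdivrMl//.
  apply: le_trans (ler_norm_sum _ _ _) _; apply: (@le_trans _ _ (\sum_(m < M) e)).
    by apply: ler_sum => m _; exact: hw.
  by rewrite sumr_const card_ord mulr_natl.
have Sne : S !=set0 by exists `|M%:R^-1 * (\sum_(m < M) cap_fun ls (bagged X Y (J n m) w) (As n m w) (X 0%N w)) - f0 (X 0%N w)|; exists (X 0%N w).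
have ubS : ubound S e by move=> y /SE /andP[].
rewrite ger0_norm; first exact: ge_sup.
have [y Sy] := Sne; have /andP[y0 _] := SE y Sy.
by apply: le_trans y0 _; apply: ub_le_sup => //; exists e.
Qed.
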